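(* Assume that, for every continuous $k:Y\times\hat U\to\mathbb R$, the pointwise limit $v(y_0)=\lim_{T\to\infty}v_T(y_0)$ exists for every $y_0\in Y$ and the limit function $v(\cdot)$ is continuous on $Y$. Then, for every $y_0\in Y$, $$\lim_{T\to\infty}\rho_H\big(\overline{\mathrm{co}}\,\Gamma_T(y_0),\,W\cap D_1(y_0)\big)=0,$$ where $\overline{\mathrm{co}}$ denotes the (weak$^*$) closed convex hull.
   Context: Model. $Y\subset\mathbb R^n$ is a nonempty compact set, $\hat U$ is a compact metric space, $S$ is a Polish space. The function $f:Y\times\hat U\times S\to\mathbb R^n$ is bounded, continuous in $(y,u)$ on $Y\times\hat U$ and Borel measurable in $s$ on $S$. The $S$-valued random elements $s(0),s(1),\dots$ are independent and identically distributed on a common probability space; $s$ denotes a generic random element with the same distribution, and $E[\varphi(f(y,u,s))]$ is the expectation over $s$ with $(y,u)$ fixed. $U(\cdot)$ is an upper semicontinuous multivalued map from $Y$ to nonempty compact subsets of $\hat U$, and $f(y,u,s)\in Y$ for all $y\in Y$, $u\in U(y)$, $s\in S$. $G:=\{(y,u): y\in Y,\ u\in U(y)\}$ (a compact set). $\Pi$ is the set of control plans $\pi=\{\pi_t(\cdot)\}_{t=0,1,\dots}$, where each $\pi_t:Y\to\hat U$ is Borel measurable with $\pi_t(y)\in U(y)$ for all $y\in Y$. For $\pi\in\Pi$ and $y_0\in Y$, the state-control trajectory $(y^{\pi,y_0}(\cdot),u^{\pi,y_0}(\cdot))$ is defined by $y(0)=y_0$, $u(t)=\pi_t(y(t))$,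 $y(t+1)=f(y(t),u(t),s(t))$. For continuous $k:Y\times\hat U\to\mathbb R$ and $T=1,2,\dots$, $$v_T(y_0):=\frac1T\min_{\pi\in\Pi}E\Big[\sum_{t=0}^{T-1}k(y^{\pi,y_0}(t),u^{\pi,y_0}(t))\Big]$$ (which depends on $k$). $\mathcal P(G)$, $\mathcal M_+(G)$, $\mathcal M(G)$ are the sets of probability, finite nonnegative, and finite signed measures on Borel subsets of $G$; $C(Y)$, $C(G)$ are spaces of continuous functions. For Borel $Q\subset G$, $\gamma^{\pi,y_0,T}(Q):=\frac1T E[\sum_{t=0}^{T-1}1_Q(y^{\pi,y_0}(t),u^{\pi,y_0}(t))]$, and $\Gamma_T(y_0):=\{\gamma^{\pi,y_0,T}:\pi\in\Pi\}$. $$W:=\Big\{\gamma\in\mathcal P(G):\int_G\big(E[\varphi(f(y,u,s))]-\varphi(y)\big)\gamma(dy,du)=0\ \forall\varphi\in C(Y)\Big\}.$$ $D_1(y_0)$ is the set of $\gamma\in\mathcal M(G)$ for which there exist $\xi_l\in\mathcal M_+(G)$, $l=1,2,\dots$, such that $$\int_G(\varphi(y)-\varphi(y_0))\gamma(dy,du)=\lim_{l\to\infty}\int_G\big(E[\varphi(f(y,u,s))]-\varphi(y)\big)\xi_l(dy,du)\quad\forall\varphi\in C(Y).$$ Metric. $\rho(\gamma',\gamma''):=\sum_{j\ge1}2^{-j}\big|\int_G q_j\,d\gamma'-\int_G q_j\,d\gamma''\big|$, where $(q_j)_{j\ge1}$ is a fixed sequence of Lipschitz continuous functions dense in the unit ball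 of $C(G)$; it metrizes the weak$^*$ topology on $\mathcal P(G)$. For $\Gamma_1,\Gamma_2\subset\mathcal P(G)$, $\rho(\gamma,\Gamma_i):=\inf_{\gamma'\in\Gamma_i}\rho(\gamma,\gamma')$ and $\rho_H(\Gamma_1,\Gamma_2):=\max\{\sup_{\gamma\in\Gamma_1}\rho(\gamma,\Gamma_2),\sup_{\gamma\in\Gamma_2}\rho(\gamma,\Gamma_1)\}$. *)

(* Defs.v *)
From HB Require Import structures.
From mathcomp Require Import all_boot all_order all_algebra finmap.
From mathcomp Require Import all_classical all_reals all_analysis.

Set Implicit Arguments.
Unset Strict Implicit.
Unset Printing Implicit Defensive.

Import Order.TTheory GRing.Theory Num.Theory.
Import numFieldNormedType.Exports.

Local Open Scope classical_set_scope.
Local Open Scope ring_scope.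

(* The library's measurable types are pointed, so the spaces carrying Borel
   sigma-algebras below are pointed as well, that is, nonempty. *)
#[short(type="pmetricType")]
HB.structure Definition PointedMetric (R : numDomainType) :=
  { M of Metric R M & isPointed M }.

HB.instance Definition _ (T T' : ptopologicalType) :=
  Pointed.on (T * T')%type.

Notation borel T := (g_sigma_algebraType (@open T)).

Section polish.
Variables (R : realType) (T : topologicalType).

Definition metrizes (dist : T -> T -> R) : Prop :=
  [/\ forall x y, dist x y = 0 <-> x = y,
      forall x y, dist x y = dist y x,
      forall x y z, dist x z <= dist x y + dist y z &
      forall x (A : set T),
        nbhs x A <-> exists2 e, 0 < e & [set y | dist x y < e] `<=` A].

Definition complete_dist (dist : T -> T -> R) : Prop :=
  forall u : nat -> T,
    (forall e : R, 0 < e -> exists N, forall i j,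
      (N <= i)%N -> (N <= j)%N -> dist (u i) (u j) < e) ->
    exists l : T, u @ \oo --> l.

Definition polish_space : Prop :=
  (exists2 D : set T, countable D & dense D) /\
  (exists2 dist : T -> T -> R, metrizes dist & complete_dist dist).

End polish.

Section iid.
Context (d d' : measure_display) (Omega : measurableType d)
  (S : measurableType d') (R : realType) (P : probability Omega R).
Variable s : nat -> {RV P >-> S}.

Definition identically_distributed : Prop :=
  forall (t : nat) (A : set S), measurable A ->
    distribution P (s t) A = distribution P (s 0%N) A.

Definition mutually_independent : Prop :=
  forall (J : {fset nat}) (A : nat -> set S), (forall j, measurable (A j)) ->
    P (\bigcap_(j in [set` J]) (s j @^-1` A j)) =
    (\prod_(j <- J) P (s j @^-1` A j))%E.

Definition iid : Prop := identically_distributed /\ mutually_independent.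

End iid.

Definition upper_semicontinuous_on (T T' : topologicalType) (Y : set T)
    (U : T -> set T') : Prop :=
  forall y, Y y -> forall V, open V -> U y `<=` V ->
    \forall y' \near within Y (nbhs y), U y' `<=` V.

(* Measures on the Borel subsets of G are represented by Borel measures on the
   ambient space X that vanish outside of G. *)
Section measures_on.
Context (R : realType) (X : ptopologicalType) (G : set X).

Record prob_on := ProbOn {
  prob_on_measure :> probability (borel X) R;
  prob_on_supp : prob_on_measure (~` G) = 0%E }.

HB.instance Definition _ := gen_eqMixin prob_on.
HB.instance Definition _ := gen_choiceMixin prob_on.

Definition continuous_on := {h : X -> R | {within G, continuous h}}.

HB.instance Definition _ := gen_eqMixin continuous_on.
HB.instance Definition _ := gen_choiceMixin continuous_on.

Definition prob_eval (gamma : prob_on) :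
    prod_topology (fun _ : continuous_on => R) :=
  fun h => \int[gamma]_(z in G) sval h z.

(* the weak* topology on the probability measures on G *)
HB.instance Definition _ :=
  Topological.copy prob_on (initial_topology prob_eval).

(* A measure is a function on all sets, of which only the values at measurable
   sets matter; the hull is therefore closed under equality on measurable
   sets. *)
Definition convex_hull (A : set prob_on) : set prob_on :=
  [set gamma | exists (m : nat) (w : 'I_m -> R) (g : 'I_m -> prob_on),
    [/\ forall i, 0 <= w i, \sum_i w i = 1, forall i, A (g i) &
        forall Q : set (borel X), measurable Q ->
          gamma Q = (\sum_i (w i)%:E * g i Q)%E]].

Definition closed_convex_hull (A : set prob_on) : set prob_on :=
  closure (convex_hull A).

Definition finite_measure_on (xi : {finite_measure set (borel X) -> \bar R}) :=
  xi (~` G) = 0%E.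

Definition charge_on (nu : {charge set (borel X) -> \bar R}) : Prop :=
  forall A : set (borel X), measurable A -> A `<=` ~` G -> nu A = 0%E.

End measures_on.

Section charge_integral.
Context (d : measure_display) (T : measurableType d) (R : realType).

(* integral against the Jordan decomposition of nu *)
Definition charge_integral (nu : {charge set T -> \bar R}) (D : set T)
    (h : T -> R) : R :=
  let P := cid (Hahn_decomposition nu) in
  let N := cid (projT2 P) in
  \int[jordan_pos (projT2 N)]_(z in D) h z -
  \int[jordan_neg (projT2 N)]_(z in D) h z.

Lemma charge_integral_finite_measure
    (mu : {finite_measure set T -> \bar R}) (D : set T) (h : T -> R) :
  charge_integral (charge_of_finite_measure mu) D h = \int[mu]_(z in D) h z.
Proof.
pose nu : {charge set T -> \bar R} := charge_of_finite_measure mu.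
have N0 P N (PN : hahn_decomposition nu P N) A :
    measurable A -> nu (A `&` N) = 0%E.
  have [_ [mN negN] _ _] := PN; move=> mA; apply/eqP.
  rewrite eq_le (negN _ (measurableI _ _ mA mN) (@subIsetr _ _ _)) /=.
  exact: measure_ge0.
have posE P N (PN : hahn_decomposition nu P N) A :
    measurable A -> jordan_pos PN A = mu A.
  have [[mP _] [mN _] PUN PN0] := PN => mA.
  rewrite jordan_posE cjordan_posE /crestr0 mem_set//= /crestr.
  rewrite -[in RHS](setIT A) -PUN setIUr measureU.
  - exact: (esym (etrans (congr1 (adde _) (N0 _ _ PN _ mA)) (adde0 _))).
  - exact: measurableI.
  - exact: measurableI.
  - by rewrite setIACA PN0 setI0.
have negE P N (PN : hahn_decomposition nu P N) A :
    measurable A -> jordan_neg PN A = 0%E.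
  move=> mA; rewrite jordan_negE cjordan_negE /crestr0 mem_set//= /crestr.
  by rewrite (N0 _ _ PN _ mA) oppe0.
rewrite /charge_integral -[RHS]subr0; congr (_ - _).
  by congr fine; apply: eq_measure_integral => A mA _; exact: posE.
rewrite /Rintegral (_ : integral _ _ _ = 0%E) //.
rewrite -(integral_measure_zero D (fun z => (h z)%:E)).
by apply: eq_measure_integral => A mA _; exact: negE.
Qed.

End charge_integral.

Section metric_on_measures.
Context (R : realType) (n : nat) (Uhat : pmetricType R).
Local Notation X := ('rV[R]_n * Uhat)%type.
Variable G : set X.

Definition lipschitz_fun_on (h : X -> R) : Prop :=
  exists L : R, forall z z' : X, G z -> G z' ->
    `|h z - h z'| <= L * Num.max `|z.1 - z'.1| (mdist z.2 z'.2).

Definition dense_lipschitz_seq (q : nat -> X -> R) : Prop :=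
  [/\ forall j, lipschitz_fun_on (q j),
      forall j z, G z -> `|q j z| <= 1 &
      forall h : X -> R, {within G, continuous h} ->
        (forall z, G z -> `|h z| <= 1) ->
        forall e : R, 0 < e -> exists j, forall z, G z -> `|h z - q j z| <= e].

(* The sequence is indexed from 0 here, whence the weights 2^-(j+1). *)
Definition rho (q : nat -> X -> R) (g g' : prob_on R G) : \bar R :=
  (\sum_(j <oo)
    (2 ^- j.+1 * `|\int[g]_(z in G) q j z - \int[g']_(z in G) q j z|)%:E)%E.

Definition rho_set (q : nat -> X -> R) (g : prob_on R G)
    (A : set (prob_on R G)) : \bar R :=
  ereal_inf [set rho q g g' | g' in A].

Definition rho_H (q : nat -> X -> R) (A B : set (prob_on R G)) : \bar R :=
  Order.max (ereal_sup [set rho_set q g B | g in A])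
            (ereal_sup [set rho_set q g A | g in B]).

End metric_on_measures.

Section model.
Context (R : realType) (n : nat) (Uhat : pmetricType R) (S : ptopologicalType)
  (d : measure_display) (Omega : measurableType d) (P : probability Omega R).
Local Notation X := ('rV[R]_n * Uhat)%type.
Variables (Y : set 'rV[R]_n) (U : 'rV[R]_n -> set Uhat)
  (f : 'rV[R]_n -> Uhat -> S -> 'rV[R]_n) (s : nat -> {RV P >-> borel S}).

Definition graph_of : set X := [set z | Y z.1 /\ U z.1 z.2].
Local Notation G := graph_of.

Definition control_plan (p : nat -> 'rV[R]_n -> Uhat) : Prop :=
  forall t,
    measurable_fun (Y : set (borel 'rV[R]_n)) (p t : _ -> borel Uhat) /\
    (forall y, Y y -> U y (p t y)).

Fixpoint state (p : nat -> 'rV[R]_n -> Uhat) (y0 : 'rV[R]_n) (t : nat)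
    (w : Omega) : 'rV[R]_n :=
  if t is t'.+1 then
    f (state p y0 t' w) (p t' (state p y0 t' w)) (s t' w)
  else y0.

Definition trajectory (p : nat -> 'rV[R]_n -> Uhat) (y0 : 'rV[R]_n) (t : nat)
    (w : Omega) : X :=
  (state p y0 t w, p t (state p y0 t w)).

(* The infimum is attained under the assumptions of the model. *)
Definition value (k : X -> R) (T : nat) (y0 : 'rV[R]_n) : R :=
  T%:R^-1 * inf [set \int[P]_w (\sum_(t < T) k (trajectory p y0 t w)) |
                 p in control_plan].

Definition occupation (p : nat -> 'rV[R]_n -> Uhat) (y0 : 'rV[R]_n) (T : nat)
    (Q : set X) : R :=
  T%:R^-1 * \int[P]_w (\sum_(t < T) \1_Q (trajectory p y0 t w)).

Definition Gamma (T : nat) (y0 : 'rV[R]_n) : set (prob_on R G) :=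
  [set g : prob_on R G | exists2 p, control_plan p &
     forall Q : set (borel X), measurable Q -> Q `<=` G ->
       g Q = (occupation p y0 T Q)%:E].

(* s 0 serves as the generic random element *)
Definition drift (phi : 'rV[R]_n -> R) (z : X) : R :=
  \int[P]_w phi (f z.1 z.2 (s 0%N w)) - phi z.1.

Definition W : set (prob_on R G) :=
  [set g : prob_on R G | forall phi : 'rV[R]_n -> R, {within Y, continuous phi} ->
     \int[g]_(z in G) drift phi z = 0].

Definition D1 (y0 : 'rV[R]_n) : set ({charge set (borel X) -> \bar R}) :=
  [set nu : {charge set (borel X) -> \bar R} | charge_on G nu /\
     exists2 xi : nat -> {finite_measure set (borel X) -> \bar R},
       forall l, finite_measure_on G (xi l) &
       forall phi : 'rV[R]_n -> R, {within Y, continuous phi} ->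
         \int[xi l]_(z in G) drift phi z @[l --> \oo] -->
           charge_integral nu G (fun z => phi z.1 - phi y0)].

Definition W_cap_D1 (y0 : 'rV[R]_n) : set (prob_on R G) :=
  W `&` [set g : prob_on R G | D1 y0 (charge_of_finite_measure g)].

End model.

Arguments Gamma {R n Uhat S d Omega P} Y U f s T y0.
Arguments W {R n Uhat S d Omega P} Y U f s.
Arguments D1 {R n Uhat S d Omega P} Y U f s y0.
Arguments W_cap_D1 {R n Uhat S d Omega P} Y U f s y0.

(* Main.v *)
(* By weak* compactness it is enough to show that the limit points of
   [co Gamma_T(y0)] lie in [W] and [D1(y0)], and that every point of the
   intersection is approached.

   Limit points.  A measure of [co Gamma_T(y0)] integrates the drift of [phi] to
   [O(1/T)], whence [W]; summing the telescoping increments of [E phi(y(t))] by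
   parts writes its integral of [phi - phi(y0)] as the integral of the drift
   against the measure [sum_t (T-1-t)/T law(y(t),u(t))], whence [D1].

   Approximation. If a point [g] of the intersection stays away from [co
   Gamma_T(y0)], separating the first coordinates [int q_j] gives a
   combination [k] of the [q_j] with [v_T(y0) >= int k dg + c], [c > 0]. On
   the other hand [int k dg >= v(y0)]: dynamic programming gives [v <= E
   v(f(y,u,s))] on [G] and, for [g] in [W], [int v dg <= int k dg], while
   membership in [D1(y0)] turns the first inequality into [v(y0) <= int v
   dg]. The vectors of coefficients range over a compact box, so that
   finitely many cost functions suffice. *)

From HB Require Import structures.
Require Import Defs.
From mathcomp Require Import all_boot all_order all_algebra finmap.
From mathcomp Require Import all_classical all_reals all_analysis.
From mathcomp Require Import measurable_realfun ring lra.

Set Implicit Arguments.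
Unset Strict Implicit.
Unset Printing Implicit Defensive.

Import Order.TTheory GRing.Theory Num.Theory.
Import numFieldNormedType.Exports.

Local Open Scope classical_set_scope.
Local Open Scope ring_scope.

(** * Integrals of bounded measurable functions *)

(** Two obstacles shape the development. Since [U] is only upper semicontinuous, minimising over
    [U y] produces finite-horizon costs that are merely lower semicontinuous, whereas [W] tests
    continuous functions and the one-step identity for trajectories is first available for those.
    Both identities are therefore carried over to bounded pointwise limits from below, the Bellman
    recursion is kept inside that class, and Borel minimisers come from a measurable selection. The
    assumed continuity of [v] is what makes it admissible in [D1].

    The other obstacle is uniformity: the horizon has to be fixed before the point of [W_cap_D1],
    hence before the separating cost is known. It is met because a plan nearly optimal for one cost
    competes with all points of [W_cap_D1] at once, and because the separation has a gap depending
    on [e] only.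

    The limit in [D1] reflects that the measure obtained by summation by parts has mass
    [(T - 1) / 2]: it grows with the horizon, so no compactness is available for it. *)

Section bounded_measurable.
Context d (T : measurableType d) (R : realType).
Implicit Types (D : set T) (h : T -> R).

Definition bounded_measurable D h :=
  measurable_fun D h /\ exists M : R, forall x, D x -> `|h x| <= M.

Lemma bounded_measurable_integrable (mu : {finite_measure set T -> \bar R})
    D h : measurable D -> bounded_measurable D h ->
  mu.-integrable D (EFin \o h).
Proof.
move=> mD [mh [M hM]]; apply: measurable_bounded_integrable => //.
  by rewrite ltey_eq fin_num_measure.
exists M; split; first exact: num_real.
by move=> r Mr x Dx /=; rewrite (le_trans (hM _ Dx))// ltW.
Qed.

Lemma bounded_measurableD D h1 h2 : bounded_measurable D h1 ->
  bounded_measurable D h2 -> bounded_measurable D (fun x => h1 x + h2 x).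
Proof.
move=> [m1 [M1 b1]] [m2 [M2 b2]]; split; first exact: measurable_funD.
exists (M1 + M2) => x Dx; apply: le_trans (ler_normD _ _) _.
by apply: lerD; [exact: b1|exact: b2].
Qed.

Lemma bounded_measurableZ D h c : bounded_measurable D h ->
  bounded_measurable D (fun x => c * h x).
Proof.
move=> [mh [M hM]]; split.
  by apply: measurable_funM => //; exact: measurable_cst.
by exists (`|c| * M) => x Dx; rewrite normrM ler_wpM2l// hM.
Qed.

Lemma bounded_measurable_cst D (c : R) : bounded_measurable D (fun=> c).
Proof. by split; [exact: measurable_cst|exists `|c|]. Qed.

Lemma bounded_measurableB D h1 h2 : bounded_measurable D h1 ->
  bounded_measurable D h2 -> bounded_measurable D (fun x => h1 x - h2 x).
Proof.
move=> b1 b2; have := bounded_measurableD b1 (bounded_measurableZ (-1) b2).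
by under eq_fun do rewrite mulN1r.
Qed.

Lemma bounded_measurable_sum D (I : Type) (r : seq I) (h : I -> T -> R) :
  (forall i, bounded_measurable D (h i)) ->
  bounded_measurable D (fun x => \sum_(i <- r) h i x).
Proof.
move=> bh; elim: r => [|i r ih].
  by under eq_fun do rewrite big_nil; exact: bounded_measurable_cst.
by under eq_fun do rewrite big_cons; exact: bounded_measurableD.
Qed.

Lemma bounded_measurable_indic D (A : set T) : measurable A ->
  bounded_measurable D (\1_A : T -> R).
Proof.
move=> mA; split; first exact: measurable_indic.
by exists 1 => x _; rewrite indicE; case: (_ \in _); rewrite ?normr1 ?normr0.
Qed.

Lemma bounded_measurableM D h1 h2 : bounded_measurable D h1 ->
  bounded_measurable D h2 -> bounded_measurable D (fun x => h1 x * h2 x).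
Proof.
move=> [m1 [M1 b1]] [m2 [M2 b2]]; split; first exact: measurable_funM.
by exists (M1 * M2) => x Dx; rewrite normrM ler_pM// ?b1 ?b2.
Qed.

Section fixed_measure.
Variables (mu : {finite_measure set T -> \bar R}) (D : set T).
Hypothesis mD : measurable D.

Lemma Rintegral_bounded_sum (I : Type) (r : seq I) (h : I -> T -> R) :
  (forall i, bounded_measurable D (h i)) ->
  \int[mu]_(x in D) (\sum_(i <- r) h i x) =
  \sum_(i <- r) \int[mu]_(x in D) h i x.
Proof.
move=> bh; elim: r => [|i r ih].
  under eq_Rintegral do rewrite big_nil.
  by rewrite Rintegral_cst// mul0r big_nil.
under eq_Rintegral do rewrite big_cons.
rewrite big_cons -ih RintegralD//; apply: bounded_measurable_integrable => //.
exact: bounded_measurable_sum.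
Qed.

Lemma bounded_convergence (h_ : nat -> T -> R) h M :
  (forall n, measurable_fun D (h_ n)) ->
  (forall n x, D x -> `|h_ n x| <= M) ->
  (forall x, D x -> h_ ^~ x @ \oo --> h x) ->
  \int[mu]_(x in D) h_ n x @[n --> \oo] --> \int[mu]_(x in D) h x.
Proof.
move=> mh_ hM h_h.
have mh : measurable_fun D h by exact: measurable_fun_cvg mh_ h_h.
have hb x : D x -> `|h x| <= M.
  move=> Dx; apply: (cvgr_to_le (cvg_norm (h_h x Dx))).
  by apply: nearW => n; exact: hM.
have iM : mu.-integrable D (fun=> M%:E).
  exact: (bounded_measurable_integrable mu mD (bounded_measurable_cst D M)).
have [|||||ih _] := @dominated_convergence _ _ _ mu D mD
  (fun n x => (h_ n x)%:E) (fun x => (h x)%:E) (fun=> M%:E).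
- by move=> n; apply/measurable_EFinP.
- exact/measurable_EFinP.
- by apply: aeW => x Dx; apply: cvg_EFin; [exact: nearW|exact: h_h].
- exact: iM.
- by apply: aeW => x n Dx; rewrite lee_fin hM.
move=> hc; apply: fine_cvg; rewrite fineK //; exact: integrable_fin_num.
Qed.

Lemma normr_Rintegral_le (h : T -> R) (M : R) : \int[mu]_(_ in D) M = M ->
  measurable_fun D h -> (forall x, D x -> `|h x| <= M) ->
  `|\int[mu]_(x in D) h x| <= M.
Proof.
move=> MM mh hM.
have ih : mu.-integrable D (EFin \o h).
  by apply: bounded_measurable_integrable => //; split=> //; exists M.
apply: le_trans (le_normr_Rintegral mD ih) _.
rewrite -[leRHS]MM; apply: le_Rintegral => //.
- apply: bounded_measurable_integrable => //; split.
    by apply: measurableT_comp.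
  by exists M => x /hM; rewrite normr_id.
- apply: bounded_measurable_integrable => //; exact: bounded_measurable_cst.
Qed.

(** The mixture identity is assumed on subsets of [D] only, because membership in [Gamma] determines
    a measure through subsets of the graph. Additivity in the measure is applied to nonnegative
    integrands; a bounded [h] is reached by adding its bound [M] and subtracting the constant
    again. *)
Lemma Rintegral_mixture m (w : 'I_m -> R)
    (nu_ : 'I_m -> {finite_measure set T -> \bar R}) h :
  (forall i, 0 <= w i) ->
  (forall A, measurable A -> A `<=` D ->
    mu A = (\sum_i (w i)%:E * nu_ i A)%E) ->
  bounded_measurable D h ->
  \int[mu]_(x in D) h x = \sum_i w i * \int[nu_ i]_(x in D) h x.
Proof.
move=> w0 muE bh; have [mh [M hM]] := bh.
have H (g : T -> R) : measurable_fun D g -> (forall x, D x -> 0 <= g x) ->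
    (exists M : R, forall x, D x -> `|g x| <= M) ->
    \int[mu]_(x in D) g x = \sum_i w i * \int[nu_ i]_(x in D) g x.
  move=> mg g0 bg.
  (* [msum] adds up a sequence of measures, so the family over ['I_m] is continued by the zero
     measure. *)
  pose nuS j : {measure set T -> \bar R} :=
    if insub j is Some i then mscale (NngNum (w0 i)) (nu_ i) else mzero.
  rewrite /Rintegral (@eq_measure_integral _ _ _ D (msum nuS m)); last first.
    move=> A mA AD; apply: etrans (muE _ mA AD) _.
    rewrite /msum/=; apply: eq_bigr => i _.
    by rewrite /nuS valK.
  rewrite ge0_integral_measure_sum//; last exact/measurable_EFinP.
  rewrite -sum_fine => [|j _].
    apply: eq_bigr => i _; rewrite /nuS valK ge0_integral_mscale//=.
      rewrite fineM//; apply: integrable_fin_num => //.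
      exact: bounded_measurable_integrable.
    exact/measurable_EFinP.
  rewrite /nuS; rewrite valK ge0_integral_mscale//=; last exact/measurable_EFinP.
  rewrite fin_numM//; apply: integrable_fin_num => //.
  exact: bounded_measurable_integrable.
have h1 : bounded_measurable D (fun x => h x + M).
  by apply: bounded_measurableD => //; exact: bounded_measurable_cst.
have hM0 x : D x -> 0 <= h x + M.
  by move=> Dx; have := hM _ Dx; rewrite ler_norml -lerBlDr sub0r => /andP[].
have hc (nu : {finite_measure set T -> \bar R}) : \int[nu]_(x in D) h x =
    \int[nu]_(x in D) (h x + M) - \int[nu]_(x in D) M.
  rewrite RintegralD ?addrK//; apply: bounded_measurable_integrable => //.
  exact: bounded_measurable_cst.
have [M0|D0] := pselect (exists x, D x); last first.
  have -> : D = set0 by apply/seteqP; split=> // x Dx; case: D0; exists x.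
  by rewrite Rintegral_set0 big1// => i _; rewrite Rintegral_set0 mulr0.
have {}M0 : 0 <= M by have [x Dx] := M0; rewrite (le_trans _ (hM _ Dx)).
rewrite hc H//; [|exact: h1.1|exact: h1.2].
rewrite H//; last 1 first.
  by exists M => x _; rewrite ger0_norm.
by rewrite -sumrB; apply: eq_bigr => i _; rewrite -mulrBr -hc.
Qed.

End fixed_measure.
End bounded_measurable.

Lemma measure_setI_supp d (T : measurableType d) (R : realType)
    (mu : {measure set T -> \bar R}) (A G : set T) : measurable A ->
  measurable G -> mu (~` G) = 0%E -> mu (A `&` G) = mu A.
Proof.
move=> mA mG muG; have AG0 : mu (A `\` G) = 0%E.
  apply/eqP; rewrite eq_le measure_ge0 andbT -muG le_measure ?inE//.
  - exact: measurableD.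
  - exact: measurableC.
apply/esym; apply: etrans (measureDI mu mA mG) _.
by apply: etrans (congr1 (adde^~ _) AG0) _; exact: add0e.
Qed.

Section measure_promotion.
Context d (T : measurableType d) (R : realType).
Variable mu : {measure set T -> \bar R}.

(** The proof argument leaves the set function unchanged; carrying it in the term lets the instance
    of a finite measure be inferred. [measure_prob] works in the same way. *)
Definition measure_fin (_ : fin_num_fun mu) : set T -> \bar R := mu.

HB.instance Definition _ h := isMeasure.Build _ _ _ (measure_fin h)
  (measure0 mu) (measure_ge0 mu) (@measure_semi_sigma_additive _ _ _ mu).
HB.instance Definition _ h := Measure_isFinite.Build _ _ _ (measure_fin h) h.

Definition measure_prob (_ : mu setT = 1%E) : set T -> \bar R := mu.

HB.instance Definition _ h := isMeasure.Build _ _ _ (measure_prob h)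
  (measure0 mu) (measure_ge0 mu) (@measure_semi_sigma_additive _ _ _ mu).
HB.instance Definition _ h :=
  Measure_isProbability.Build _ _ _ (measure_prob h) h.

End measure_promotion.

Section pushforward.
Context d d' (T : measurableType d) (T' : measurableType d') (R : realType).
Variables (mu : {finite_measure set T -> \bar R}) (phi : T -> T').
Variable nu : {finite_measure set T' -> \bar R}.

Lemma Rintegral_image (D : set T') h : measurable_fun setT phi ->
  measurable D -> (forall x, D (phi x)) -> bounded_measurable D h ->
  (forall A, measurable A -> nu A = mu (phi @^-1` A)) ->
  \int[nu]_(y in D) h y = \int[mu]_x h (phi x).
Proof.
move=> mphi mD Dphi [mh [M hM]] nuE.
(* [h] is measurable on [D] only and is extended by zero; as [phi] takes its values in [D], the
   composition is not affected. *)
have bhD : bounded_measurable setT (h \_ D).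
  split; first by apply/(measurable_restrictT h mD).
  exists `|M| => x _; rewrite /patch; case: ifPn => [/set_mem Dx|_].
    by rewrite (le_trans (hM _ Dx))// ler_norm.
  by rewrite normr0.
have hphi x : (h \_ D) (phi x) = h (phi x) by rewrite /patch mem_set.
pose phi' : {mfun T >-> T'} := HB.pack phi (isMeasurableFun.Build _ _ _ _ _ mphi).
rewrite Rintegral_mkcond /Rintegral; congr fine.
rewrite (@eq_measure_integral _ _ _ setT (pushforward mu phi')).
  rewrite integral_pushforward//.
  - by apply: eq_integral => x _ /=; rewrite hphi.
  - by apply/measurable_EFinP; exact: bhD.1.
  - apply: (@bounded_measurable_integrable _ _ _ mu setT ((h \_ D) \o phi)) => //.
    split; first by apply: measurableT_comp => //; exact: bhD.1.
    by have [_ [N hN]] := bhD; exists N => x _; exact: hN.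
by move=> A mA _; exact: nuE.
Qed.
End pushforward.

(** * Metrized spaces *)

Section metrized.
Context (R : realType) (T : ptopologicalType) (dist : T -> T -> R).
Hypothesis dist_metrizes : metrizes dist.

Lemma metrizesxx x : dist x x = 0.
Proof. by have [/(_ x x)[_ ->]] := dist_metrizes. Qed.

Lemma metrizesC x y : dist x y = dist y x.
Proof. by have [_ ->] := dist_metrizes. Qed.

Lemma metrizes_triangle y x z : dist x z <= dist x y + dist y z.
Proof. by have [_ _ + _] := dist_metrizes; apply. Qed.

Lemma metrizes_ge0 x y : 0 <= dist x y.
Proof.
have := metrizes_triangle y x x.
by rewrite metrizesxx (metrizesC y) -mulr2n pmulrn_lge0.
Qed.

Lemma metrizes_gt0 x y : x <> y -> 0 < dist x y.
Proof.
move=> xy; rewrite lt_neqAle metrizes_ge0 andbT eq_sym.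
by apply/eqP => d0; apply: xy; have [dxy _ _ _] := dist_metrizes; exact/dxy.
Qed.

Lemma metrizes_nbhs x (A : set T) :
  nbhs x A <-> exists2 e, 0 < e & forall y, dist x y < e -> A y.
Proof. by have [_ _ _] := dist_metrizes; apply. Qed.

Lemma metrizes_open (A : set T) : open A <->
  forall x, A x -> exists2 e, 0 < e & forall y, dist x y < e -> A y.
Proof.
rewrite openE; split=> [oA x /oA /metrizes_nbhs//|oA x /oA].
by move=> ?; apply/metrizes_nbhs.
Qed.

Lemma metrizes_within_continuous (A : set T) (h : T -> R) :
  {within A, continuous h} <->
  (forall x, A x -> forall e, 0 < e -> exists2 r, 0 < r &
     forall y, A y -> dist x y < r -> `|h x - h y| < e).
Proof.
rewrite subspace_continuousP; split=> H x Ax.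
  move=> e e0; have /cvgrPdist_lt /(_ e e0) := H x Ax.
  rewrite near_withinE => /metrizes_nbhs[r r0 hr].
  by exists r => // y Ay xy; exact: hr.
apply/cvgrPdist_lt => e e0; have [r r0 hr] := H x Ax e e0.
by rewrite near_withinE; apply/metrizes_nbhs; exists r => // y xy Ay; exact: hr.
Qed.

Lemma metrizes_lipschitz_continuous (h : T -> R) L :
  (forall x y, `|h x - h y| <= L * dist x y) -> continuous h.
Proof.
move=> hL x; apply/cvgrPdist_lt => e e0; apply/metrizes_nbhs.
exists (e / (`|L| + 1)) => [|y]; first by rewrite divr_gt0// ltr_wpDl.
rewrite ltr_pdivlMr ?ltr_wpDl// => xy; apply: le_lt_trans (hL x y) _.
apply: le_lt_trans xy; rewrite mulrC ler_wpM2l ?metrizes_ge0//.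
by rewrite (le_trans (ler_norm _))// lerDl.
Qed.

Lemma metrizes_dist_continuous z : continuous (dist z).
Proof.
apply: (@metrizes_lipschitz_continuous _ 1) => x y; rewrite mul1r.
rewrite ler_norml lerNl opprB !lerBlDl (metrizes_triangle x).
by rewrite (metrizesC x y) (metrizes_triangle y).
Qed.

Lemma metrizes_open_ball z e : open [set x | dist z x < e].
Proof.
apply: (open_comp (f := dist z)) (@open_lt _ e) => x _.
exact: metrizes_dist_continuous.
Qed.

Lemma metrizes_compact_closed (A : set T) : compact A -> closed A.
Proof.
apply: compact_closed => x y xy; apply: contrapT => /metrizes_gt0 d0.
have d20 : 0 < dist x y / 2 by rewrite divr_gt0.
have nb z : nbhs z [set t | dist z t < dist x y / 2].
  by apply/metrizes_nbhs; exists (dist x y / 2).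
have [z [/= xz yz]] := xy _ _ (nb x) (nb y).
 have := metrizes_triangle z x y.
by rewrite (metrizesC z y) leNgt (splitr (dist x y)) ltrD.
Qed.

Lemma metrizes_net (A : set T) : compact A -> forall e, 0 < e ->
  exists s : seq T, (forall x, x \in s -> A x) /\
    forall x, A x -> exists2 y, y \in s & dist x y < e.
Proof.
rewrite compact_cover => cA e e0.
have [||D' D'A AD'] := cA T A (fun y => [set x | dist x y < e]).
- move=> y _; apply: open_comp (@open_lt _ e) => x _.
  by under eq_fun do rewrite metrizesC; exact: metrizes_dist_continuous.
- by move=> x Ax; exists x => //=; rewrite metrizesxx.
exists (enum_fset D'); split=> [x xD|x /AD'[y yD xy]].
  by have := D'A _ xD; rewrite inE.
by exists y.
Qed.

(** For [h] bounded below on [A] and [L >= 0], this is the largest [L]-Lipschitz function lying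
    below [h] on [A]. It is used three times: for bump functions inside open sets, for extending the
    Lipschitz test functions, and for approximating lower semicontinuous costs from below. *)
Definition infconv (h : T -> R) (A : set T) (L : R) (x : T) : R :=
  inf [set h a + L * dist x a | a in A].

Section infconv.
Variables (h : T -> R) (A : set T) (m L : R).
Hypotheses (A0 : A !=set0) (mh : forall x, A x -> m <= h x) (L0 : 0 <= L).

Let has_inf_infconv x : has_inf [set h a + L * dist x a | a in A].
Proof.
split; first by have [a Aa] := A0; exists (h a + L * dist x a), a.
exists m => _ [a Aa <-]; rewrite (le_trans (mh Aa))// lerDl.
by rewrite mulr_ge0 ?metrizes_ge0.
Qed.

Lemma infconv_le x a : A a -> infconv h A L x <= h a + L * dist x a.
Proof. by move=> Aa; apply: ge_inf; [exact: (has_inf_infconv x).2|exists a]. Qed.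

Lemma le_infconv x c : (forall a, A a -> c <= h a + L * dist x a) ->
  c <= infconv h A L x.
Proof.
move=> H; apply: lb_le_inf; first exact: (has_inf_infconv x).1.
by move=> _ [a Aa <-]; exact: H.
Qed.

Lemma infconv_lipschitz x y :
  `|infconv h A L x - infconv h A L y| <= L * dist x y.
Proof.
suff H u v : infconv h A L u - infconv h A L v <= L * dist u v.
  by rewrite ler_norml H andbT lerNl opprB (metrizesC x) H.
rewrite lerBlDr -lerBlDl; apply: le_infconv => a Aa.
rewrite lerBlDl; apply: le_trans (infconv_le u Aa) _.
by rewrite addrCA lerD2l -mulrDr ler_wpM2l// metrizes_triangle.
Qed.

Lemma infconv_continuous : continuous (infconv h A L).
Proof. exact: metrizes_lipschitz_continuous infconv_lipschitz. Qed.

Lemma infconv_ge x : m <= infconv h A L x.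
Proof.
apply: le_infconv => a Aa; rewrite (le_trans (mh Aa))// lerDl.
by rewrite mulr_ge0 ?metrizes_ge0.
Qed.

Lemma infconv_le_self x : A x -> infconv h A L x <= h x.
Proof. by move=> /(infconv_le x); rewrite metrizesxx mulr0 addr0. Qed.

End infconv.

Lemma metrizes_within_continuous_seq (A : set T) (h : T -> R) :
  (forall x (u : nat -> T), A x -> (forall n, A (u n)) ->
    (forall n, dist x (u n) < n.+1%:R^-1) -> h \o u @ \oo --> h x) ->
  {within A, continuous h}.
Proof.
move=> H; apply/metrizes_within_continuous => x Ax e e0; apply: contrapT => nr.
have /choice[u uP] : forall n, exists y,
    [/\ A y, dist x y < n.+1%:R^-1 & e <= `|h x - h y|].
  move=> n; apply: contrapT => ny; apply: nr.
  exists n.+1%:R^-1; first by rewrite invr_gt0.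
  move=> y Ay xy; rewrite ltNge; apply/negP => exy.
  by apply: ny; exists y.
have /cvgrPdist_lt/(_ e e0)[N _ /(_ N (leqnn N))] : h \o u @ \oo --> h x.
  by apply: H => // n; have [] := uP n.
by rewrite /= ltNge; have [_ _ ->] := uP N.
Qed.

(** For [L >= 0] this is the minimum of 1 and [L] times the distance to the complement of [V]; as
    [L] grows it increases to the indicator of an open [V]. *)
Definition bump (V : set T) (L : R) : T -> R := infconv \1_V setT L.

Section bump.
Variables (V : set T) (L : R).
Hypothesis L0 : 0 <= L.

Let V0 a : setT a -> (0 : R) <= \1_V a.
Proof. by rewrite indicE ler0n. Qed.

Let setT0 : [set: T] !=set0. Proof. by exists point. Qed.

Lemma bump_continuous : continuous (bump V L).
Proof. exact: infconv_continuous setT0 V0 L0. Qed.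

Lemma bump_ge0 x : 0 <= bump V L x.
Proof. exact: infconv_ge setT0 V0 L0 x. Qed.

Lemma bump_le x : bump V L x <= \1_V x.
Proof. exact: (infconv_le_self setT0 V0 L0 (I : setT x)). Qed.

Lemma bump_ge1 x r : (forall y, dist x y < r -> V y) -> 1 <= L * r ->
  1 <= bump V L x.
Proof.
move=> xr Lr; apply: le_infconv => // a _; rewrite indicE.
case: (boolP (a \in V)) => [_|/negP aV].
  by rewrite lerDl mulr_ge0// metrizes_ge0.
rewrite add0r (le_trans Lr)// ler_wpM2l// leNgt; apply/negP => /xr Va.
by apply: aV; rewrite inE.
Qed.

End bump.

Lemma borel_open (A : set T) : open A -> measurable (A : set (borel T)).
Proof. exact: sub_sigma_algebra. Qed.

Lemma borel_closed (A : set T) : closed A -> measurable (A : set (borel T)).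
Proof.
by move=> /closed_openC/borel_open/measurableC; rewrite setCK.
Qed.

Lemma within_continuous_borel (A : set T) (h : T -> R) :
  {within A, continuous h} -> measurable_fun (A : set (borel T)) h.
Proof.
move=> /continuousP ch mA; move: (mA).
apply: (measurability _ (RGenOpens.measurableE R)) => _ [_ [a [b ->] <-]].
have /open_subspaceP[V oV VA] : open (h @^-1` `]a, b[ : set (subspace A)).
  by apply: ch; exact: interval_open.
rewrite setIC (_ : _ `&` _ = V `&` A)//.
by apply: measurableI => //; exact: borel_open.
Qed.

End metrized.

Section metrizes_instances.
Variable R : realType.

Lemma metrizes_norm n : metrizes (fun x y : 'rV[R]_n => `|x - y|).
Proof.
split=> [x y|x y|x y z|x A].
- split=> [/normr0_eq0/eqP|->]; last by rewrite subrr normr0.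
  by rewrite subr_eq0 => /eqP.
- exact: distrC.
- exact: ler_distD.
- split=> [/nbhs_ballP[e /= e0 h]|[e e0 h]].
    by exists e => // y xy; apply: h; rewrite -ball_normE.
  by apply/nbhs_ballP; exists e => //= y; rewrite -ball_normE; exact: h.
Qed.

Lemma metrizes_mdist (T : pmetricType R) : metrizes (@mdist R T).
Proof.
split=> [x y|x y|x y z|x A].
- by split=> [/mdist_positivity|->]//; exact: mdistxx.
- exact: metric_sym.
- exact: metric_triangle.
- by rewrite -metricType_numDomainType.filter_from_mdist_nbhs.
Qed.

Lemma metrizes_prod (T1 T2 : ptopologicalType) (d1 : T1 -> T1 -> R)
    (d2 : T2 -> T2 -> R) : metrizes d1 -> metrizes d2 ->
  metrizes (fun x y : T1 * T2 => Num.max (d1 x.1 y.1) (d2 x.2 y.2)).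
Proof.
move=> m1 m2; split=> [[x1 x2] [y1 y2]|x y|x y z|x A] /=.
- split=> [d0|[-> ->]]; last by rewrite (metrizesxx m1) (metrizesxx m2) maxxx.
  have [h1 _ _ _] := m1; have [h2 _ _ _] := m2.
  congr pair; [apply/h1|apply/h2]; apply/eqP; rewrite eq_le metrizes_ge0//.
    by rewrite -d0 le_max lexx.
  by rewrite -d0 le_max lexx orbT.
- by rewrite (metrizesC m1) (metrizesC m2).
- rewrite ge_max; apply/andP; split.
    apply: le_trans (metrizes_triangle m1 y.1 _ _) _.
    by apply: lerD; rewrite le_max lexx.
  apply: le_trans (metrizes_triangle m2 y.2 _ _) _.
  by apply: lerD; rewrite le_max lexx orbT.
- split.
  + move=> [[B1 B2] /= [/(metrizes_nbhs m1)[e1 e10 h1]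
      /(metrizes_nbhs m2)[e2 e20 h2]] hA].
    exists (Num.min e1 e2); first by rewrite lt_min e10.
    move=> y; rewrite /= gt_max !lt_min => /andP[/andP[y1 _] /andP[_ y2]].
    by apply: hA; split; [exact: h1|exact: h2].
  + move=> [e e0 hA]; exists ([set y | d1 x.1 y < e], [set y | d2 x.2 y < e]).
      by split; [apply/(metrizes_nbhs m1)|apply/(metrizes_nbhs m2)]; exists e.
    by move=> y [/= y1 y2]; apply: hA; rewrite /= gt_max y1.
Qed.

End metrizes_instances.

(** * Riesz representation on a compact set *)

Lemma sum_half (R : realType) N : \sum_(i < N) 2 ^- i.+1 = 1 - 2 ^- N :> R.
Proof.
elim: N => [|N ih]; first by rewrite big_ord0 expr0 invr1 subrr.
rewrite big_ord_recr/= ih exprS invfM; lra.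
Qed.

Section riesz.
Context (R : realType) (T : ptopologicalType) (dist : T -> T -> R).
Hypothesis dist_metrizes : metrizes dist.
Variables (G : set T) (L : (T -> R) -> R).
Hypothesis G_compact : compact G.
Local Notation C h := {within G, continuous (h : T -> R)}.
Implicit Types (h : T -> R) (V A : set T).
Hypothesis LD : forall h1 h2, C h1 -> C h2 ->
  L (fun x => h1 x + h2 x) = L h1 + L h2.
Hypothesis LZ : forall c h, C h -> L (fun x => c * h x) = c * L h.
Hypothesis L_le : forall h1 h2, C h1 -> C h2 ->
  (forall x, G x -> h1 x <= h2 x) -> L h1 <= L h2.
Hypothesis L1 : L (fun=> 1) = 1.

Let C_cst (c : R) : C (fun=> c).
Proof. by move=> x; exact: cvg_cst. Qed.

Let CD (h1 h2 : T -> R) : C h1 -> C h2 -> C (fun x => h1 x + h2 x).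
Proof. by move=> c1 c2 x; apply: cvgD; [exact: c1|exact: c2]. Qed.

Let CZ c (h : T -> R) : C h -> C (fun x => c * h x).
Proof. by move=> ch x; apply: cvgM; [exact: cvg_cst|exact: ch]. Qed.

Let CB (h1 h2 : T -> R) : C h1 -> C h2 -> C (fun x => h1 x - h2 x).
Proof. by move=> c1 c2 x; apply: cvgB; [exact: c1|exact: c2]. Qed.

Let C_norm h : C h -> C (fun x => `|h x|).
Proof. by move=> ch x; apply: cvg_norm; exact: ch. Qed.

Let C_max c h : C h -> C (fun x => Num.max c (h x)).
Proof.
move=> ch; have := @CZ 2^-1 _ (CD (CD (@C_cst c) ch) (C_norm (CB (@C_cst c) ch))).
rewrite (_ : (fun x => Num.max c (h x)) =
  (fun x => 2^-1 * (c + h x + `|c - h x|)))//.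
by apply/funext => x; rewrite maxr_absE mulrC.
Qed.

Let C_min c h : C h -> C (fun x => Num.min c (h x)).
Proof.
move=> ch; have := CB (CD (@C_cst c) ch) (@C_max c _ ch).
rewrite (_ : (fun x => Num.min c (h x)) =
  (fun x => c + h x - Num.max c (h x)))//.
by apply/funext => x; case: (leP c (h x)) => _; rewrite ?addrK// addrC addKr.
Qed.

Let C_sum (I : Type) (r : seq I) (h : I -> T -> R) : (forall i, C (h i)) ->
  C (fun x => \sum_(i <- r) h i x).
Proof.
move=> ch; elim: r => [|i r ih].
  by under eq_fun do rewrite big_nil; exact: (@C_cst 0).
by under eq_fun do rewrite big_cons; exact: CD.
Qed.

Let L0 : L (fun=> 0) = 0.
Proof. by have := LZ 0 (@C_cst 1); under eq_fun do rewrite mul0r; rewrite mul0r. Qed.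

Let L_cst c : L (fun=> c) = c.
Proof. by have := LZ c (@C_cst 1); under eq_fun do rewrite mulr1; rewrite L1 mulr1. Qed.

Let LB h1 h2 : C h1 -> C h2 -> L (fun x => h1 x - h2 x) = L h1 - L h2.
Proof.
move=> c1 c2; rewrite -mulN1r -LZ// -LD//; last exact: CZ.
by congr L; apply/funext => x; rewrite mulN1r.
Qed.

Let L_sum (I : Type) (r : seq I) (h : I -> T -> R) : (forall i, C (h i)) ->
  L (fun x => \sum_(i <- r) h i x) = \sum_(i <- r) L (h i).
Proof.
move=> ch; elim: r => [|i r ih].
  by under eq_fun do rewrite big_nil; rewrite big_nil L0.
by under eq_fun do rewrite big_cons; rewrite big_cons -ih LD//; exact: C_sum.
Qed.

Let open_lt_within (h : T -> R) e : C h -> open [set x | G x -> h x < e].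
Proof.
move=> /(metrizes_within_continuous dist_metrizes) ch.
apply/(metrizes_open dist_metrizes) => x hx.
have [Gx|Gx] := pselect (G x); last first.
  have /closed_openC/(metrizes_open dist_metrizes) := metrizes_compact_closed dist_metrizes G_compact.
  move=> /(_ x Gx)[r r0 hr]; exists r => // y /hr; by move=> /[apply].
have [|r r0 hr] := ch x Gx (e - h x); first by rewrite subr_gt0; exact: hx.
exists r => // y xy Gy; have := hr y Gy xy.
by rewrite distrC => /(le_lt_trans (ler_norm _)); rewrite ltrBlDr subrK.
Qed.

Let minorant V h := C h /\ forall x, G x -> h x <= \1_V x.

(** The Riesz construction: [inner] prescribes the measure of open sets, and [outer] approximates an
    arbitrary set by open sets from outside. Minorants are compared with the indicator on [G] only,
    which is why the resulting measure vanishes off [G]. *)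
Let inner V := sup [set L h | h in minorant V].

Let minorant0 V : minorant V (fun=> 0).
Proof. by split=> [|x _]; [exact: (@C_cst 0)|rewrite indicE ler0n]. Qed.

Let minorant_le1 V h : minorant V h -> L h <= 1.
Proof.
move=> [ch hV]; rewrite -L1; apply: L_le => // x /hV /le_trans; apply.
by rewrite indicE; case: (_ \in _).
Qed.

Let inner_has_sup V : has_sup [set L h | h in minorant V].
Proof.
split; first by exists (L (fun=> 0)), (fun=> 0).
by exists 1 => _ [h /minorant_le1 ? <-].
Qed.

Let le_inner V h : minorant V h -> L h <= inner V.
Proof. by move=> mh; apply: ub_le_sup; [exact: (inner_has_sup V).2|exists h]. Qed.

(** The positive part of a minorant is again a minorant and has no smaller value under [L], so only
    nonnegative minorants need to be examined. *)
Let inner_le V c : (forall h, minorant V h -> (forall x, G x -> 0 <= h x) ->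
  L h <= c) -> inner V <= c.
Proof.
move=> H; apply: ge_sup; first exact: (inner_has_sup V).1.
move=> _ [h [ch hV] <-]; have cm : C (fun x => Num.max 0 (h x)) by exact: C_max.
apply: (@le_trans _ _ (L (fun x => Num.max 0 (h x)))).
  by apply: L_le => // x Gx; rewrite le_max lexx orbT.
apply: H => [|x _]; last by rewrite le_max lexx.
by split=> // x Gx; rewrite ge_max hV// indicE ler0n.
Qed.

Let inner_le_majorant V h : C h -> (forall x, G x -> \1_V x <= h x) ->
  inner V <= L h.
Proof.
move=> ch Vh; apply: inner_le => g [cg gV] _; apply: L_le => // x Gx.
by rewrite (le_trans (gV _ Gx))// Vh.
Qed.

Let inner_ge0 V : 0 <= inner V.
Proof. by rewrite -L0; exact: le_inner. Qed.

Let inner_le1 V : inner V <= 1.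
Proof. by apply: inner_le => h /minorant_le1. Qed.

Let inner_mono V V' : V `<=` V' -> inner V <= inner V'.
Proof.
move=> VV'; apply: inner_le => h [ch hV] _; apply: le_inner; split=> // x Gx.
rewrite (le_trans (hV _ Gx))// !indicE ler_nat.
by case: (boolP (x \in V)) => // /set_mem/VV' /mem_set ->.
Qed.

Let inner_adherent V e : 0 < e -> exists h,
  [/\ C h, forall x, G x -> h x <= \1_V x, forall x, G x -> 0 <= h x &
      inner V < L h + e].
Proof.
move=> e0; apply: contrapT => ne; suff : inner V <= inner V - e.
  by rewrite leNgt ltrBlDr ltrDl e0.
apply: inner_le => h [ch hV] h0; rewrite leNgt; apply/negP => he.
by apply: ne; exists h; split => //; rewrite -ltrBlDr.
Qed.

Let outer A := inf [set inner V | V in [set V | open V /\ A `<=` V]].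

Let outer_has_inf A : has_inf [set inner V | V in [set V | open V /\ A `<=` V]].
Proof.
split; first by exists (inner setT), setT => //; split=> //; exact: openT.
by exists 0 => _ [V _ <-].
Qed.

Let outer_le A V : open V -> A `<=` V -> outer A <= inner V.
Proof. by move=> oV AV; apply: ge_inf; [exact: (outer_has_inf A).2|exists V]. Qed.

Let le_outer A c : (forall V, open V -> A `<=` V -> c <= inner V) ->
  c <= outer A.
Proof.
move=> H; apply: lb_le_inf; first exact: (outer_has_inf A).1.
by move=> _ [V [oV AV] <-]; exact: H.
Qed.

Let outer_adherent A e : 0 < e ->
  exists V, [/\ open V, A `<=` V & inner V < outer A + e].
Proof.
move=> e0; have [_ [V [oV AV] <-] Ve] := inf_adherent e0 (outer_has_inf A).
by exists V.
Qed.

Let outer_open V : open V -> outer V = inner V.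
Proof.
move=> oV; apply/eqP; rewrite eq_le outer_le//=.
by apply: le_outer => V' _; exact: inner_mono.
Qed.

Let outer_ge0 A : 0 <= outer A.
Proof. by apply: le_outer => *; exact: inner_ge0. Qed.

Let outer_mono A B : A `<=` B -> outer A <= outer B.
Proof.
move=> AB; apply: le_outer => V oV BV; apply: outer_le => //.
exact: subset_trans BV.
Qed.

Let outer0 : outer set0 = 0.
Proof.
apply/eqP; rewrite eq_le outer_ge0 andbT (le_trans (outer_le open0 _))//.
rewrite -L0; apply: inner_le_majorant => [|x _]; first exact: (@C_cst 0).
by rewrite indicE in_set0.
Qed.

Let bumpC V (N : nat) : C (bump dist V N%:R).
Proof.
by apply: continuous_subspaceT; apply: bump_continuous.
Qed.

(* Dini's argument: on the compact set where [h >= e], finitely many bump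
   functions below the indicators of the [V i] add up to at least 1. *)
Let inner_bigcup (V : nat -> set T) e : 0 < e -> (forall i, open (V i)) ->
  exists N, inner (\bigcup_i V i) <= \sum_(i < N) inner (V i) + e.
Proof.
move=> e0 oV; have e20 : 0 < e / 2 by rewrite divr_gt0.
have [h [ch hV h0 hi]] := inner_adherent (\bigcup_i V i) e20.
pose s N x : R := \sum_(i < N) bump dist (V i) N%:R x.
pose K := G `&` ~` [set x | G x -> h x < e / 2].
have cK : compact K.
  by apply: compact_closedI => //; apply: open_closedC; exact: open_lt_within.
have bump0 N i x : 0 <= bump dist (V i) N%:R x by exact: bump_ge0.
have [N _ /(_ N (leqnn N)) KN] : \forall N \near \oo, K `<=` [set x | 1 <= s N x].
  apply: ((compact_near_coveringP K).1 cK nat \oo (fun N x => 1 <= s N x)) => x [Gx /=].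
  move=> /not_implyP[_ /negP]; rewrite -leNgt => hx.
  have [i _ Vix] : (\bigcup_i V i) x.
    have := hV x Gx; rewrite indicE; case: (boolP (x \in _)) => [/set_mem//|_].
    by move=> /(le_trans hx); rewrite leNgt e20.
  have [r r0 xr] := (metrizes_open dist_metrizes (V i)).1 (oV i) x Vix.
  exists ([set x' | dist x x' < r / 2], [set N | (i < N)%N /\ 2 / r <= N%:R]).
    split; first by apply/(metrizes_nbhs dist_metrizes); exists (r / 2); rewrite ?divr_gt0.
    by apply: filterI; [exact: nbhs_infty_gt|exact: nbhs_infty_ger].
  move=> [x' N] /= [xx' [iN rN]]; rewrite /s (bigD1 (Ordinal iN))//=.
  rewrite -[leLHS]addr0 lerD ?sumr_ge0//.
  apply: (@bump_ge1 _ _ _ dist_metrizes _ _ _ _ (r / 2)) => //.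
    move=> y x'y; apply: xr; rewrite (splitr r).
    by rewrite (le_lt_trans (metrizes_triangle dist_metrizes x' _ _))// ltrD.
  by rewrite -ler_pdivrMr ?divr_gt0// mul1r invf_div.
exists N; have : L h <= L (fun x => e / 2 + s N x).
  apply: L_le => // [|x Gx].
    by apply: CD; [exact: (@C_cst (e / 2))|apply: C_sum => i; exact: bumpC].
  have s0 : 0 <= s N x by apply: sumr_ge0.
  have [hx|hx] := ltP (h x) (e / 2); first by rewrite ler_wpDr// ltW.
  apply: ler_wpDl; first exact: ltW.
  apply: le_trans (KN x _); last by split=> //= /(_ Gx); rewrite ltNge hx.
  by rewrite (le_trans (hV x Gx))// indicE; case: (_ \in _).
rewrite LD; [|exact: (@C_cst (e / 2))|by apply: C_sum => i; exact: bumpC].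
rewrite L_cst L_sum; last by move=> i; exact: bumpC.
move=> Lh; rewrite (splitr e) addrA -lerBlDr (le_trans _ (le_trans Lh _))//.
  by rewrite lerBlDr ltW.
rewrite [leLHS]addrC lerD2r; apply: ler_sum => i _; apply: le_inner; split=> [|x _].
  exact: bumpC.
exact: bump_le.
Qed.

(** Each [F i] is enclosed in an open set with loss at most [e / 2 * 2 ^- i.+1]; these losses add up
    to at most [e / 2], and [inner_bigcup] spends the other half. *)
Let outer_sigma_subadditive : sigma_subadditive (fun A => (outer A)%:E).
Proof.
move=> F; apply/lee_addgt0Pr => e e0; have e20 : 0 < e / 2 by rewrite divr_gt0.
have /choice[V VP] : forall i, exists V,
    [/\ open V, F i `<=` V & inner V < outer (F i) + e / 2 * 2 ^- i.+1].
  by move=> i; apply: outer_adherent; rewrite mulr_gt0// invr_gt0 exprn_gt0.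
have [N VN] : exists N, inner (\bigcup_i V i) <=
    \sum_(i < N) inner (V i) + e / 2.
  by apply: inner_bigcup => // i; have [] := VP i.
apply: (@le_trans _ _ ((\sum_(i < N) outer (F i))%:E + e%:E)%E); last first.
  rewrite leeD2r// -sumEFin -(big_mkord xpredT (fun i => (outer (F i))%:E)).
  by apply: nneseries_lim_ge => i _ _; rewrite lee_fin.
rewrite -EFinD lee_fin; apply: (@le_trans _ _ (inner (\bigcup_i V i))).
  apply: outer_le; first by apply: bigcup_open => i _; have [] := VP i.
  by move=> x [i _ Fx]; exists i => //; have [_ + _] := VP i; apply.
apply: le_trans VN _; rewrite {2}(splitr e) addrA lerD2r.
apply: (@le_trans _ _ (\sum_(i < N) (outer (F i) + e / 2 * 2 ^- i.+1))).
  by apply: ler_sum => i _; have [_ _ /ltW] := VP i.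
rewrite big_split/= lerD2l -mulr_sumr sum_half ler_piMr// ?ltW//.
Qed.

Let mu : {outer_measure set T -> \bar R} := HB.pack (fun A => (outer A)%:E)
  (isOuterMeasure.Build R T (fun A => (outer A)%:E) (congr1 EFin outer0)
    outer_ge0 outer_mono outer_sigma_subadditive).

(** Let [B] be open around [X], let [f] be nearly optimal for [B] inside [V], and let [B'] be the
    part of [B] where [f] is small; it contains the points of [X] outside [V]. A minorant [g] of
    [B'] is at most 0 where [f] is not small, so [f + g] exceeds 1 by at most [e / 4], and dividing
    by [1 + e / 4] gives a minorant of [B]. *)
Let open_caratheodory V : open V -> mu.-caratheodory V.
Proof.
move=> oV; apply: le_caratheodory_measurable => X.
rewrite -EFinD lee_fin; apply/ler_addgt0Pr => e e0.
have e40 : 0 < e / 4 by rewrite divr_gt0.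
have [B [oB XB Be]] := outer_adherent X e40.
have [f [cf fV f0 fe]] := inner_adherent (B `&` V) e40.
pose B' := B `&` [set x | G x -> f x < e / 4].
have oB' : open B' by apply: openI => //; exact: open_lt_within.
have [g [cg gV g0 ge]] := inner_adherent B' e40.
have XV : outer (X `&` V) <= inner (B `&` V).
  by apply: outer_le; [exact: openI|exact: setSI].
have XVC : outer (X `&` ~` V) <= inner B'.
  apply: outer_le => // x [Xx Vx]; split; first exact: XB.
  move=> Gx; apply: le_lt_trans (fV x Gx) _.
  by rewrite indicE memNset// => -[].
have : L (fun x => (1 + e / 4)^-1 * (f x + g x)) <= inner B.
  apply: le_inner; split=> [|x Gx]; first by apply: CZ; exact: CD.
  rewrite mulrC ler_pdivrMr ?addr_gt0//.
  have := fV x Gx; have := gV x Gx; rewrite !indicE !in_setI /=.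
  have fx0 := f0 x Gx; have gx0 := g0 x Gx.
  case: (x \in B) => /=; last by rewrite mul0r; lra.
  case: (boolP (x \in [set x | G x -> f x < e / 4])) => [/set_mem/(_ Gx)|_].
    by case: (x \in V) => /=; lra.
  by case: (x \in V) => /=; lra.
rewrite LZ; last exact: CD.
rewrite LD// mulrC ler_pdivrMr ?addr_gt0// mulrDr mulr1.
have := @ler_pM _ _ _ _ _ (inner_ge0 B) (ltW e40) (inner_le1 B) (lexx (e / 4)).
lra.
Qed.

Let borel_caratheodory (A : set (borel T)) : measurable A -> mu.-caratheodory A.
Proof.
move: A; apply: smallest_sub => [|V /open_caratheodory//].
exact: (@sigma_algebra_measurable _ (caratheodory_type mu)).
Qed.

Let outer_semi_sigma_additive :
  semi_sigma_additive ((fun A => (outer A)%:E) : set (borel T) -> \bar R).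
Proof.
move=> F mF tF mUF.
have := @measure_semi_sigma_additive _ (caratheodory_type mu) _ (mu : measure _ _) F.
apply=> //; [move=> i; exact: borel_caratheodory|exact: borel_caratheodory].
Qed.

Let outer_prob_ge0 (A : set (borel T)) : (0 <= (outer A)%:E)%E.
Proof. by rewrite lee_fin. Qed.

Let outer_prob_measure0 : (outer (set0 : set (borel T)))%:E = 0%E.
Proof. by rewrite outer0. Qed.

Let outer_prob_measure : {measure set (borel T) -> \bar R} :=
  HB.pack ((fun A => (outer A)%:E) : set (borel T) -> \bar R)
  (isMeasure.Build _ _ _ ((fun A => (outer A)%:E) : set (borel T) -> \bar R)
    outer_prob_measure0 outer_prob_ge0 outer_semi_sigma_additive).

Let outer_prob_setT : outer_prob_measure setT = 1%E.
Proof.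
rewrite /= outer_open; last exact: openT.
congr EFin; apply/eqP; rewrite eq_le inner_le1 -{1}L1; apply: le_inner.
by split=> [|x _]; [exact: (@C_cst 1)|rewrite indicE in_setT].
Qed.

Let outer_prob : probability (borel T) R := measure_prob outer_prob_setT.

Let outer_probE (A : set (borel T)) : outer_prob A = (outer A)%:E.
Proof. by []. Qed.

Let G_closed : closed G.
Proof. exact: (metrizes_compact_closed dist_metrizes). Qed.

Let outer_prob_supp : outer_prob (~` G) = 0%E.
Proof.
rewrite outer_probE outer_open; last exact: closed_openC.
congr EFin; apply/eqP; rewrite eq_le inner_ge0 andbT -L0.
apply: inner_le_majorant => [|x Gx]; first exact: (@C_cst 0).
by rewrite indicE memNset// => /(_ Gx).
Qed.

Let mG : measurable (G : set (borel T)).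
Proof. exact: borel_closed. Qed.

Let C_bounded_measurable h : C h ->
  bounded_measurable (G : set (borel T)) h.
Proof.
move=> ch; split; first exact: within_continuous_borel.
have [M [_ hM]] := compact_bounded (continuous_compact ch G_compact).
by exists (M + 1) => x Gx; apply: (hM (M + 1)); [rewrite ltrDl|exists x].
Qed.

Let Rint_indic (V : set T) : open V ->
  \int[outer_prob]_(x in G) \1_V x = inner V.
Proof.
move=> oV; have mV := borel_open oV.
rewrite /Rintegral (integral_indic _ mG mV).
transitivity (fine (outer_prob V)); last by rewrite outer_probE outer_open.
by congr fine; exact: measure_setI_supp.
Qed.

(* Slicing [h] at the heights [k / n], the two integrals of each slice lie
   between the measures of two consecutive superlevel sets divided by [n]. *)
Let Rint_slice h n : C h -> (forall x, G x -> 0 <= h x <= 1) ->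
  `|\int[outer_prob]_(x in G) h x - L h| <= n.+1%:R^-1.
Proof.
move=> ch h01; pose N : R := n.+1%:R.
pose a k : R := k%:R / N.
have a_ge0 k : 0 <= a k by rewrite divr_ge0.
have a_inc k : a k < a k.+1 by rewrite ltr_pM2r ?invr_gt0// ltr_nat.
have aD k : a k.+1 - a k = N^-1 by rewrite /a -mulrBl -natrB// subSnn mul1r.
pose V k := [set x | G x -> a k < h x].
have oV k : open (V k).
  rewrite (_ : V k = [set x | G x -> - 1 * h x < - a k]).
    by apply: open_lt_within; exact: CZ.
  by apply/funext => x; apply/propext; rewrite /V/= mulN1r ltrN2.
pose g k x := Num.min (a k.+1) (h x) - Num.min (a k) (h x).
have cg k : C (g k) by apply: CB; exact: C_min.
have hg x : G x -> h x = \sum_(k < n.+1) g k x.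
  move=> /h01/andP[h0 h1]; rewrite -(big_mkord xpredT (fun k => g k x)).
  rewrite (@telescope_sumr _ 0 n.+1 (fun k => Num.min (a k) (h x)))// /a mul0r divff ?pnatr_eq0//.
  by rewrite (min_r h1) (min_l h0) subr0.
have gle k x : G x -> g k x <= N^-1 * \1_(V k) x.
  move=> Gx; rewrite indicE /g -(aD k).
  case: (boolP (x \in V k)) => [/set_mem/(_ Gx) hk|/negP Vk].
    by rewrite mulr1 (min_l (ltW hk)) lerD2r ge_min lexx.
  have hk : h x <= a k by rewrite leNgt; apply/negP => hk; apply: Vk; rewrite inE.
  by rewrite mulr0 !min_r ?subrr// (le_trans hk)// ltW.
have gge k x : G x -> N^-1 * \1_(V k.+1) x <= g k x.
  move=> Gx; rewrite indicE /g -(aD k).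
  case: (boolP (x \in V k.+1)) => [/set_mem/(_ Gx) hk|_].
    by rewrite mulr1 (min_l (ltW hk)) min_l// ltW// (lt_trans _ hk).
  by rewrite mulr0 subr_ge0 le_min !ge_min lexx orbT andbT ltW.
have N0 : 0 < N^-1 by rewrite invr_gt0.
have bg k : bounded_measurable (G : set (borel T)) (g k) by exact: C_bounded_measurable.
have b1 (W : set T) : open W -> bounded_measurable (G : set (borel T)) (\1_W : T -> R).
  move=> /borel_open mW; split; first exact: measurable_indic.
  by exists 1 => x _; rewrite indicE; case: (_ \in _); rewrite ?normr1 ?normr0.
have Lg k : N^-1 * inner (V k.+1) <= L (g k) <= N^-1 * inner (V k).
  apply/andP; split.
    rewrite mulrC ler_pdivrMr// mulrC -LZ//; apply: inner_le_majorant; first exact: CZ.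
    by move=> x Gx; rewrite -ler_pdivrMl// gge.
  rewrite mulrC ler_pdivlMr// mulrC -LZ//; apply: le_inner; split; first exact: CZ.
  by move=> x Gx; rewrite -ler_pdivlMl// gle.
have Ig k : N^-1 * inner (V k.+1) <= \int[outer_prob]_(x in G) g k x <= N^-1 * inner (V k).
  have i1 W : open W -> N^-1 * inner W = \int[outer_prob]_(x in G) (N^-1 * \1_W x).
    move=> oW; rewrite RintegralZl ?Rint_indic//.
    exact: (bounded_measurable_integrable outer_prob mG (b1 W oW)).
  rewrite !i1//; apply/andP; split; apply: le_Rintegral => //;
    by [apply: bounded_measurable_integrable => //; apply: bounded_measurableZ; exact: b1
       |apply: bounded_measurable_integrable => //; exact: bg
       |move=> x /gge
       |move=> x /gle].
have -> : \int[outer_prob]_(x in G) h x = \sum_(k < n.+1) \int[outer_prob]_(x in G) g k x.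
  rewrite -Rintegral_bounded_sum//.
  by apply: eq_Rintegral => x /set_mem /hg.
have -> : L h = \sum_(k < n.+1) L (g k).
  rewrite -L_sum//; apply/eqP; rewrite eq_le.
  have cs : C (fun x => \sum_(k < n.+1) g k x) by exact: C_sum.
  by apply/andP; split; apply: L_le => // x /hg ->.
rewrite -sumrB (le_trans (ler_norm_sum _ _ _))//.
apply: (@le_trans _ _ (\sum_(k < n.+1) N^-1 * (inner (V k) - inner (V k.+1)))).
  apply: ler_sum => k _; have /andP[? ?] := Ig k; have /andP[? ?] := Lg k.
  by rewrite mulrBr ler_norml opprB !lerB.
rewrite -mulr_sumr ler_piMr ?(ltW N0)//.
rewrite -(big_mkord xpredT (fun k => inner (V k) - inner (V k.+1))).
rewrite (eq_bigr (fun i => - inner (V i.+1) - - inner (V i))); last first.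
  by move=> i _; rewrite opprK addrC.
rewrite (@telescope_sumr _ 0 n.+1 (fun i => - inner (V i)))// opprK addrC.
by rewrite lerBlDr (le_trans (inner_le1 _))// lerDl.
Qed.

Lemma riesz_representation :
  exists g : prob_on R G, forall h, C h -> \int[g]_(x in G) h x = L h.
Proof.
exists (ProbOn outer_prob_supp) => h ch /=.
have H01 g : C g -> (forall x, G x -> 0 <= g x <= 1) ->
    \int[outer_prob]_(x in G) g x = L g.
  move=> cg g01; apply/eqP; rewrite -subr_eq0 -normr_le0; apply/ler_addgt0Pr => e e0.
  have [n _ /(_ n (leqnn n)) ne] := near_infty_natSinv_lt (PosNum e0).
  by rewrite add0r (le_trans (Rint_slice n cg g01))// ltW.
have [_ [M hM]] := C_bounded_measurable ch.
(* [Rint_slice] requires values in [0, 1]. The affine image [g] of [h] has them, and both the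
   integral and [L] commute with affine maps. *)
pose B := `|M| + 1; have B0 : 0 < B by rewrite ltr_wpDl.
pose g x := (2 * B)^-1 * (h x + B).
have cg : C g by apply: CZ; apply: CD => //; exact: (@C_cst B).
have hE : h = fun x => 2 * B * g x - B.
  by apply/funext => x; rewrite /g mulrA divff ?mul1r ?addrK// mulf_neq0 ?gt_eqF.
rewrite hE LB; [|exact: CZ|exact: (@C_cst B)].
have bg : bounded_measurable (G : set (borel T)) g by exact: C_bounded_measurable.
rewrite LZ// L_cst RintegralB//; last 2 first.
- apply: (bounded_measurable_integrable outer_prob mG).
  exact: bounded_measurableZ.
- apply: (bounded_measurable_integrable outer_prob mG).
  exact: bounded_measurable_cst.
rewrite RintegralZl//; last exact: (bounded_measurable_integrable outer_prob mG).
rewrite H01//; last first.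
  move=> x Gx; have := hM x Gx; have := ler_norm M.
  rewrite ler_norml /g => M1 /andP[M2 M3]; apply/andP; split.
    by rewrite mulr_ge0 ?invr_ge0 ?mulr_ge0 ?(ltW B0)//; rewrite /B; lra.
  by rewrite mulrC ler_pdivrMr ?mulr_gt0// mul1r /B; lra.
rewrite Rintegral_cst//; congr (_ - _).
apply: etrans (congr1 (fun z => B * fine z) (_ : outer_prob G = 1%E)) (mulr1 B).
rewrite -[RHS](probability_setT outer_prob) -[G in LHS]setTI.
exact: (measure_setI_supp (mu := outer_prob)).
Qed.

End riesz.

(** * The weak* topology *)

Lemma ultra_cvg_compact (I : Type) (T : topologicalType) (F : set_system I)
    (f : I -> T) (K : set T) : UltraFilter F -> compact K ->
  F (f @^-1` K) -> exists2 p, K p & f @ F --> p.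
Proof.
move=> FU cK FK; have [p [Kp clp]] := cK (f @ F) _ FK.
exists p => // B nB; have [//|FNB] := in_ultra_setVsetC (f @^-1` B) FU.
by have [x []] := clp (~` B) B FNB nB.
Qed.

Lemma compact_within_continuous_bounded (R : realType) (T : topologicalType)
    (G : set T) (h : T -> R) : compact G -> {within G, continuous h} ->
  exists M, forall x, G x -> `|h x| <= M.
Proof.
move=> cG ch; have [M [_ hM]] := compact_bounded (continuous_compact ch cG).
by exists (M + 1) => x Gx; apply: (hM (M + 1)); [rewrite ltrDl|exists x].
Qed.

Section prob_on_topology.
Context (R : realType) (X : ptopologicalType) (G : set X).

Lemma Rintegral_prob_on_continuous (h : X -> R) : {within G, continuous h} ->
  continuous (fun g : prob_on R G => \int[g]_(z in G) h z).
Proof.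
move=> ch; pose h' : continuous_on R G := exist _ h ch.
have c1 : continuous (@prob_eval R X G : prob_on R G -> _).
  exact: initial_continuous.
have c2 : continuous (proj h' : prod_topology (fun _ : continuous_on R G => R) -> R).
  exact: proj_continuous.
by move=> g; apply: (continuous_comp (c1 g) (c2 _)).
Qed.

Lemma cvg_prob_on (F : set_system (prob_on R G)) (g : prob_on R G) :
  Filter F ->
  (forall h : X -> R, {within G, continuous h} ->
    (fun g' : prob_on R G => \int[g']_(z in G) h z) @ F -->
      \int[g]_(z in G) h z) ->
  F --> g.
Proof.
move=> FF Fh.
have cp : prob_eval (G := G) @ F --> prob_eval g.
  apply/cvg_sup => h A /= [_ [[B Bop <-] Bg sBA]].
  apply: (filterS sBA); apply: (Fh (sval h) (svalP h)).
  exact: open_nbhs_nbhs.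
move=> A /= [_ [[B Bop <-] Bg sBA]].
by apply: (filterS sBA); apply: cp; exact: open_nbhs_nbhs.
Qed.

End prob_on_topology.

Lemma bounded_measurable_within_continuous (R : realType) (T : ptopologicalType)
    (G : set T) (h : T -> R) : compact G -> {within G, continuous h} ->
  bounded_measurable (G : set (borel T)) h.
Proof.
move=> cG ch; split; first exact: within_continuous_borel.
exact: compact_within_continuous_bounded.
Qed.

Lemma prob_on_setT (R : realType) (T : ptopologicalType) (G : set T)
    (g : prob_on R G) : measurable (G : set (borel T)) -> g G = 1%E.
Proof.
move=> mG; rewrite -[RHS](probability_setT g).
rewrite -[RHS](measure_setI_supp (mu := g) measurableT mG (prob_on_supp g)).
by rewrite setTI.
Qed.

Lemma Rintegral_prob_on_cst (R : realType) (T : ptopologicalType) (G : set T)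
    (g : prob_on R G) c : measurable (G : set (borel T)) ->
  \int[g]_(_ in G) c = c.
Proof.
move=> mG; rewrite Rintegral_cst//.
exact: etrans (congr1 (fun z => c * fine z) (prob_on_setT g mG)) (mulr1 c).
Qed.

(** Along an ultrafilter of measures the integrals of each continuous function stay in a segment and
    therefore converge. The limits form a positive normalised linear functional, and the measure
    that represents it is the limit of the ultrafilter. *)
Lemma compact_prob_on (R : realType) (X : ptopologicalType) (dist : X -> X -> R)
    (G : set X) : metrizes dist -> compact G -> compact [set: prob_on R G].
Proof.
move=> md cG; have mG : measurable (G : set (borel X)).
  exact: borel_closed (metrizes_compact_closed md cG).
rewrite compact_ultra => F FU _.
pose L (h : X -> R) : R := lim ((fun g : prob_on R G => \int[g]_(z in G) h z) @ F).
have bh (h : X -> R) : {within G, continuous h} -> bounded_measurable (G : set (borel X)) h.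
  exact: bounded_measurable_within_continuous.
have ih (h : X -> R) (g : prob_on R G) : {within G, continuous h} -> g.-integrable G (EFin \o h).
  by move=> ch; apply: (bounded_measurable_integrable g mG); exact: bh.
have Lc (h : X -> R) : {within G, continuous h} ->
    (fun g : prob_on R G => \int[g]_(z in G) h z) @ F --> L h.
  move=> ch; have [_ [M hM]] := bh h ch.
  have [|p _ Fp] := @ultra_cvg_compact _ _ F
      (fun g : prob_on R G => \int[g]_(z in G) h z) `[- M, M] FU (@segment_compact _ _ _).
    apply: filterE => g; rewrite /= in_itv/= -ler_norml.
    apply: le_trans (le_normr_Rintegral mG (ih h g ch)) _.
    apply: le_trans (le_Rintegral mG (ih _ g _) (ih (fun=> M) g _) hM) _.
    - by move=> x; apply: cvg_norm; exact: ch.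
    - by move=> x; exact: cvg_cst.
    - by rewrite Rintegral_prob_on_cst.
  by rewrite /L (cvg_lim _ Fp).
have FF : ProperFilter F by exact: ultra_proper.
have [||||g gL] := @riesz_representation R X dist md G L cG.
- move=> h1 h2 c1 c2; apply/cvg_lim => //.
  rewrite (_ : (fun g : prob_on R G => _) = (fun g : prob_on R G =>
      \int[g]_(z in G) h1 z + \int[g]_(z in G) h2 z)).
    by apply: cvgD; exact: Lc.
  by apply/funext => g; rewrite RintegralD//; exact: ih.
- move=> c h ch; apply/cvg_lim => //.
  rewrite (_ : (fun g : prob_on R G => _) = (fun g : prob_on R G =>
      c * \int[g]_(z in G) h z)).
    by apply: cvgM; [exact: cvg_cst|exact: Lc].
  by apply/funext => g; rewrite RintegralZl//; exact: ih.
- move=> h1 h2 c1 c2 h12; apply: (ler_cvg_to (Lc _ c1) (Lc _ c2)).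
  by apply: filterE => g; apply: le_Rintegral => //; exact: ih.
- apply/cvg_lim => //; rewrite (_ : (fun g : prob_on R G => _) = cst 1).
    exact: cvg_cst.
  by apply/funext => g; rewrite Rintegral_prob_on_cst.
exists g; split=> //; apply: cvg_prob_on => h ch.
by rewrite gL//; exact: Lc.
Qed.

Lemma finite_measure_mixture d (T : measurableType d) (R : realType) m
    (w : 'I_m -> R) (nu : 'I_m -> {finite_measure set T -> \bar R}) :
  (forall i, 0 <= w i) -> exists mu : {finite_measure set T -> \bar R},
    forall A, measurable A -> mu A = (\sum_i (w i)%:E * nu i A)%E.
Proof.
move=> w0; pose nuS j : {measure set T -> \bar R} :=
  if insub j is Some i then mscale (NngNum (w0 i)) (nu i) else mzero.
have sE A : msum nuS m A = (\sum_i (w i)%:E * nu i A)%E.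
  by rewrite /msum/=; apply: eq_bigr => i _; rewrite /nuS valK.
have sfin : fin_num_fun (msum nuS m).
  move=> A mA; apply/sum_fin_numP => i _ _.
  by rewrite /nuS valK/= fin_numM// fin_num_measure.
by exists (measure_fin sfin) => A mA; exact: sE.
Qed.

Lemma prob_on_mixture (R : realType) (X : ptopologicalType) (G : set X) m
    (w : 'I_m -> R) (g : 'I_m -> prob_on R G) : open (~` G) ->
  (forall i, 0 <= w i) -> \sum_i w i = 1 -> exists gamma : prob_on R G,
    forall A : set (borel X), measurable A ->
      gamma A = (\sum_i (w i)%:E * g i A)%E.
Proof.
move=> oG w0 w1; have [mu muE] := finite_measure_mixture (fun i => g i) w0.
have muT : mu setT = 1%E.
  rewrite muE// -[RHS]/(1%R%:E) -w1 -sumEFin; apply: eq_bigr => i _.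
  exact: etrans (congr1 (mule _) (probability_setT (g i))) (mule1 _).
have muG : measure_prob muT (~` G) = 0%E.
  rewrite /= /measure_prob muE; last exact: borel_open.
  rewrite big1// => i _.
  exact: etrans (congr1 (mule _) (prob_on_supp (g i))) (mule0 _).
by exists (ProbOn muG) => A mA; exact: muE.
Qed.

Lemma convex_hull_segment (R : realType) (X : ptopologicalType) (G : set X)
    (A : set (prob_on R G)) (g g' : prob_on R G) (t : R) : open (~` G) ->
  convex_hull A g -> convex_hull A g' -> 0 <= t <= 1 ->
  exists2 g'', convex_hull A g'' & forall Q : set (borel X), measurable Q ->
    g'' Q = ((1 - t)%:E * g Q + t%:E * g' Q)%E.
Proof.
move=> oG [m [w [h [w0 w1 Ah gE]]]] [m' [w' [h' [w'0 w'1 Ah' g'E]]]].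
move=> /andP[t0 t1].
pose W (i : 'I_(m + m')) := match fintype.split i with
  | inl j => (1 - t) * w j | inr j => t * w' j end.
pose H (i : 'I_(m + m')) := match fintype.split i with inl j => h j | inr j => h' j end.
have W0 i : 0 <= W i.
  by rewrite /W; case: fintype.split => j; rewrite mulr_ge0 ?subr_ge0.
have sE (V : nmodType) (F : R -> prob_on R G -> V) : \sum_i F (W i) (H i) =
    \sum_i F ((1 - t) * w i) (h i) + \sum_i F (t * w' i) (h' i).
  rewrite big_split_ord/=; congr (_ + _); apply: eq_bigr => i _.
    by rewrite /W /H (unsplitK (inl i)).
  by rewrite /W /H (unsplitK (inr i)).
have W1 : \sum_i W i = 1.
  by rewrite (sE _ (fun a _ => a)) -!mulr_sumr w1 w'1 !mulr1 subrK.
have [g'' g''E] := prob_on_mixture H oG W0 W1.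
exists g'' => [|Q mQ].
  exists (m + m')%N, W, H; split=> // i.
  by rewrite /H; case: fintype.split.
rewrite g''E// (sE _ (fun a (b : prob_on R G) => (a%:E * b Q)%E)) gE// g'E//.
rewrite !ge0_sume_distrr; last 2 first.
- by move=> i _; rewrite mule_ge0// lee_fin.
- by move=> i _; rewrite mule_ge0// lee_fin.
by congr (_ + _)%E; apply: eq_bigr => i _; rewrite EFinM muleA.
Qed.

(** The vector is [c0 - x] for a near-minimiser [c0] of the squared distance to [x]; since [C] need
    not be closed, there may be no exact projection. The explicit constants matter later: the bound
    [B] confines all separating vectors to one box, and the gap [e / 2] does not depend on [x]. *)
Lemma convex_separation (R : realType) N (C : set ('I_N -> R)) (x : 'I_N -> R)
    (B e : R) : C !=set0 -> (forall c, C c -> forall j, `|c j - x j| <= B) ->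
  (forall c c' t, C c -> C c' -> 0 <= t <= 1 ->
    C (fun j => c j + t * (c' j - c j))) -> 0 < e ->
  (exists2 c, C c & \sum_j (c j - x j) ^+ 2 < e) \/
  (exists2 v : 'I_N -> R, (forall j, `|v j| <= B) &
    forall c, C c -> e / 2 <= \sum_j v j * (c j - x j)).
Proof.
move=> [a Ca] CB Cconv e0; pose S c := \sum_j (c j - x j) ^+ 2.
have [?|nS] := pselect (exists2 c, C c & S c < e); [by left|right].
have Se c : C c -> e <= S c.
  by move=> Cc; rewrite leNgt; apply/negP => ?; apply: nS; exists c.
have infS : has_inf [set S c | c in C].
  by split; [exists (S a), a|exists e => _ [c /Se ? <-]].
pose K : R := \sum_(j < N) (2 * B) ^+ 2.
have K0 : 0 <= K by apply: sumr_ge0 => j _; exact: sqr_ge0.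
(* [K] bounds the squared distance [P] from [c0] to [c]. Moving from [c0] towards [c] by the
   fraction [t] cannot bring [S] below its infimum; as [c0] is optimal up to [t * (e / 2)], this
   gives [2 * Q > - e / 2 - t * P], and [t * K <= e / 2] then yields [Q > - e / 2], which is added
   to [S c0 >= e]. *)
pose t := Num.min 1 (e / (2 * (K + 1))).
have K1 : 0 < 2 * (K + 1) by rewrite mulr_gt0// ltr_wpDl.
have t0 : 0 < t by rewrite lt_min ltr01 divr_gt0.
have t1 : t <= 1 by rewrite ge_min lexx.
have tK : t * K <= e / 2.
  have : t <= e / (2 * (K + 1)) by rewrite ge_min lexx orbT.
  rewrite ler_pdivlMr// => h; rewrite ler_pdivlMr//.
  by apply: le_trans h; have := ltW t0; lra.
have [|_ [c0 Cc0 <-] c0D] := @inf_adherent _ _ (t * (e / 2)) _ infS.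
  by rewrite mulr_gt0// divr_gt0.
exists (fun j => c0 j - x j) => [j|c Cc]; first exact: CB.
pose Q := \sum_j (c0 j - x j) * (c j - c0 j).
pose P := \sum_j (c j - c0 j) ^+ 2.
have PK : P <= K.
  apply: ler_sum => j _; rewrite -[leLHS]real_normK ?num_real// ler_sqr ?nnegrE//.
    rewrite (_ : c j - c0 j = (c j - x j) - (c0 j - x j)); last by ring.
    apply: le_trans (ler_normB _ _) _; rewrite mulr2n mulrDl mul1r.
    by apply: lerD; exact: CB.
  by rewrite mulr_ge0// (le_trans _ (CB _ Cc j)).
have -> : \sum_j (c0 j - x j) * (c j - x j) = Q + S c0.
  by rewrite /Q /S -big_split/=; apply: eq_bigr => j _; ring.
have SE : S (fun j => c0 j + t * (c j - c0 j)) = S c0 + t * (2 * Q + t * P).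
  rewrite /S /Q /P mulrDr !mulr_sumr -!big_split/=.
  by apply: eq_bigr => j _; ring.
have : inf [set S c | c in C] <= S c0 + t * (2 * Q + t * P).
  rewrite -SE; apply: ge_inf; first exact: infS.2.
  by exists (fun j => c0 j + t * (c j - c0 j)) => //; apply: Cconv => //; rewrite ltW.
move=> iS; have : 0 < t * (e / 2 + 2 * Q + t * P).
  by move: c0D iS; rewrite !mulrDr; lra.
rewrite pmulr_rgt0// => h; have := Se c0 Cc0.
have := ler_wpM2l (ltW t0) PK; lra.
Qed.

Lemma rho_le (R : realType) (n : nat) (Uhat : pmetricType R)
    (G : set ('rV[R]_n * Uhat)) (q : nat -> 'rV[R]_n * Uhat -> R)
    (g g' : prob_on R G) N e :
  (forall j, `|\int[g]_(z in G) q j z - \int[g']_(z in G) q j z| <= 2) ->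
  (forall j, (j < N)%N ->
    `|\int[g]_(z in G) q j z - \int[g']_(z in G) q j z| <= e) -> 0 <= e ->
  (rho q g g' <= (e + 2 * 2 ^- N)%:E)%E.
Proof.
pose a j := `|\int[g]_(z in G) q j z - \int[g']_(z in G) q j z|.
move=> a2 ae e0; apply: lime_le.
  by apply: is_cvg_nneseries => i _ _; rewrite lee_fin mulr_ge0.
apply: nearW => M; rewrite big_mkord sumEFin lee_fin.
have p0 i : 0 <= 2 ^- i :> R by rewrite invr_ge0 exprn_ge0.
(* This bound is an invariant of the partial sums: up to [N] the second summand is zero and each
   term costs at most [e] times its weight; from [N] on each term costs at most twice its weight. *)
apply: (@le_trans _ _ (e * (1 - 2 ^- M) + 2 * (2 ^- N - 2 ^- (maxn M N)))).
  elim: M => [|M ih].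
    by rewrite big_ord0 expr0 invr1 subrr mulr0 max0n subrr mulr0 addr0.
  rewrite big_ord_recr/=.
  have hM : 2 ^- M = 2 * 2 ^- M.+1 :> R.
    by rewrite exprS invfM mulrA divff ?mul1r// pnatr_eq0.
  have [MN|NM] := ltnP M N.
    rewrite (maxn_idPr MN); move: ih; rewrite (maxn_idPr (ltnW MN)) => ih.
    have := ler_wpM2l (p0 M.+1) (ae M MN); rewrite hM in ih; rewrite /a; lra.
  rewrite (maxn_idPl (leqW NM)); move: ih; rewrite (maxn_idPl NM) => ih.
  have := ler_wpM2l (p0 M.+1) (a2 M); rewrite hM in ih.
  have := mulr_ge0 e0 (p0 M.+1); rewrite /a; lra.
have := mulr_ge0 e0 (p0 M); have := p0 (maxn M N); lra.
Qed.

(** * Measurable selection *)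

(** Lower semicontinuity enters as closedness of the sublevel sets at the values of [h]. Without a
    minimiser their complements would cover [K]; in a finite subcover, the index point with the
    least value lies in none of the chosen complements. *)
Lemma compact_min (R : realType) (T : ptopologicalType) (K : set T)
    (h : T -> R) : compact K -> K !=set0 ->
  (forall x, K x -> closed (K `&` [set z | h z <= h x])) ->
  exists2 x, K x & forall y, K y -> h x <= h y.
Proof.
move=> cK [x0 Kx0] ch; apply: contrapT => nmin.
have small x : K x -> exists2 y, K y & h y < h x.
  move=> Kx; apply: contrapT => ny; apply: nmin; exists x => // y Ky.
  by rewrite leNgt; apply/negP => ?; apply: ny; exists y.
move: cK; rewrite compact_cover => cK.
have [||D DK KD] := cK T K (fun x => ~` (K `&` [set z | h z <= h x])).
- by move=> x Kx; apply: closed_openC; exact: ch.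
- move=> x Kx; have [y Ky yx] := small x Kx; exists y => //= -[_].
  by rewrite leNgt yx.
have [x xD xmin] : exists2 x, x \in D & forall y, y \in D -> h x <= h y.
  have [y yD _] := KD _ Kx0.
  have [x xD xmin] := @arg_minP _ _ _ [` yD]%fset xpredT (fun z => h (val z)) isT.
  exists (val x); first exact: valP.
  by move=> z zD; exact: (xmin [` zD]%fset isT).
have Kx : K x by have := DK _ xD; rewrite inE.
have [y yD /= yx] := KD _ Kx.
by apply: yx; split=> //; exact: xmin.
Qed.

Section selection.
Context (R : realType) (T T' : ptopologicalType).
Variables (Y : set T) (g : nat -> T' -> R) (F : T -> set T').
Hypothesis Y_closed : closed Y.
Hypothesis T'_closed : forall K : set T', compact K -> closed K.
Hypothesis g_continuous : forall j, continuous (g j).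
Hypothesis g_separates : forall x y, (forall j, g j x = g j y) -> x = y.
Hypothesis F_compact : forall y, Y y -> compact (F y).
Hypothesis F_nonempty : forall y, Y y -> F y !=set0.
Hypothesis F_measurable : forall C, closed C ->
  measurable (Y `&` [set y | F y `&` C !=set0] : set (borel T)).

(* With [g] the distances to a dense sequence, minimising them one after the
   other shrinks [F y] to a single point, which depends measurably on [y]. *)
Fixpoint lexmin (k : nat) (y : T) : set T' :=
  if k is j.+1 then
    lexmin j y `&` [set u | forall u', lexmin j y u' -> g j u <= g j u']
  else F y.

Lemma closed_le_continuous (h : T' -> R) r : continuous h ->
  closed [set u | h u <= r].
Proof.
by move=> ch; apply: (closed_comp (f := h)) (@closed_le _ r) => x _; exact: ch.
Qed.

Lemma lexmin_compact k y : Y y -> compact (lexmin k y) /\ lexmin k y !=set0.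
Proof.
move=> Yy; elim: k => [|k [ck nk]] /=; first by split; [exact: F_compact|exact: F_nonempty].
have [|u ku umin] := @compact_min _ _ (lexmin k y) (g k) ck nk.
  move=> x kx; apply: closedI; first exact: T'_closed.
  exact: closed_le_continuous.
split; last by exists u; split.
rewrite (_ : _ `&` _ = lexmin k y `&` [set z | g k z <= g k u]).
  by apply: compact_closedI => //; exact: closed_le_continuous.
apply/seteqP; split=> z [kz /= hz]; split=> //; first exact: hz.
by move=> u' /umin; exact: le_trans.
Qed.

(** The minimisers of [g k] over stage [k] meet [C] exactly when stage [k] cut by [C] reaches every
    rational level that stage [k] reaches. Failure at level [r] involves stage [k] and closed sets
    only, so the induction must range over all closed [C]. *)
Lemma lexmin_measurable k C : closed C ->
  measurable (Y `&` [set y | lexmin k y `&` C !=set0] : set (borel T)).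
Proof.
elim: k C => [|k ih] C cC /=; first exact: F_measurable.
pose A (r : rat) (D : set T') : set (borel T) :=
  Y `&` [set y | lexmin k y `&` (D `&` [set u | g k u <= ratr r]) !=set0].
have mA r D : closed D -> measurable (A r D).
  by move=> cD; apply: ih; apply: closedI => //; exact: closed_le_continuous.
have mY : measurable (Y : set (borel T)) by exact: borel_closed.
rewrite (_ : _ `&` _ = Y `\` \bigcup_(r : rat) (A r setT `\` A r C)).
  apply: measurableD => //; apply: bigcupT_measurable_rat => r.
  by apply: measurableD; apply: mA => //; exact: closedT.
apply/seteqP; split=> [y [Yy [u [[ku umin] Cu]]]|y [Yy H]].
  split=> // -[r _ [[_ [u' [ku' [_ /= u'r]]]] +]]; apply.
  by split=> //; exists u; split=> //; split=> //=; exact: le_trans (umin _ ku') u'r.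
split=> //; have [ck [u0 ku0]] := lexmin_compact k Yy.
have HC u r : lexmin k y u -> g k u <= ratr r ->
    exists u', [/\ lexmin k y u', C u' & g k u' <= ratr r].
  move=> ku ur; apply: contrapT => nu; apply: H; exists r => //; split.
    by split=> //; exists u; split.
  by move=> [_ [u' [? [? ?]]]]; apply: nu; exists u'.
have [||u1 [k1 C1] min1] := @compact_min _ _ (lexmin k y `&` C) (g k)
    (compact_closedI ck cC) _ _.
- have [|r] := @rat_in_itvoo R (g k u0) (g k u0 + 1); first by rewrite ltrDl.
  rewrite in_itv/= => /andP[/ltW/(HC _ _ ku0)[u' [? ? _]] _].
  by exists u'.
- move=> x _; apply: closedI; last exact: closed_le_continuous.
  by apply: closedI => //; exact: T'_closed.
exists u1; split=> //; split=> // u ku; rewrite leNgt; apply/negP => uu1.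
have [r] := rat_in_itvoo uu1; rewrite in_itv/= => /andP[ur ru1].
have [u' [ku' Cu' u'r]] := HC u r ku (ltW ur).
by have := min1 u' (conj ku' Cu'); rewrite leNgt (le_lt_trans u'r).
Qed.

Lemma lexmin_nested k l y : (k <= l)%N -> lexmin l y `<=` lexmin k y.
Proof.
move=> /subnK <-; elim: (l - k)%N => [//|m ih] u; rewrite addSn /= => -[+ _].
exact: ih.
Qed.

(** Cantor's intersection argument: a cluster point of points chosen in the successive stages lies
    in each stage, as the stages are nested and closed. *)
Lemma lexmin_bigcap y C : Y y -> closed C ->
  (forall k, lexmin k y `&` C !=set0) ->
  exists2 u, C u & forall k, lexmin k y u.
Proof.
move=> Yy cC /choice[u uP].
have := @compact_closedI _ _ _ (lexmin_compact 0 Yy).1 cC.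
move=> /(_ (u @ \oo) _)[|x [[Fx Cx] clx]].
  exists 0%N => // k _ /=; have [ku Cu] := uP k; split=> //.
  exact: (@lexmin_nested 0%N k y (leq0n k)) ku.
exists x => // k; have /T'_closed := (lexmin_compact k Yy).1; apply.
move=> B nB; apply: clx => //; exists k => // l /= kl.
by have [+ _] := uP l; exact: lexmin_nested.
Qed.

Lemma measurable_selection : exists p : T -> T',
  measurable_fun (Y : set (borel T)) (p : borel T -> borel T') /\
  forall y, Y y -> F y (p y).
Proof.
pose p y := xget point [set u | forall k, lexmin k y u].
have pP y : Y y -> forall k, lexmin k y (p y).
  move=> Yy; have [|u _ ku] := lexmin_bigcap Yy closedT.
    by move=> k; rewrite setIT; have [] := lexmin_compact k Yy.
  by apply: (@xgetPex _ point [set u | forall k, lexmin k y u]); exists u.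
exists p; split=> [|y Yy]; last exact: pP Yy 0%N.
have mpC C : closed C -> measurable (Y `&` p @^-1` C : set (borel T)).
  move=> cC; rewrite (_ : _ `&` _ =
      \bigcap_k (Y `&` [set y | lexmin k y `&` C !=set0])).
    by apply: bigcapT_measurable => k; exact: lexmin_measurable.
  apply/seteqP; split=> [y [Yy Cp] k _|y H].
    by split=> //; exists (p y); split=> //; exact: pP.
  have [Yy _] := H 0%N I; split=> //=.
  have [|u Cu ku] := lexmin_bigcap Yy cC; first by move=> k; have [] := H k I.
  (* Both points survive stage [j.+1], so each of them minimises [g j] over stage [j], which
     contains the other. All the [g j] therefore agree at the two points. *)
  rewrite (_ : p y = u)//; apply: g_separates => j; apply/eqP.
  have [_ uj] := ku j.+1; have [_ pj] := pP y Yy j.+1.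
  by rewrite eq_le (uj _ (pP y Yy j)) (pj _ (ku j)).
move=> mY; move: (mY); apply: (@measurability _ _ (borel T) (borel T') Y p (@open T') erefl).
move=> _ [V oV <-]; rewrite (_ : _ `&` _ = Y `\` (Y `&` p @^-1` (~` V))).
  by apply: measurableD => //; apply: mpC; exact: open_closedC.
apply/seteqP; split=> [y [Yy Vp]|y [Yy nV]]; first by split=> // -[_]; exact.
by split=> //; apply: contrapT => nVp; apply: nV.
Qed.

End selection.

(** * Independence *)

Section measurable_into_compact.
Context (R : realType) (T : ptopologicalType) (dist : T -> T -> R).
Hypothesis dist_metrizes : metrizes dist.
Variable G : set T.
Hypothesis G_compact : compact G.
Context d (Omega : measurableType d).
Implicit Type Z : Omega -> T.

Let nets : exists s : nat -> seq T,
  (forall m z, z \in s m -> G z) /\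
  (forall m x, G x -> exists2 z, z \in s m & dist x z < m.+1%:R^-1).
Proof.
have /choice[s sP] m := metrizes_net dist_metrizes G_compact
  (e := m.+1%:R^-1) (ltac:(by rewrite invr_gt0)).
by exists s; split=> m z; [exact: (sP m).1|exact: (sP m).2].
Qed.

(** The preimage of an open set is the countable union of the preimages of those net balls that it
    contains. Measurability of a [G]-valued map is thus reduced to that of real-valued distances. *)
Lemma measurable_fun_balls Z : (forall w, G (Z w)) ->
  (forall z e, G z -> measurable [set w | dist (Z w) z < e]) ->
  measurable_fun [set: Omega] (Z : Omega -> borel T).
Proof.
move=> GZ mZ; have [s [sG sP]] := nets.
apply: (@measurability _ _ Omega (borel T) setT Z (@open T) erefl).
move=> _ [V oV <-]; rewrite setTI.
pose B m i := [set w | dist (Z w) (nth point (s m) i) < m.+1%:R^-1].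
pose I m := [set i | (i < size (s m))%N /\
  forall y, dist (nth point (s m) i) y < m.+1%:R^-1 -> V y].
rewrite (_ : _ @^-1` _ = \bigcup_m \bigcup_(i in I m) B m i).
  apply: bigcupT_measurable => m; apply: bigcup_measurable => i [im _].
  by apply: mZ; apply: (sG m); exact: mem_nth.
apply/seteqP; split=> w /=; last by move=> [m _ [i [_ ballV] Bw]]; apply: ballV; rewrite (metrizesC dist_metrizes).
move=> VZ; have [r r0 rV] := (metrizes_open dist_metrizes V).1 oV _ VZ.
have r20 : 0 < r / 2 by rewrite divr_gt0.
have [m _ /(_ m (leqnn m)) mr] := near_infty_natSinv_lt (PosNum r20).
have [z zs Zz] := sP m _ (GZ w).
exists m => //; exists (index z (s m)); last by rewrite /B /= nth_index.
split=> [|y]; first by rewrite index_mem.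
rewrite nth_index// => zy; apply: rV.
apply: le_lt_trans (metrizes_triangle dist_metrizes z _ _) _.
by rewrite (splitr r); apply: ltrD; exact: lt_trans mr.
Qed.

(** [Z] is replaced by the first point of a finite net close to it. The approximant is given by the
    index [I m w], so that [nth_sumE] can expand any function of it as a finite sum over the events
    [I m w = i]. *)
Lemma simple_approximation Z : (forall w, G (Z w)) ->
  measurable_fun [set: Omega] (Z : Omega -> borel T) ->
  exists (s : nat -> seq T) (I : nat -> Omega -> nat),
  [/\ forall m i, (i < size (s m))%N -> G (nth point (s m) i),
      forall m w, (I m w < size (s m))%N,
      forall m i, measurable [set w | I m w = i] &
      forall m w, dist (Z w) (nth point (s m) (I m w)) < m.+1%:R^-1].
Proof.
move=> GZ mZ; have [s [sG sP]] := nets.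
pose a m w z := dist (Z w) z < m.+1%:R^-1.
have has_a m w : has (a m w) (s m).
  by have [z zs Zz] := sP m _ (GZ w); apply/hasP; exists z.
exists s, (fun m w => find (a m w) (s m)); split=> [m i im|m w|m i|m w].
- by apply: (sG m); exact: mem_nth.
- by rewrite -has_find.
- have mB j : measurable [set w | a m w (nth point (s m) j)].
    rewrite -[X in measurable X]setTI; apply: (mZ measurableT
      [set x | dist x (nth point (s m) j) < m.+1%:R^-1]).
    apply: borel_open; apply: (open_comp (f := fun x => dist x _)) (@open_lt _ _).
    move=> x _; under eq_fun do rewrite (metrizesC dist_metrizes).
    exact: metrizes_dist_continuous.
  have [im|im] := ltnP i (size (s m)); last first.
    rewrite (_ : [set w | _] = set0)//; apply/seteqP; split=> w //= wi.
    by have := has_a m w; rewrite has_find wi ltnNge im.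
  rewrite (_ : [set w | _] = [set w | a m w (nth point (s m) i)] `&`
      \bigcap_(j in [set j | (j < i)%N]) ~` [set w | a m w (nth point (s m) j)]).
    apply: measurableI => //; apply: bigcap_measurableType => j _.
    exact: measurableC.
  apply/seteqP; split=> w /= => [<-|[ai aj]].
    split=> [|j /= ji]; first exact: (nth_find point (has_a m w)).
    by apply/negP; rewrite (before_find point ji).
  apply/eqP; rewrite eqn_leq; apply/andP; split.
    by rewrite leqNgt; apply/negP => ji; have := before_find point ji; rewrite ai.
  rewrite leqNgt; apply/negP => ji; apply: (aj _ ji).
  exact: (nth_find point (has_a m w)).
- by have := nth_find point (has_a m w).
Qed.

Lemma nth_sumE (s : seq T) (I : nat) (h : T -> R) : (I < size s)%N ->
  h (nth point s I) = \sum_(i < size s) (I == i)%:R * h (nth point s i).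
Proof.
move=> Is; rewrite (bigD1 (Ordinal Is))//= eqxx mul1r big1 ?addr0// => i iI.
by rewrite (_ : I == i = false) ?mul0r//; apply/negbTE; rewrite eq_sym.
Qed.

Lemma cvg_approximation (z : T) (u : nat -> T) (h : T -> R) :
  {within G, continuous h} -> G z -> (forall m, G (u m)) ->
  (forall m, dist z (u m) < m.+1%:R^-1) -> h (u m) @[m --> \oo] --> h z.
Proof.
move=> /(metrizes_within_continuous dist_metrizes) ch Gz Gu zu.
apply/cvgrPdist_lt => e e0; have [r r0 hr] := ch z Gz e e0.
near=> m; apply: hr => //; apply: lt_trans (zu m) _.
by near: m; exact: (near_infty_natSinv_lt (PosNum r0)).
Unshelve. all: by end_near. Qed.

(** Along the simple approximations of [Z] the expression is a finite sum of indicators times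
    measurable functions [F z]; continuity in [z] gives the pointwise limit. *)
Lemma caratheodory_fun_measurable Z (F : T -> Omega -> R) :
  (forall w, G (Z w)) -> measurable_fun [set: Omega] (Z : Omega -> borel T) ->
  (forall z, G z -> measurable_fun [set: Omega] (F z)) ->
  (forall w, {within G, continuous (F ^~ w)}) ->
  measurable_fun [set: Omega] (fun w => F (Z w) w).
Proof.
move=> GZ mZ mF cF; have [s [I [sG Is mI Ia]]] := simple_approximation GZ mZ.
apply: (@measurable_fun_cvg _ _ _ setT (fun m w => F (nth point (s m) (I m w)) w)).
  move=> m; under eq_fun do rewrite (nth_sumE (F ^~ _) (Is m _)).
  apply: measurable_sum => i; apply: measurable_funM; last exact/mF/sG.
  rewrite (_ : (fun w => _) = \1_[set w | I m w = i]); first exact: measurable_indic.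
  by apply/funext => w; rewrite indicE; congr (nat_of_bool _)%:R; apply/eqP/idP; rewrite inE.
by move=> w _; apply: (cvg_approximation (cF w)) => // m; exact: sG.
Qed.

End measurable_into_compact.

Lemma Rintegral_prob_cst d (T : measurableType d) (R : realType)
  (P : probability T R) c : \int[P]_x c = c.
Proof.
rewrite Rintegral_cst//.
exact: etrans (congr1 (fun z => c * fine z) (probability_setT P)) (mulr1 c).
Qed.

Lemma Rintegral_mrestr d (T : measurableType d) (R : realType)
    (mu : {finite_measure set T -> \bar R}) (A : set T) (mA : measurable A)
    (h : T -> R) : bounded_measurable setT h ->
  \int[mrestr mu mA]_x h x = \int[mu]_(x in A) h x.
Proof.
move=> bh; rewrite -(setvU A) setUC Rintegral_setU//.
- rewrite [X in _ + X](_ : _ = 0) ?addr0.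
    congr fine; apply: eq_measure_integral => B mB BA.
    by rewrite /= /mrestr setIidl.
  rewrite /Rintegral (_ : integral _ _ _ = 0%E)//.
  rewrite -[RHS](integral_measure_zero (~` A) (fun z => (h z)%:E)).
  apply: eq_measure_integral => B mB BA; rewrite /= /mrestr /mzero.
  by rewrite (_ : B `&` A = set0) ?measure0//; apply/disjoints_subset.
- exact: measurableC.
- rewrite (_ : A `|` ~` A = setT) ?setUv//.
  exact: (bounded_measurable_integrable _ measurableT).
- by apply/disj_setPS; rewrite setICr.
Qed.

Section independence.
Context d d' (Omega : measurableType d) (S : measurableType d') (R : realType).
Variables (P : probability Omega R) (s : nat -> {RV P >-> S}).
Hypothesis s_iid : iid s.

(** A pi-system that generates the history [s 0, ..., s t.-1]. The index [t] itself is excluded, so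
    that this history is independent of [s t]. *)
Definition cylinder (t : nat) : set (set Omega) :=
  [set A | exists2 B : nat -> set S, (forall j, measurable (B j)) &
    A = \bigcap_(j in [set j | (j < t)%N]) (s j @^-1` B j)].

Let measurable_preim j (B : set S) : measurable B -> measurable (s j @^-1` B).
Proof. by move=> mB; rewrite -[X in measurable X]setTI; exact: measurable_funP. Qed.

Lemma cylinder_measurable t : cylinder t `<=` measurable.
Proof.
move=> _ [B mB ->]; apply: bigcap_measurableType => j _.
exact: measurable_preim.
Qed.

Lemma sigma_cylinder_measurable t : <<s cylinder t >> `<=` measurable.
Proof.
apply: smallest_sub; first exact: sigma_algebra_measurable.
exact: cylinder_measurable.
Qed.

Lemma sigma_cylinderS t : <<s cylinder t >> `<=` <<s cylinder t.+1 >>.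
Proof.
apply: smallest_sub; first exact: smallest_sigma_algebra.
move=> _ [B mB ->]; apply: sub_sigma_algebra.
exists (fun j => if (j < t)%N then B j else setT).
  by move=> j; case: ifPn => // _; exact: measurableT.
apply/seteqP; split=> w h j /= jt; first by case: ifPn => // jt'; exact: h.
by have := h j (ltnW jt); rewrite jt.
Qed.

Lemma sigma_cylinder_last t (B : set S) : measurable B ->
  <<s cylinder t.+1 >> (s t @^-1` B).
Proof.
move=> mB; apply: sub_sigma_algebra.
exists (fun j => if j == t then B else setT).
  by move=> j; case: ifPn => // _; exact: measurableT.
apply/seteqP; split=> w h => [j _ /=|]; first by case: ifPn => // /eqP ->.
by have := h t (ltnSn t); rewrite /= eqxx.
Qed.

Lemma cylinderI t : setI_closed (cylinder t).
Proof.
move=> _ _ [B mB ->] [C mC ->]; exists (fun j => B j `&` C j).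
  by move=> j; exact: measurableI.
apply/seteqP; split=> w => [[hB hC] j jt|h]; first by split; [exact: hB|exact: hC].
by split=> j jt; have [] := h j jt.
Qed.

(** As functions of [A], both sides are finite measures, a restriction and a multiple of [P]. They
    agree on cylinders by mutual independence, hence on the generated sigma-algebra. *)
Lemma cylinder_indep t A (B : set S) : <<s cylinder t >> A -> measurable B ->
  P (A `&` s t @^-1` B) = (P A * P (s 0%N @^-1` B))%E.
Proof.
move=> cA mB; have [idd indep] := s_iid.
have mtB : measurable (s t @^-1` B) by exact: measurable_preim.
have tB : P (s t @^-1` B) = P (s 0%N @^-1` B) by exact: idd.
have PtB0 : 0 <= fine (P (s t @^-1` B)) by rewrite fine_ge0.
have E2 X : mscale (NngNum PtB0) P X = (P (s t @^-1` B) * P X)%E.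
  by rewrite /mscale/= fineK// fin_num_measure.
pose m1 := mrestr P mtB; pose m2 := mscale (NngNum PtB0) P.
suff m12 : m1 A = m2 A by apply: etrans m12 _; apply: etrans (E2 A) _; rewrite muleC tB.
apply: (@g_sigma_algebra_measure_unique _ _ _ (cylinder t) _ (fun=> setT) _ _ m1 m2) => //.
- exact: cylinder_measurable.
- move=> _; exists (fun=> setT); first by move=> _; exact: measurableT.
  by apply/seteqP; split.
- by apply/seteqP; split=> // w _; exists 0%N.
- exact: cylinderI.
- move=> _ [C mC ->]; apply: etrans (esym (E2 _)); rewrite /= /mrestr.
  pose J := [fset x in iota 0 t]%fset.
  have JE (F : nat -> set Omega) : \bigcap_(j in [set j | (j < t)%N]) F j =
      \bigcap_(j in [set` J]) F j.
    by apply/seteqP; split=> w h j /= jt; apply: h; move: jt; rewrite /= !inE mem_iota.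
  have tJ : t \notin J by rewrite inE mem_iota ltnn andbF.
  pose D j := if j == t then B else C j.
  have mD j : measurable (D j) by rewrite /D; case: ifP.
  have CD : \bigcap_(j in [set` J]) (s j @^-1` C j) =
      \bigcap_(j in [set` J]) (s j @^-1` D j).
    apply: eq_bigcapr => j /= jJ; rewrite /D ifN//.
    by apply: contraNneq tJ => <-.
  rewrite JE CD indep//.
  have -> : \bigcap_(j in [set` J]) (s j @^-1` D j) `&` s t @^-1` B =
      \bigcap_(j in [set` (t |` J)%fset]) (s j @^-1` D j).
    apply/seteqP; split=> w.
      move=> [h wB] j /=; rewrite !inE => /predU1P[->|jJ]; first by rewrite /D eqxx.
      by apply: h; rewrite /= !inE.
    move=> h; split=> [j jJ|]; first by apply: h; rewrite /= inE jJ orbT.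
    by have := h t; rewrite /= !inE eqxx /D eqxx => /(_ isT).
  by rewrite indep// big_fsetU1//= /D eqxx.
- by move=> _; rewrite ltey_eq fin_num_measure.
Qed.

(** By [cylinder_indep], the image under [s t] of [P] restricted to [A] is the law of [s 0]
    multiplied by the mass of [A]. *)
Lemma cylinder_Rintegral t A (psi : S -> R) : <<s cylinder t >> A ->
  bounded_measurable setT psi ->
  \int[P]_w (\1_A w * psi (s t w)) =
  fine (P A) * \int[P]_w psi (s 0%N w).
Proof.
move=> cA bpsi; have mA := sigma_cylinder_measurable cA.
have bt : bounded_measurable setT (fun w => psi (s t w)).
  have [mpsi [M hM]] := bpsi; split; last by exists M => w _; exact: hM.
  by apply: measurableT_comp => //; exact: measurable_funP.
have -> : \int[P]_w (\1_A w * psi (s t w)) = \int[mrestr P mA]_w psi (s t w).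
  rewrite Rintegral_mrestr// [RHS]Rintegral_mkcond; congr (fine _).
  apply: eq_integral => w _; rewrite /patch indicE.
  by case: ifPn => _; rewrite ?mul1r ?mul0r.
have PA0 : 0 <= fine (P A) by rewrite fine_ge0.
pose nu := mscale (NngNum PA0) (distribution P (s 0%N)).
have nuE B : nu B = (P A * P (s 0%N @^-1` B))%E.
  by rewrite /nu /mscale/= fineK// fin_num_measure.
rewrite -(@Rintegral_image _ _ _ _ _ (mrestr P mA) (s t) nu setT psi)//.
  rewrite (@Rintegral_mixture _ _ _ nu setT measurableT 1
    (fun=> fine (P A)) (fun=> distribution P (s 0%N)))//.
    by rewrite big_ord1; congr (_ * _); apply: Rintegral_image.
  move=> B mB _; apply: etrans (nuE B) _.
  by rewrite big_ord1 fineK// fin_num_measure.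
move=> B mB; apply: etrans (nuE B) _; rewrite /= /mrestr setIC.
by apply/esym; exact: cylinder_indep.
Qed.

End independence.

(** * Expectations conditional on the history *)

Section freezing.
Context (R : realType) (T : ptopologicalType) (dist : T -> T -> R).
Hypothesis dist_metrizes : metrizes dist.
Variable G : set T.
Hypothesis G_compact : compact G.
Context d d' (Omega : measurableType d) (S : measurableType d').
Variables (P : probability Omega R) (s : nat -> {RV P >-> S}).
Variables (F : T -> S -> R) (M : R).
Hypothesis F_measurable : forall z, G z -> measurable_fun [set: S] (F z).
Hypothesis F_bounded : forall z x, G z -> `|F z x| <= M.
Hypothesis F_continuous : forall x, {within G, continuous (F ^~ x)}.

Let K z := \int[P]_w F z (s 0%N w).

Let mFs t z : G z -> measurable_fun [set: Omega] (fun w => F z (s t w)).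
Proof. by move=> Gz; apply: measurableT_comp => //; exact: F_measurable. Qed.

Lemma expectation_continuous : {within G, continuous K}.
Proof.
apply: (metrizes_within_continuous_seq dist_metrizes) => z u Gz Gu zu.
apply: (@bounded_convergence _ _ _ P setT measurableT
  (fun m w => F (u m) (s 0%N w)) _ M).
- by move=> m; exact: mFs.
- by move=> m w _; exact: F_bounded.
- move=> w _.
  exact: (cvg_approximation dist_metrizes (@F_continuous (s 0%N w)) Gz Gu zu).
Qed.

Lemma expectation_bounded z : G z -> `|K z| <= M.
Proof.
move=> Gz; apply: (@normr_Rintegral_le _ _ _ P _ measurableT) => //.
- exact: Rintegral_prob_cst.
- exact: mFs.
- by move=> w _; exact: F_bounded.
Qed.

Lemma freezing t (Z : Omega -> T) : iid s -> (forall w, G (Z w)) ->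
  measurable_fun [set: g_sigma_algebraType (cylinder s t)]
    (Z : _ -> borel T) ->
  \int[P]_w F (Z w) (s t w) = \int[P]_w K (Z w).
Proof.
move=> s_iid GZ mZ.
have [l [I [lG Il mI Ia]]] := @simple_approximation _ _ _ dist_metrizes _
  G_compact _ (g_sigma_algebraType (cylinder s t)) Z GZ mZ.
pose A m i := [set w : Omega | I m w = i].
have cA m i : <<s cylinder s t >> (A m i) by exact: mI.
have mA m i : measurable (A m i).
  exact: (@sigma_cylinder_measurable _ _ _ _ _ _ s t).
have AE m (i : nat) (w : Omega) : (I m w == i)%:R = \1_(A m i) w :> R.
  by rewrite indicE; congr (nat_of_bool _)%:R; apply/eqP/idP; rewrite inE.
pose z_ m (w : Omega) := nth point (l m) (I m w).
have Gz m w : G (z_ m w) by exact: lG.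
have mFz m : measurable_fun setT (fun w => F (z_ m w) (s t w)).
  rewrite /z_; under eq_fun do rewrite (nth_sumE (F ^~ _) (Il m _)).
  apply: measurable_sum => i; apply: measurable_funM; last exact/mFs/lG.
  by under eq_fun do rewrite AE; exact: measurable_indic.
have mKz m : measurable_fun setT (fun w => K (z_ m w)).
  rewrite /z_; under eq_fun do rewrite (nth_sumE K (Il m _)).
  apply: measurable_sum => i; apply: measurable_funM => //.
  by under eq_fun do rewrite AE; exact: measurable_indic.
have cF := @bounded_convergence _ _ _ P setT measurableT
  (fun m w => F (z_ m w) (s t w)) (fun w => F (Z w) (s t w)) M mFz.
have cK := @bounded_convergence _ _ _ P setT measurableT
  (fun m w => K (z_ m w)) (fun w => K (Z w)) M mKz.
have {}cF : \int[P]_w F (z_ m w) (s t w) @[m --> \oo] -->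
    \int[P]_w F (Z w) (s t w).
  apply: cF => [m w _|w _]; first exact: F_bounded.
  exact: (cvg_approximation dist_metrizes (@F_continuous (s t w)) (GZ w)
    (Gz^~ w) (Ia^~ w)).
have {}cK : \int[P]_w K (z_ m w) @[m --> \oo] --> \int[P]_w K (Z w).
  apply: cK => [m w _|w _]; first exact: expectation_bounded.
  exact: (cvg_approximation dist_metrizes (@expectation_continuous) (GZ w)
    (Gz^~ w) (Ia^~ w)).
suff FK : (fun m => \int[P]_w F (z_ m w) (s t w)) =
    (fun m => \int[P]_w K (z_ m w)).
  by rewrite FK in cF; exact: (cvg_unique (@norm_hausdorff _ _) cF cK).
apply/funext => m; rewrite /z_.
transitivity (\int[P]_w \sum_(i < size (l m)) (\1_(A m i) w * F (nth point (l m) i) (s t w))).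
  apply: eq_Rintegral => w _; rewrite (nth_sumE (F ^~ _) (Il m _)).
  by apply: eq_bigr => i _; rewrite AE.
transitivity (\int[P]_w \sum_(i < size (l m)) (\1_(A m i) w * K (nth point (l m) i))); last first.
  apply: eq_Rintegral => w _; rewrite (nth_sumE K (Il m _)).
  by apply: eq_bigr => i _; rewrite AE.
rewrite !Rintegral_bounded_sum//; last 2 first.
- move=> i; apply: bounded_measurableM; first exact: bounded_measurable_indic.
  exact: bounded_measurable_cst.
- move=> i; apply: bounded_measurableM; first exact: bounded_measurable_indic.
  split; first exact/mFs/lG.
  by exists M => w _; apply: F_bounded; exact: lG.
apply: eq_bigr => i _; rewrite (cylinder_Rintegral s_iid (cA m i)); last first.
  split; first exact/F_measurable/lG.
  by exists M => x _; apply: F_bounded; exact: lG.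
rewrite RintegralZr//; last first.
  exact/(bounded_measurable_integrable P measurableT)/bounded_measurable_indic.
by congr (_ * _); rewrite /Rintegral integral_indic// setIT.
Qed.

End freezing.

(** * The controlled system *)

Section dynamics.
Context (R : realType) (n : nat) (Uhat : pmetricType R) (S : ptopologicalType)
  (d : measure_display) (Omega : measurableType d) (P : probability Omega R)
  (s : nat -> {RV P >-> borel S})
  (Y : set 'rV[R]_n) (U : 'rV[R]_n -> set Uhat)
  (f : 'rV[R]_n -> Uhat -> S -> 'rV[R]_n).
Hypothesis Y_compact : compact Y.
Hypothesis Uhat_compact : compact [set: Uhat].
Hypothesis f_continuous : forall x,
  {within Y `*` [set: Uhat], continuous (fun z => f z.1 z.2 x)}.
Hypothesis f_measurable : forall y u, Y y ->
  measurable_fun [set: borel S] (f y u : _ -> borel 'rV[R]_n).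
Hypothesis s_iid : iid s.
Hypothesis U_usc : upper_semicontinuous_on Y U.
Hypothesis U_compact : forall y, Y y -> compact (U y).
Hypothesis f_invariant : forall y u x, Y y -> U y u -> Y (f y u x).

Local Notation X := ('rV[R]_n * Uhat)%type.
Local Notation G := (graph_of Y U).

Definition product_dist (z z' : X) : R :=
  Num.max `|z.1 - z'.1| (mdist z.2 z'.2).

Lemma metrizes_product_dist : metrizes product_dist.
Proof. exact: (metrizes_prod (metrizes_norm R n) (metrizes_mdist Uhat)). Qed.

Local Notation metX := metrizes_product_dist.
Local Notation metV := (metrizes_norm R n).
Local Notation metU := (metrizes_mdist Uhat).

Lemma product_dist_lt (z z' : X) e :
  (product_dist z z' < e) = (`|z.1 - z'.1| < e) && (mdist z.2 z'.2 < e).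
Proof. by rewrite /product_dist gt_max. Qed.

Lemma compact_closed_Y : closed Y.
Proof. exact: (metrizes_compact_closed metV Y_compact). Qed.
Local Notation Y_closed := compact_closed_Y.

Lemma compact_graph : compact G.
Proof.
apply: (subclosed_compact (B := Y `*` [set: Uhat])); first last.
- by move=> z [].
- exact: compact_setX.
rewrite -[G]setCK; apply: open_closedC; apply/(metrizes_open metX) => -[y u] nG.
have [Yy|nY] := pselect (Y y); last first.
  have /closed_openC/(metrizes_open metV)/(_ y nY)[r r0 hr] := Y_closed.
  exists r => // -[y' u'] /=; rewrite product_dist_lt => /andP[/= yy' _] [/= Yy' _].
  exact: (hr y').
have nU : ~ U y u by move=> Uyu; apply: nG.
have /closed_openC/(metrizes_open metU)/(_ u nU)[r r0 hr] :=
  metrizes_compact_closed metU (U_compact Yy).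
pose V := [set u' | r / 2 < mdist u u'].
have oV : open V.
  apply: (open_comp (f := mdist u)) (@open_gt _ _) => x _.
  exact: (metrizes_dist_continuous metU).
have UV : U y `<=` V.
  move=> u' Uu'; rewrite /V /= ltNge; apply/negP => uu'.
  apply: (hr u') => //; apply: le_lt_trans uu' _.
  by rewrite ltr_pdivrMr// ltr_pMr// ltr1n.
have := U_usc Yy oV UV; rewrite near_withinE => /(metrizes_nbhs metV)[q q0 hq].
exists (Num.min q (r / 2)); first by rewrite lt_min q0 divr_gt0.
move=> [y' u']; rewrite product_dist_lt/= !lt_min => /andP[/andP[yq _] /andP[_ ur]].
move=> [/= Yy' Uu']; have /= := hq y' yq Yy' u' Uu'.
by rewrite /V/= ltNge (ltW ur).
Qed.

Lemma measurable_graph : measurable (G : set (borel X)).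
Proof. exact: borel_closed (metrizes_compact_closed metX compact_graph). Qed.

Lemma open_setC_graph : open (~` G).
Proof. exact: closed_openC (metrizes_compact_closed metX compact_graph). Qed.

Lemma f_continuous_graph x : {within G, continuous (fun z => f z.1 z.2 x)}.
Proof.
by apply: continuous_subspaceW (@f_continuous x) => z [? _]; split.
Qed.

Lemma f_graph z x : G z -> Y (f z.1 z.2 x).
Proof. by move=> [? ?]; exact: f_invariant. Qed.

Lemma continuous_comp_f (phi : 'rV[R]_n -> R) x : {within Y, continuous phi} ->
  {within G, continuous (fun z => phi (f z.1 z.2 x))}.
Proof.
move=> /subspace_continuousP cphi; apply/subspace_continuousP => z Gz.
have /subspace_continuousP/(_ z Gz) cf := @f_continuous_graph x.
move=> B /(cphi _ (f_graph x Gz)); rewrite /= !nbhs_simpl/= => hB.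
have {}hB : nbhs z (fun z' => G z' -> Y (f z'.1 z'.2 x) -> B (phi (f z'.1 z'.2 x))).
  exact: cf hB.
suff : nbhs z (fun z' => G z' -> B (phi (f z'.1 z'.2 x))) by [].
by apply: filterS hB => z' h Gz'; apply: h => //; exact: f_graph.
Qed.

Lemma continuous_fst_graph (phi : 'rV[R]_n -> R) : {within Y, continuous phi} ->
  {within G, continuous (fun z => phi z.1)}.
Proof.
move=> /(metrizes_within_continuous metV) cphi.
apply/(metrizes_within_continuous metX) => z [Yz _] e e0.
have [r r0 hr] := cphi _ Yz e e0; exists r => // z' [Yz' _].
by rewrite product_dist_lt => /andP[zz' _]; exact: hr.
Qed.

Lemma measurable_comp_f (phi : 'rV[R]_n -> R) z :
  measurable_fun (Y : set (borel 'rV[R]_n)) phi -> G z ->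
  measurable_fun [set: borel S] (fun x => phi (f z.1 z.2 x)).
Proof.
move=> mphi [Yz Uz]; apply: (@measurable_comp _ _ _ _ (borel 'rV[R]_n) _ Y phi setT) => //.
- exact: borel_closed Y_closed.
- by move=> _ [x _ <-]; exact: f_invariant.
- exact: f_measurable.
Qed.

Definition mean (phi : 'rV[R]_n -> R) (z : X) : R :=
  \int[P]_w phi (f z.1 z.2 (s 0%N w)).

Lemma mean_continuous (phi : 'rV[R]_n -> R) : {within Y, continuous phi} ->
  {within G, continuous (mean phi)}.
Proof.
move=> cphi.
have [M hM] := compact_within_continuous_bounded Y_compact cphi.
apply: (@expectation_continuous _ _ _ metX G _ _ _ _ P s
  (fun z x => phi (f z.1 z.2 x)) M).
- by move=> z Gz; apply: measurable_comp_f => //; exact: within_continuous_borel.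
- by move=> z x Gz; apply: hM; exact: f_graph.
- by move=> x; exact: continuous_comp_f.
Qed.

Lemma mean_bounded (phi : 'rV[R]_n -> R) (M : R) : measurable_fun (Y : set (borel 'rV[R]_n)) phi ->
  (forall y, Y y -> `|phi y| <= M) -> forall z, G z -> `|mean phi z| <= M.
Proof.
move=> mphi hM z Gz.
apply: (@expectation_bounded _ _ G _ _ _ _ P s (fun z x => phi (f z.1 z.2 x))) => //.
- by move=> z' Gz'; exact: measurable_comp_f.
- by move=> z' x Gz'; apply: hM; exact: f_graph.
Qed.

Section trajectory.
Variables (p : nat -> 'rV[R]_n -> Uhat) (y0 : 'rV[R]_n).
Hypotheses (p_plan : control_plan Y U p) (Yy0 : Y y0).

Lemma state_in t w : Y (state f s p y0 t w).
Proof.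
elim: t => [//|t ih] /=; apply: f_invariant => //.
by have [_] := p_plan t; exact.
Qed.

Lemma trajectory_in t w : G (trajectory f s p y0 t w).
Proof.
split; first exact: state_in.
by have [_] := p_plan t; apply; exact: state_in.
Qed.

(** Balls of the maximum metric are products, so state and control can be treated separately. The
    source is left abstract because the state at time [t] is considered on the histories before [t]
    and before [t.+1]. *)
Let measurable_trajectory_sub d' (Om : measurableType d') (y : Om -> 'rV[R]_n)
    (t : nat) : (forall w, Y (y w)) ->
  measurable_fun [set: Om] (y : Om -> borel 'rV[R]_n) ->
  measurable_fun [set: Om] ((fun w => (y w, p t (y w))) : Om -> borel X).
Proof.
move=> Yy my; have [mp pU] := p_plan t.
apply: (measurable_fun_balls metX compact_graph) => [w|z e Gz].
  by split=> //=; exact: pU.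
rewrite (_ : [set w | _] = y @^-1` [set v | `|z.1 - v| < e] `&`
    y @^-1` (Y `&` p t @^-1` [set u | mdist z.2 u < e])).
  apply: measurableI.
    rewrite -[X in measurable X]setTI; apply: my => //; apply: borel_open.
    exact: (metrizes_open_ball metV).
  rewrite -[X in measurable X]setTI; apply: my => //; apply: mp.
    exact: borel_closed Y_closed.
  by apply: borel_open; exact: (metrizes_open_ball metU).
apply/seteqP; split=> w /=; rewrite (metrizesC metX) product_dist_lt/=.
  by move=> /andP[].
by move=> [-> [_ ->]].
Qed.

Let norm_sub_continuous (v : 'rV[R]_n) : {within Y, continuous (fun x => `|x - v|)}.
Proof.
rewrite (_ : (fun x => _) = (fun x => `|v - x|)).
  by apply: continuous_subspaceT; exact: (metrizes_dist_continuous metV).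
by apply/funext => x; rewrite distrC.
Qed.

(** [freezing] needs the state to be adapted to the history, not just measurable on [Omega]. In the
    induction step, the distance from the next state to a given point is continuous in the pair of
    state and control and measurable in the noise. *)
Lemma measurable_state t :
  measurable_fun [set: g_sigma_algebraType (cylinder s t)]
    (state f s p y0 t : _ -> borel 'rV[R]_n).
Proof.
elim: t => [|t ih]; first exact: measurable_cst.
pose Om := g_sigma_algebraType (cylinder s t.+1).
have mst : measurable_fun [set: Om] (state f s p y0 t : Om -> borel 'rV[R]_n).
  by move=> _ B mB; apply: sigma_cylinderS; exact: ih.
have mtr := @measurable_trajectory_sub _ Om (state f s p y0 t) t (state_in t) mst.
have ms (B : set (borel S)) : measurable B -> measurable (s t @^-1` B : set Om).
  exact: sigma_cylinder_last.
apply: (measurable_fun_balls metV Y_compact) => [w|y e Yy]; first exact: (state_in t.+1).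
rewrite -[X in measurable X]setTI.
pose F (z : X) (w : Om) := `|f z.1 z.2 (s t w) - y|.
apply: (@caratheodory_fun_measurable _ _ _ metX G compact_graph _ Om
  (fun w => trajectory f s p y0 t w) F _ _ _ _ measurableT [set r | r < e]).
- by move=> w; exact: trajectory_in.
- exact: mtr.
- move=> z Gz; apply: (@measurable_comp _ _ _ Om (borel S) _ setT
    (fun x => `|f z.1 z.2 x - y|) setT (s t)) => //.
    apply: (@measurable_comp_f (fun v => `|v - y|) z) => //.
    apply: within_continuous_borel; exact: norm_sub_continuous.
  by move=> _ B mB; rewrite setTI; exact: ms.
- move=> w; apply: (continuous_comp_f (phi := fun v => `|v - y|)).
  exact: norm_sub_continuous.
- by apply: open_measurable; exact: open_lt.
Qed.

Lemma measurable_trajectory t :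
  measurable_fun [set: g_sigma_algebraType (cylinder s t)]
    (trajectory f s p y0 t : _ -> borel X).
Proof.
exact: (@measurable_trajectory_sub _ (g_sigma_algebraType (cylinder s t))
  (state f s p y0 t) t (state_in t) (@measurable_state t)).
Qed.

Lemma measurable_trajectory_T t :
  measurable_fun [set: Omega] (trajectory f s p y0 t : _ -> borel X).
Proof.
move=> _ B mB; apply: (@sigma_cylinder_measurable _ _ _ _ _ _ s t).
exact: measurable_trajectory.
Qed.

(** The one-step Markov property, obtained by freezing the state-control pair at time [t]. *)
Lemma Rintegral_state_succ (phi : 'rV[R]_n -> R) t : {within Y, continuous phi} ->
  \int[P]_w phi (state f s p y0 t.+1 w) =
  \int[P]_w mean phi (trajectory f s p y0 t w).
Proof.
move=> cphi; have [M hM] := compact_within_continuous_bounded Y_compact cphi.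
apply: (@freezing R X product_dist metX G compact_graph _ _ Omega (borel S) P s
  (fun z x => phi (f z.1 z.2 x)) M _ _ _ t (trajectory f s p y0 t)) => //.
- by move=> z Gz; apply: measurable_comp_f => //; exact: within_continuous_borel.
- by move=> z x Gz; apply: hM; exact: f_graph.
- by move=> x; exact: continuous_comp_f.
- by move=> w; exact: trajectory_in.
- exact: measurable_trajectory.
Qed.

Lemma trajectory_law t : exists mu : prob_on R G,
  (forall A : set (borel X), measurable A ->
    mu A = P (trajectory f s p y0 t @^-1` A)) /\
  forall h, bounded_measurable (G : set (borel X)) h ->
    \int[mu]_(z in G) h z = \int[P]_w h (trajectory f s p y0 t w).
Proof.
have mtr := @measurable_trajectory_T t.
pose phi : {mfun Omega >-> borel X} := HB.pack
  (trajectory f s p y0 t : Omega -> borel X)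
  (isMeasurableFun.Build _ _ _ _ _ mtr).
have nuG : distribution P phi (~` G) = 0%E.
  rewrite -(measure0 P) /distribution /= /pushforward; congr (P _).
  by apply/seteqP; split=> // w /=; apply; exact: trajectory_in.
exists (ProbOn nuG); split=> // h bh.
apply: (@Rintegral_image _ _ _ _ _ P phi (distribution P phi)) => //.
- exact: measurable_graph.
- by move=> w; exact: trajectory_in.
Qed.

End trajectory.

(** * Lower semicontinuous functions as limits from below *)

Hypothesis Y_nonempty : Y !=set0.
Hypothesis U_nonempty : forall y, Y y -> U y !=set0.

Lemma within_continuous_closed_le (T : topologicalType) (A : set T) (h : T -> R)
    r : closed A -> {within A, continuous h} -> closed (A `&` [set z | h z <= r]).
Proof.
move=> cA /continuous_closedP/(_ _ (@closed_le R r)) /closed_subspaceP[V cV VA].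
rewrite (_ : _ `&` _ = V `&` A); first exact: closedI.
by rewrite VA setIC.
Qed.

Lemma eq_cvg_unique (u v : nat -> R) (a b : R) : u @ \oo --> a -> v @ \oo --> b ->
  u =1 v -> a = b.
Proof. by move=> ua vb /funext uv; apply: (cvg_unique _ ua) => //; rewrite uv. Qed.

(* The optimal costs over finite horizons are only lower semicontinuous; the
   identities that hold for [C(Y)] reach them as bounded limits. *)
Definition lower_approximation (phi : nat -> 'rV[R]_n -> R) (h : 'rV[R]_n -> R)
    (M : R) : Prop :=
  [/\ forall m, {within Y, continuous (phi m)},
      forall m y, Y y -> `|phi m y| <= M,
      forall m y, Y y -> phi m y <= h y &
      forall y, Y y -> phi m y @[m --> \oo] --> h y].

(** Baire's approximation by Lipschitz regularisations of growing slope [m]. Near [y], lower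
    semicontinuity keeps [h] above [h y - e / 2]; far from [y], the penalty does. *)
Lemma lower_semicontinuous_approximation (h : 'rV[R]_n -> R) (M : R) :
  (forall y, Y y -> `|h y| <= M) ->
  (forall r, closed (Y `&` [set y | h y <= r])) ->
  exists phi, lower_approximation phi h M.
Proof.
move=> hM hc.
have mh y : Y y -> - M <= h y by move=> /hM; rewrite ler_norml => /andP[].
have L0 m : (0 : R) <= m%:R by [].
exists (fun m => infconv (fun x y => `|x - y|) h Y m%:R).
have le_h m y := infconv_le_self metV Y_nonempty mh (L0 m) (x := y).
split=> // [m|m y Yy|y Yy].
- by apply: continuous_subspaceT; exact: (infconv_continuous metV Y_nonempty mh).
- rewrite ler_norml (infconv_ge metV Y_nonempty mh)//=.
  by apply: (le_trans (le_h _ _ Yy)); have := hM y Yy; rewrite ler_norml => /andP[].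
- apply/cvgrPdist_lt => e e0.
  have := hc (h y - e / 2) => /closed_openC/(metrizes_open metV)/(_ y).
  case=> [[_ /=]|r r0 hr]; first by rewrite lerBrDr gerDl leNgt divr_gt0.
  have M0 : 0 <= M by exact: le_trans (normr_ge0 _) (hM _ Yy).
  near=> m; rewrite ltr_norml; apply/andP; split.
    by apply: (@lt_le_trans _ _ 0); [rewrite oppr_lt0|rewrite subr_ge0 le_h].
  rewrite ltrBlDl -ltrBlDr; apply: (@lt_le_trans _ _ (h y - e / 2)).
    by rewrite ltrD2l ltrN2 ltr_pdivrMr// ltr_pMr// ltr1n.
  apply: (le_infconv metV Y_nonempty mh (L0 m)) => a Ya.
  have [ya|ya] := ltP `|y - a| r.
    have : ~ (Y `&` [set y' | h y' <= h y - e / 2]) a by exact: hr.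
    move=> /not_andP[//|] /negP; rewrite -ltNge => /ltW ha.
    by apply: le_trans ha _; rewrite lerDl mulr_ge0.
  apply: (@le_trans _ _ M).
    apply: (@le_trans _ _ (h y)); first by rewrite gerBl divr_ge0// ltW.
    by have := hM y Yy; rewrite ler_norml => /andP[].
  have {}ya : m%:R * r <= m%:R * `|y - a| by rewrite ler_wpM2l.
  (* Outside the ball of radius [r] the penalty is at least [2 * M], which lifts any value
     [h a >= - M] to at least [M >= h y]. *)
  have mr : 2 * M <= m%:R * r.
    rewrite -ler_pdivrMr//; near: m; exact: nbhs_infty_ger.
  have := mh a Ya; lra.
Unshelve. all: by end_near. Qed.

Lemma lower_approximation_bounded_measurable phi h M :
  lower_approximation phi h M ->
  measurable_fun (Y : set (borel 'rV[R]_n)) h /\ forall y, Y y -> `|h y| <= M.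
Proof.
move=> [cphi phiM _ phih]; split.
  apply: (@measurable_fun_cvg _ (borel 'rV[R]_n) R Y phi h) => // m.
  exact: within_continuous_borel.
move=> y Yy; apply: (ler_cvg_to (cvg_norm (phih y Yy)) (cvg_cst M)).
by apply: nearW => m; exact: phiM.
Qed.

Lemma measurable_comp_s (psi : 'rV[R]_n -> R) t z :
  measurable_fun (Y : set (borel 'rV[R]_n)) psi -> G z ->
  measurable_fun [set: Omega] (fun w => psi (f z.1 z.2 (s t w))).
Proof.
move=> mpsi Gz.
exact: (measurableT_comp (measurable_comp_f mpsi Gz) (@measurable_funPT _ _ _ _ (s t))).
Qed.

Lemma mean_integrable (psi : 'rV[R]_n -> R) (M : R) t z :
  measurable_fun (Y : set (borel 'rV[R]_n)) psi ->
  (forall y, Y y -> `|psi y| <= M) -> G z ->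
  P.-integrable setT (EFin \o (fun w => psi (f z.1 z.2 (s t w)))).
Proof.
move=> mpsi psiM Gz; apply: bounded_measurable_integrable => //; split.
  exact: measurable_comp_s.
by exists M => w _; apply: psiM; exact: f_graph.
Qed.

Section approximated.
Variables (phi : nat -> 'rV[R]_n -> R) (h : 'rV[R]_n -> R) (M : R).
Hypothesis phih : lower_approximation phi h M.

Let cphi m : {within Y, continuous (phi m)}. Proof. by have [] := phih. Qed.

Let mphi m : measurable_fun (Y : set (borel 'rV[R]_n)) (phi m).
Proof. by apply: within_continuous_borel; exact: (@cphi m). Qed.

Let phiM m y : Y y -> `|phi m y| <= M.
Proof. by have [_ + _ _] := phih; apply. Qed.

Let mh : measurable_fun (Y : set (borel 'rV[R]_n)) h.
Proof. by have [] := lower_approximation_bounded_measurable phih. Qed.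

Let hM y : Y y -> `|h y| <= M.
Proof. by have [_] := lower_approximation_bounded_measurable phih; exact. Qed.

Lemma cvg_mean z : G z -> mean (phi m) z @[m --> \oo] --> mean h z.
Proof.
move=> Gz; apply: (@bounded_convergence _ _ _ P _ measurableT _ _ M) => //.
- by move=> m; exact: measurable_comp_s.
- by move=> m w _; apply: phiM; exact: f_graph.
- by move=> w _; have [_ _ _ +] := phih; apply; exact: f_graph.
Qed.

Lemma mean_lower_approximation z m : G z -> mean (phi m) z <= mean h z.
Proof.
move=> Gz; apply: le_Rintegral => //.
- exact: (mean_integrable _ (@mphi m) (@phiM m)).
- exact: (mean_integrable _ mh hM).
- by move=> w _; have [_ _ + _] := phih; apply; exact: f_graph.
Qed.

Lemma mean_limit_bounded_measurable :
  bounded_measurable (G : set (borel X)) (mean h).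
Proof.
split; last by exists M => z; exact: (mean_bounded mh).
apply: (@measurable_fun_cvg _ (borel X) R G (fun m => mean (phi m))).
  move=> m; apply: within_continuous_borel.
  exact: (mean_continuous (@cphi m)).
exact: cvg_mean.
Qed.

(** A limit from below makes the sublevel set the intersection of those of the approximants, which
    are closed. This is how lower semicontinuity survives the expectation in a Bellman step. *)
Lemma mean_sublevel_closed (k : X -> R) r : {within G, continuous k} ->
  closed (G `&` [set z | k z + mean h z <= r]).
Proof.
move=> ck; rewrite (_ : _ `&` _ =
    \bigcap_m (G `&` [set z | k z + mean (phi m) z <= r])).
  apply: closed_bigI => m _.
  apply: within_continuous_closed_le.
    exact: (metrizes_compact_closed metX compact_graph).
  move=> z; apply: cvgD; first exact: ck.
  exact: (mean_continuous (@cphi m)).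
apply/seteqP; split=> z.
  move=> [Gz /= hz] m _; split => //=.
  by apply: le_trans hz; rewrite lerD2l mean_lower_approximation.
move=> hz; have [Gz _] := hz 0%N I; split=> //=.
apply: (ler_cvg_to (cvgD (cvg_cst (k z)) (cvg_mean Gz)) (cvg_cst r)).
by apply: nearW => m; have [] := hz m I.
Qed.

Lemma fst_limit_bounded_measurable :
  bounded_measurable (G : set (borel X)) (fun z => h z.1).
Proof.
split; last by exists M => z [Yz _]; exact: hM.
apply: (@measurable_fun_cvg _ (borel X) R G (fun m z => phi m z.1)).
  move=> m; apply: within_continuous_borel.
  exact: (continuous_fst_graph (@cphi m)).
by move=> z [Yz _]; have [_ _ _] := phih; apply.
Qed.

Lemma Rintegral_limit_state_succ p y0 t : control_plan Y U p -> Y y0 ->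
  \int[P]_w h (state f s p y0 t.+1 w) =
  \int[P]_w mean h (trajectory f s p y0 t w).
Proof.
move=> pp Yy0.
have mtr := measurable_trajectory_T pp Yy0.
have stY t' w : Y (state f s p y0 t' w) by exact: state_in.
have mst t' (psi : 'rV[R]_n -> R) : measurable_fun (Y : set (borel 'rV[R]_n)) psi ->
    measurable_fun [set: Omega] (fun w => psi (state f s p y0 t' w)).
  move=> mpsi; apply: (@measurable_comp _ _ _ _ (borel 'rV[R]_n) _ Y psi) => //.
  - exact: borel_closed Y_closed.
  - by move=> _ [w _ <-]; exact: stY.
  - move=> _ B mB; apply: (@sigma_cylinder_measurable _ _ _ _ _ _ s t').
    exact: (measurable_state pp Yy0).
have c1 : \int[P]_w phi m (state f s p y0 t.+1 w) @[m --> \oo] -->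
    \int[P]_w h (state f s p y0 t.+1 w).
  apply: (@bounded_convergence _ _ _ P _ measurableT _ _ M) => //.
  - by move=> m; exact: mst.
  - by move=> m w _; exact: phiM.
  - by move=> w _; have [_ _ _] := phih; apply.
have c2 : \int[P]_w mean (phi m) (trajectory f s p y0 t w) @[m --> \oo] -->
    \int[P]_w mean h (trajectory f s p y0 t w).
  apply: (@bounded_convergence _ _ _ P _ measurableT _ _ M) => //.
  - move=> m; apply: (@measurable_comp _ _ _ _ (borel X) _ G (mean (phi m))) => //.
    + exact: measurable_graph.
    + by move=> _ [w _ <-]; exact: trajectory_in.
    + by apply: within_continuous_borel; exact: (mean_continuous (@cphi m)).
  - by move=> m w _; apply: (mean_bounded (@mphi m) (@phiM m)); exact: trajectory_in.
  - by move=> w _; apply: cvg_mean; exact: trajectory_in.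
apply: eq_cvg_unique c1 c2 _ => m.
exact: (Rintegral_state_succ pp Yy0 t (@cphi m)).
Qed.

Lemma W_Rintegral_mean_continuous (psi : 'rV[R]_n -> R) (g : prob_on R G) :
  {within Y, continuous psi} -> W Y U f s g ->
  \int[g]_(z in G) mean psi z = \int[g]_(z in G) psi z.1.
Proof.
move=> cpsi Wg; apply/eqP; rewrite -subr_eq0 -RintegralB//; first exact/eqP/Wg.
- exact: measurable_graph.
- apply: bounded_measurable_integrable; first exact: measurable_graph.
  apply: (bounded_measurable_within_continuous compact_graph).
  exact: (mean_continuous (@cpsi)).
- apply: bounded_measurable_integrable; first exact: measurable_graph.
  apply: (bounded_measurable_within_continuous compact_graph).
  exact: (continuous_fst_graph (@cpsi)).
Qed.

(** [W] tests continuous functions; bounded convergence extends its identity to [h], in view of the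
    costs-to-go. *)
Lemma W_Rintegral_mean (g : prob_on R G) : W Y U f s g ->
  \int[g]_(z in G) mean h z = \int[g]_(z in G) h z.1.
Proof.
move=> Wg.
have c1 : \int[g]_(z in G) mean (phi m) z @[m --> \oo] -->
    \int[g]_(z in G) mean h z.
  apply: (@bounded_convergence _ _ _ g _ measurable_graph _ _ M) => //.
  - by move=> m; apply: within_continuous_borel; exact: (mean_continuous (@cphi m)).
  - by move=> m z Gz; apply: (mean_bounded (@mphi m) (@phiM m)).
  - exact: cvg_mean.
have c2 : \int[g]_(z in G) phi m z.1 @[m --> \oo] -->
    \int[g]_(z in G) h z.1.
  apply: (@bounded_convergence _ _ _ g _ measurable_graph _ _ M) => //.
  - move=> m; apply: within_continuous_borel.
    exact: (continuous_fst_graph (@cphi m)).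
  - by move=> m z [Yz _]; exact: phiM.
  - by move=> z [Yz _]; have [_ _ _] := phih; apply.
apply: eq_cvg_unique c1 c2 _ => m.
exact: (W_Rintegral_mean_continuous (@cphi m)).
Qed.

End approximated.

(** * Minimisation over the admissible controls *)

Section graph_min.
Variables (J : X -> R) (M : R).
Hypothesis JM : forall z, G z -> `|J z| <= M.
Hypothesis J_closed : forall r, closed (G `&` [set z | J z <= r]).

Definition graph_min y := inf [set J (y, u) | u in U y].

Let J_ge y u : Y y -> U y u -> - M <= J (y, u).
Proof.
by move=> Yy Uu; have := JM (conj Yy Uu : G (y, u)); rewrite ler_norml => /andP[].
Qed.

Let pair_continuous y : continuous (fun u : Uhat => (y, u) : X).
Proof. by move=> u; exact: (cvg_pair (cvg_cst _) cvg_id). Qed.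

Let fiber_closed y C r : Y y -> closed C ->
  closed (U y `&` C `&` [set u | J (y, u) <= r]).
Proof.
move=> Yy cC; rewrite (_ : _ `&` _ = C `&`
    (fun u => (y, u) : X) @^-1` (G `&` [set z | J z <= r])).
  by apply: closedI => //; apply: closed_comp (@J_closed r) => u _; exact: pair_continuous.
apply/seteqP; split=> u /=.
  by move=> [[Uu Cu] ?].
by move=> [Cu [[_ Uu] ?]].
Qed.

Let fiber_min y C : Y y -> closed C -> U y `&` C !=set0 ->
  exists2 u, (U y `&` C) u & forall u', (U y `&` C) u' -> J (y, u) <= J (y, u').
Proof.
move=> Yy cC UC.
apply: (@compact_min R Uhat (U y `&` C) (fun u => J (y, u))) => //.
  by apply: compact_closedI => //; exact: U_compact.
by move=> u _; exact: fiber_closed.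
Qed.

Lemma graph_min_le y u : Y y -> U y u -> graph_min y <= J (y, u).
Proof.
move=> Yy Uu; apply: ge_inf; last by exists u.
by exists (- M) => _ [v Uv <-]; exact: J_ge.
Qed.

Lemma graph_min_attained y : Y y -> exists2 u, U y u & J (y, u) = graph_min y.
Proof.
move=> Yy; have [|u [Uu _] umin] := fiber_min Yy closedT.
  by rewrite setIT; exact: U_nonempty.
exists u => //; apply/eqP; rewrite eq_le graph_min_le// andbT.
apply: lb_le_inf; first by exists (J (y, u)); exists u.
by move=> _ [v Uv <-]; exact: umin.
Qed.

Lemma graph_min_bounded y : Y y -> `|graph_min y| <= M.
Proof.
by move=> Yy; have [u Uu <-] := graph_min_attained Yy; apply: JM.
Qed.

(** The set is a continuous image of a closed part of the compact graph. Taking all controls for [C]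
    gives lower semicontinuity of [graph_min]; a general [C] serves the selection. *)
Let projection_closed C r : closed C ->
  closed (Y `&` [set y | exists u, (U y `&` C) u /\ J (y, u) <= r]).
Proof.
move=> cC; rewrite (_ : _ `&` _ =
    fst @` (G `&` [set z | J z <= r] `&` snd @^-1` C)).
  apply: (metrizes_compact_closed metV).
  apply: continuous_compact; first by apply: continuous_subspaceT => z; exact: cvg_fst.
  apply: (subclosed_compact _ compact_graph) => [|z [[]]//].
  apply: closedI; first exact: J_closed.
  by apply: closed_comp cC => z _; exact: cvg_snd.
apply/seteqP; split=> [y /= [Yy [u [[Uu Cu] ur]]]|_ [[y u] [[[Yy Uu] /= ur] Cu] <-]].
  by exists (y, u).
by split=> //=; exists u.
Qed.

Lemma graph_min_closed r : closed (Y `&` [set y | graph_min y <= r]).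
Proof.
rewrite (_ : _ `&` _ = Y `&` [set y | exists u, (U y `&` setT) u /\ J (y, u) <= r]).
  exact: projection_closed closedT.
apply/seteqP; split=> y [Yy /= h]; split=> //=.
  by have [u Uu uy] := graph_min_attained Yy; exists u; rewrite uy.
by case: h => u [[Uu _] ur]; apply: le_trans ur; exact: graph_min_le.
Qed.

Let dense_seq : exists D : nat -> Uhat, forall u e, 0 < e -> exists j, mdist u (D j) < e.
Proof.
have net m : exists l : seq Uhat, forall u, exists2 v, v \in l & mdist u v < m.+1%:R^-1.
  have [l [_ hl]] := metrizes_net metU Uhat_compact (ltac:(by rewrite invr_gt0) : 0 < m.+1%:R^-1).
  by exists l => u; exact: hl.
have [l hl] := choice net.
exists (fun j => if choice.unpickle j is Some mi
  then nth point (l mi.1) mi.2 else point) => u e e0.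
have [m me] : exists m : nat, m.+1%:R^-1 < e.
  by have [m] := ltr_add_invr e0; rewrite add0r; exists m.
have [v vl uv] := hl m u.
exists (choice.pickle (m, index v (l m))); rewrite choice.pickleK nth_index//.
exact: lt_trans uv me.
Qed.

Lemma graph_min_selection : exists p : 'rV[R]_n -> Uhat,
  measurable_fun (Y : set (borel 'rV[R]_n)) (p : _ -> borel Uhat) /\
  forall y, Y y -> U y (p y) /\ J (y, p y) = graph_min y.
Proof.
have [D hD] := dense_seq.
pose F y := U y `&` setT `&` [set u | J (y, u) <= graph_min y].
have [|||||||p [mp Fp]] := @measurable_selection R _ Uhat Y (fun j => mdist (D j)) F.
- exact: Y_closed.
- by move=> K; exact: (metrizes_compact_closed metU).
- by move=> j; exact: (metrizes_dist_continuous metU).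
- move=> u v uv; apply: contrapT => /(metrizes_gt0 metU) uv0.
  have [j] := hD u (mdist u v / 2) (ltac:(by rewrite divr_gt0)).
  have := metrizes_triangle metU (D j) u v.
  by rewrite -uv (metrizesC metU u (D j)); lra.
- move=> y Yy; apply: (subclosed_compact _ (U_compact Yy)); last by move=> u [[]].
  exact: fiber_closed closedT.
- by move=> y Yy; have [u Uu uy] := graph_min_attained Yy; exists u; split=> //=; rewrite uy.
- move=> C cC.
  (* The minimisers at [y] meet [C] exactly when every rational level above the minimum is reached
     inside [C]; [A r] minus [B r] collects the states for which level [r] is reached, but only
     outside [C]. *)
  pose A (r : rat) := Y `&` [set y | graph_min y <= ratr r].
  pose B (r : rat) := Y `&` [set y | exists u, (U y `&` C) u /\ J (y, u) <= ratr r].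
  rewrite (_ : _ `&` _ = Y `\` \bigcup_r (A r `\` B r)).
    apply: measurableD; first exact: borel_closed Y_closed.
    apply: bigcupT_measurable_rat => r; apply: measurableD.
      by apply: borel_closed; exact: graph_min_closed.
    by apply: borel_closed; exact: projection_closed.
  apply/seteqP; split=> y.
    move=> [Yy [u [[[Uu _] /= uy] Cu]]]; split=> // -[r _ [[_ /= yr]]].
    by apply; split=> //=; exists u; split=> //; exact: le_trans uy yr.
  move=> [Yy nAB]; split=> //.
  have AB r : graph_min y <= ratr r -> exists u, (U y `&` C) u /\ J (y, u) <= ratr r.
    move=> yr; apply: contrapT => nu; apply: nAB; exists r => //.
    by split=> // -[].
  have [|u [Uu Cu] umin] := fiber_min Yy cC.
    have [r] := rat_in_itvoo (ltr_pwDr ltr01 (lexx (graph_min y))).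
    by rewrite in_itv/= => /andP[/ltW/AB[u [? _]] _]; exists u.
  exists u; split=> //; split=> //=; rewrite leNgt; apply/negP => yu.
  have [r] := rat_in_itvoo yu; rewrite in_itv/= => /andP[yr ru].
  have [v [UCv vr]] := AB r (ltW yr).
  by have := lt_le_trans ru (umin v UCv); rewrite ltNge vr.
exists p; split=> // y Yy; have [[Uy _] /= py] := Fp y Yy; split=> //.
by apply/eqP; rewrite eq_le py graph_min_le.
Qed.

End graph_min.

Lemma bounded_measurable_trajectory p y0 t (h : X -> R) :
  control_plan Y U p -> Y y0 -> bounded_measurable (G : set (borel X)) h ->
  bounded_measurable [set: Omega] (fun w => h (trajectory f s p y0 t w)).
Proof.
move=> p_plan Yy0 [mh [M hM]]; split.
  apply: (@measurable_comp _ _ _ _ (borel X) _ G h) => //.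
  - exact: measurable_graph.
  - by move=> _ [w _ <-]; exact: trajectory_in.
  - exact: measurable_trajectory_T.
by exists M => w _; apply: hM; exact: trajectory_in.
Qed.

(** * Dynamic programming *)

Section dynamic_programming.
Variables (k : X -> R) (K : R).
Hypothesis k_continuous : {within G, continuous k}.
Hypothesis kK : forall z, G z -> `|k z| <= K.

Fixpoint cost_to_go (T : nat) : 'rV[R]_n -> R :=
  if T is T'.+1 then graph_min (fun z => k z + mean (cost_to_go T') z)
  else fun=> 0.

Let J T z := k z + mean (cost_to_go T) z.

(** The invariant of the Bellman recursion, from which boundedness, measurability and the integral
    identities for the costs follow. [mean_sublevel_closed] and [graph_min_closed] preserve lower
    semicontinuity, and Baire's approximation returns to the class. *)
Lemma cost_to_go_approximation T :
  exists phi, lower_approximation phi (cost_to_go T) (T%:R * K).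
Proof.
elim: T => [|T [phi phiT]] /=.
  exists (fun _ _ => 0); split => //.
  - by move=> _ x; exact: cvg_cst.
  - by move=> *; rewrite normr0 mul0r.
  - by move=> *; exact: cvg_cst.
have JM z : G z -> `|J T z| <= T.+1%:R * K.
  move=> Gz; apply: le_trans (ler_normD _ _) _.
  rewrite -natr1 mulrDl mul1r addrC lerD ?kK//.
  have [mh hM] := lower_approximation_bounded_measurable phiT.
  exact: (mean_bounded mh).
have Jc r : closed (G `&` [set z | J T z <= r]).
  apply: (mean_sublevel_closed phiT); exact: (@k_continuous).
apply: lower_semicontinuous_approximation.
  by move=> y Yy; exact: (graph_min_bounded JM Jc).
by move=> r; exact: (graph_min_closed JM Jc).
Qed.

Let J_bounded_measurable T : bounded_measurable (G : set (borel X)) (J T).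
Proof.
have [phi phiT] := cost_to_go_approximation T.
apply: bounded_measurableD; last exact: (mean_limit_bounded_measurable phiT).
exact: (bounded_measurable_within_continuous compact_graph (@k_continuous)).
Qed.

Let J_closed T r : closed (G `&` [set z | J T z <= r]).
Proof.
have [phi phiT] := cost_to_go_approximation T.
apply: (mean_sublevel_closed phiT); exact: (@k_continuous).
Qed.

Lemma cost_to_go_bounded T y : Y y -> `|cost_to_go T y| <= T%:R * K.
Proof.
have [phi phiT] := cost_to_go_approximation T.
by have [_] := lower_approximation_bounded_measurable phiT; exact.
Qed.

Lemma measurable_cost_to_go T :
  measurable_fun (Y : set (borel 'rV[R]_n)) (cost_to_go T).
Proof.
have [phi phiT] := cost_to_go_approximation T.
by have [] := lower_approximation_bounded_measurable phiT.
Qed.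

Lemma cost_to_go_succ_le T z : G z -> cost_to_go T.+1 z.1 <= k z + mean (cost_to_go T) z.
Proof.
case: z => y u [/= Yy Uu]; have [_ [M JM]] := J_bounded_measurable T.
exact: (graph_min_le JM).
Qed.

Lemma cost_to_go_selection : exists p : nat -> 'rV[R]_n -> Uhat,
  control_plan Y U p /\ forall T y, Y y ->
    k (y, p T y) + mean (cost_to_go T) (y, p T y) = cost_to_go T.+1 y.
Proof.
have sel T : exists p : 'rV[R]_n -> Uhat,
    measurable_fun (Y : set (borel 'rV[R]_n)) (p : _ -> borel Uhat) /\
    forall y, Y y -> U y (p y) /\ J T (y, p y) = cost_to_go T.+1 y.
  have [_ [M JM]] := J_bounded_measurable T.
  exact: (graph_min_selection JM (@J_closed T)).
have [p hp] := choice sel; exists p; split.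
  by move=> T; have [mp Up] := hp T; split=> // y /Up[].
by move=> T y Yy; have [_ Up] := hp T; have [] := Up y Yy.
Qed.

Section trajectory_cost.
Variables (p : nat -> 'rV[R]_n -> Uhat) (y0 : 'rV[R]_n) (T : nat).
Hypotheses (p_plan : control_plan Y U p) (Yy0 : Y y0).

Local Notation traj t := (trajectory f s p y0 t).

Let bmk : bounded_measurable (G : set (borel X)) k.
Proof. exact: (bounded_measurable_within_continuous compact_graph (@k_continuous)). Qed.

Lemma Rintegral_trajectory_sum (h : X -> R) : bounded_measurable (G : set (borel X)) h ->
  \int[P]_w (\sum_(t < T) h (traj t w)) = \sum_(t < T) \int[P]_w h (traj t w).
Proof.
move=> bh; apply: (@Rintegral_bounded_sum _ _ _ P _ measurableT 'I_T
  (index_enum _) (fun t w => h (traj t w))) => t.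
exact: bounded_measurable_trajectory.
Qed.

(** The expected remaining cost at time [t] under optimal continuation; it leads from
    [cost_to_go T y0] at time 0 to zero at time [T]. *)
Let a t := \int[P]_w cost_to_go (T - t) (state f s p y0 t w).

Let stage t : (t < T)%N ->
  \int[P]_w k (traj t w) = \int[P]_w J (T - t.+1) (traj t w) - a t.+1.
Proof.
move=> tT; have [phi phiT] := cost_to_go_approximation (T - t.+1).
rewrite /a (Rintegral_limit_state_succ phiT)// -RintegralB//.
- by congr (Rintegral _ _ _); apply/funext => w; rewrite /J addrK.
- apply: bounded_measurable_integrable => //.
  exact: bounded_measurable_trajectory.
- apply: bounded_measurable_integrable => //.
  apply: bounded_measurable_trajectory => //.
  exact: (mean_limit_bounded_measurable phiT).
Qed.

Let a_integrable t : P.-integrable setT (EFin \o (fun w =>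
  cost_to_go (T - t) (state f s p y0 t w))).
Proof.
have [phi phiT] := cost_to_go_approximation (T - t).
apply: bounded_measurable_integrable => //.
exact: (bounded_measurable_trajectory t p_plan Yy0 (fst_limit_bounded_measurable phiT)).
Qed.

Let J_integrable t : P.-integrable setT (EFin \o (fun w =>
  J (T - t.+1) (traj t w))).
Proof.
apply: bounded_measurable_integrable => //.
exact: bounded_measurable_trajectory.
Qed.

Let telescope : \sum_(t < T) (a t - a t.+1) = cost_to_go T y0.
Proof.
rewrite -(big_mkord xpredT (fun t => a t - a t.+1)) -[LHS]opprK -sumrN.
rewrite (eq_bigr (fun t => a t.+1 - a t)); last by move=> t _; rewrite opprB.
rewrite telescope_sumr// opprB /a subnn subn0 /=.
by rewrite !Rintegral_prob_cst subr0.
Qed.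

Lemma cost_to_go_le : cost_to_go T y0 <= \int[P]_w (\sum_(t < T) k (traj t w)).
Proof.
rewrite Rintegral_trajectory_sum// -telescope; apply: ler_sum => t _.
rewrite stage// lerD2r; apply: le_Rintegral => // w _.
rewrite -[(T - t)%N]prednK ?subn_gt0// -subnS.
exact: (cost_to_go_succ_le _ (trajectory_in p_plan Yy0 t w)).
Qed.

Lemma cost_to_go_eq :
  (forall t y, (t < T)%N -> Y y ->
    k (y, p t y) + mean (cost_to_go (T - t.+1)) (y, p t y) = cost_to_go (T - t) y) ->
  \int[P]_w (\sum_(t < T) k (traj t w)) = cost_to_go T y0.
Proof.
move=> opt; rewrite Rintegral_trajectory_sum// -telescope; apply: eq_bigr => t _.
rewrite stage//; congr (_ - _); congr (Rintegral _ _ _).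
by apply/funext => w; apply: opt => //; exact: state_in.
Qed.

End trajectory_cost.

Lemma optimal_plan T y0 : Y y0 -> exists2 p, control_plan Y U p &
  \int[P]_w (\sum_(t < T) k (trajectory f s p y0 t w)) = cost_to_go T y0.
Proof.
move=> Yy0; have [q [q_plan hq]] := cost_to_go_selection.
(* [q j] is optimal with [j.+1] steps left, and [T - t] steps are left at time [t]. Beyond the
   horizon the truncated subtraction selects [q 0], which is still admissible. *)
pose p t := q (T - t.+1)%N.
have p_plan : control_plan Y U p by move=> t; exact: q_plan.
exists p => //; apply: cost_to_go_eq => // t y tT Yy.
by rewrite hq// -subSn// subSS.
Qed.

Lemma valueE T y0 : Y y0 -> value Y U f s k T y0 = T%:R^-1 * cost_to_go T y0.
Proof.
move=> Yy0; have [p p_plan opt] := optimal_plan T Yy0.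
congr (_ * _); apply/eqP; rewrite eq_le; apply/andP; split.
  apply: ge_inf; last by exists p.
  by exists (cost_to_go T y0) => _ [p' p'_plan <-]; exact: cost_to_go_le.
apply: lb_le_inf; first by exists (cost_to_go T y0); exists p.
by move=> _ [p' p'_plan <-]; exact: cost_to_go_le.
Qed.

(** Bellman's inequality is integrated against [g], which is invariant: the mean of the next cost
    integrates to the cost itself, so each step adds at most one integral of [k]. *)
Lemma W_cost_to_go_le (g : prob_on R G) T : W Y U f s g ->
  \int[g]_(z in G) cost_to_go T z.1 <= T%:R * \int[g]_(z in G) k z.
Proof.
move=> Wg; elim: T => [|T ih].
  rewrite mul0r (_ : Rintegral _ _ _ = 0)//=.
  by rewrite (Rintegral_prob_on_cst g 0 measurable_graph).
have mG := measurable_graph.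
have [phi phiT] := cost_to_go_approximation T.
have [phi' phiT'] := cost_to_go_approximation T.+1.
apply: (@le_trans _ _ (\int[g]_(z in G) (k z + mean (cost_to_go T) z))).
  apply: le_Rintegral => //; last exact: cost_to_go_succ_le.
    apply: bounded_measurable_integrable => //.
    exact: (fst_limit_bounded_measurable phiT').
  by apply: bounded_measurable_integrable => //; exact: J_bounded_measurable.
rewrite RintegralD//.
- rewrite -natr1 mulrDl mul1r addrC lerD2r.
  by rewrite (W_Rintegral_mean phiT).
- apply: bounded_measurable_integrable => //.
  exact: (bounded_measurable_within_continuous compact_graph (@k_continuous)).
- apply: bounded_measurable_integrable => //.
  exact: (mean_limit_bounded_measurable phiT).
Qed.

End dynamic_programming.

Section value_limit.
Variables (k : X -> R) (v : 'rV[R]_n -> R).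
Hypothesis k_continuous : {within G, continuous k}.
Hypothesis v_continuous : {within Y, continuous v}.
Hypothesis value_cvg :
  forall y, Y y -> value Y U f s k T y @[T --> \oo] --> v y.

Local Notation c := (cost_to_go k).

Let bound : exists2 K : R, 0 <= K & forall z, G z -> `|k z| <= K.
Proof.
have [K kK] := compact_within_continuous_bounded compact_graph (@k_continuous).
by exists `|K| => // z /kK h; exact: le_trans h (ler_norm K).
Qed.

Let average_cvg y : Y y -> T%:R^-1 * c T y @[T --> \oo] --> v y.
Proof.
have [K _ kK] := bound.
move=> Yy; under eq_fun do rewrite -(valueE (@k_continuous) kK _ Yy).
exact: value_cvg.
Qed.

Let average_bounded K T y : 0 <= K -> (forall z, G z -> `|k z| <= K) -> Y y ->
  `|T%:R^-1 * c T y| <= K.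
Proof.
move=> K0 kK Yy; case: T => [|T]; first by rewrite mulr0 normr0.
rewrite normrM ger0_norm ?invr_ge0// ler_pdivrMl ?ltr0n//.
exact: (cost_to_go_bounded (@k_continuous) kK).
Qed.

(** Bellman's inequality divided by [T.+1]: the running cost vanishes in the limit, and the factor
    [1 - T.+1%:R^-1] changes the normalisation of the next cost from [T] to [T.+1]. *)
Lemma limit_le_mean z : G z -> v z.1 <= mean v z.
Proof.
move=> Gz; have [K K0 kK] := bound; have [Yz Uz] := Gz.
have c1 : T.+1%:R^-1 * c T.+1 z.1 @[T --> \oo] --> v z.1.
  have := average_cvg Yz.
  by rewrite -(@cvg_shiftS _ (fun T => T%:R^-1 * c T z.1)).
have c2 : mean (fun y => T%:R^-1 * c T y) z @[T --> \oo] --> mean v z.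
  apply: (@bounded_convergence _ _ _ P _ measurableT _ _ K) => //.
  - move=> T; apply: (measurable_comp_s (psi := fun y => T%:R^-1 * c T y)) => //.
    apply: measurable_funM; first exact: measurable_cst.
    exact: (measurable_cost_to_go (@k_continuous) kK).
  - by move=> T w _; apply: average_bounded => //; exact: f_graph.
  - by move=> w _; apply: average_cvg; exact: f_graph.
have c0 : T.+1%:R^-1 @[T --> \oo] --> (0 : R) by exact: cvg_harmonic.
have c3 : T.+1%:R^-1 * k z + (1 - T.+1%:R^-1) * mean (fun y => T%:R^-1 * c T y) z
    @[T --> \oo] --> mean v z.
  rewrite -[X in _ --> X]add0r -(mul0r (k z)) -[X in _ + X]mul1r -[X in X * mean v z](subr0 1).
  apply: cvgD; first exact: cvgMl.
  by apply: cvgM c2; apply: cvgB c0; exact: cvg_cst.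
apply: (ler_cvg_to c1 c3); near=> T.
have T0 : (T%:R : R) != 0 by rewrite pnatr_eq0 -lt0n; near: T; exact: nbhs_infty_gt.
rewrite /mean RintegralZl//; last first.
  apply: (mean_integrable _ (measurable_cost_to_go (@k_continuous) kK T)) Gz.
  exact: (cost_to_go_bounded (@k_continuous) kK).
rewrite mulrA (_ : (1 - T.+1%:R^-1) * T%:R^-1 = T.+1%:R^-1); last first.
  by rewrite -natr1; field; rewrite T0 natr1 pnatr_eq0.
rewrite -mulrDr ler_wpM2l ?invr_ge0//.
exact: (cost_to_go_succ_le (@k_continuous) kK _ Gz).
Unshelve. all: by end_near. Qed.

Lemma W_limit_le (g : prob_on R G) : W Y U f s g ->
  \int[g]_(z in G) v z.1 <= \int[g]_(z in G) k z.
Proof.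
move=> Wg; have [K K0 kK] := bound.
have mc T : bounded_measurable (G : set (borel X)) (fun z => c T z.1).
  have [phi phiT] := cost_to_go_approximation (@k_continuous) kK T.
  exact: (fst_limit_bounded_measurable phiT).
have c1 : \int[g]_(z in G) (T%:R^-1 * c T z.1) @[T --> \oo] -->
    \int[g]_(z in G) v z.1.
  apply: (@bounded_convergence _ _ _ g _ measurable_graph _ _ K) => //.
  - move=> T; apply: measurable_funM; first exact: measurable_cst.
    by have [] := mc T.
  - by move=> T z [Yz _]; apply: average_bounded.
  - by move=> z [Yz _]; apply: average_cvg.
apply: (ler_cvg_to c1 (cvg_cst _)).
near=> T.
have T0 : (0 < T)%N by near: T; exact: nbhs_infty_gt.
have mG := measurable_graph.
rewrite RintegralZl//; last exact: bounded_measurable_integrable.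
by rewrite ler_pdivrMl ?ltr0n//; exact: (W_cost_to_go_le (@k_continuous) kK).
Unshelve. all: by end_near. Qed.

(** By [limit_le_mean] the drift of [v] is nonnegative on [G], hence so are its integrals against
    the [xi l] and their limit. Here [v] acts as a test function of [D1], for which it has to be
    continuous. *)
Lemma W_cap_D1_limit_le y0 (g : prob_on R G) : Y y0 -> W_cap_D1 Y U f s y0 g ->
  v y0 <= \int[g]_(z in G) k z.
Proof.
move=> Yy0 [Wg [_ [xi xiG hxi]]]; apply: le_trans (W_limit_le Wg).
have := hxi v (@v_continuous); rewrite charge_integral_finite_measure => cxi.
have : 0 <= \int[g]_(z in G) (v z.1 - v y0).
  apply: (ler_cvg_to (cvg_cst 0) cxi); apply: nearW => l.
  apply: Rintegral_ge0 => z Gz; rewrite subr_ge0.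
  exact: limit_le_mean.
rewrite RintegralB//.
- by rewrite (Rintegral_prob_on_cst g _ measurable_graph) subr_ge0.
- exact: measurable_graph.
- apply: bounded_measurable_integrable; first exact: measurable_graph.
  apply: (bounded_measurable_within_continuous compact_graph).
  exact: (continuous_fst_graph (@v_continuous)).
- apply: bounded_measurable_integrable; first exact: measurable_graph.
  exact: bounded_measurable_cst.
Qed.

End value_limit.

Local Notation traj := (trajectory f s).

(** * Occupation measures *)

Lemma occupation_mixture p y0 T : control_plan Y U p -> Y y0 ->
  exists mu : nat -> prob_on R G,
  [/\ forall t h, bounded_measurable (G : set (borel X)) h ->
        \int[mu t]_(z in G) h z = \int[P]_w h (traj p y0 t w) &
      forall Q : set (borel X), measurable Q ->
        (occupation f s p y0 T Q)%:E = (\sum_(t < T) (T%:R^-1)%:E * mu t Q)%E].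
Proof.
move=> p_plan Yy0.
have [mu hmu] := choice (trajectory_law p_plan Yy0).
exists mu; split=> [t|Q mQ]; first by have [_] := hmu t; exact.
rewrite /occupation Rintegral_trajectory_sum//; last first.
  exact: bounded_measurable_indic.
rewrite mulr_sumr -sumEFin; apply: eq_bigr => t _; rewrite EFinM; congr (_ * _)%E.
have [muE _] := hmu t; apply: etrans _ (esym (muE Q mQ)).
have mtQ : measurable (traj p y0 t @^-1` Q).
  rewrite -[X in measurable X]setTI.
  exact: (measurable_trajectory_T p_plan Yy0).
have E : (\int[P]_w (\1_Q (traj p y0 t w))%:E)%E = P (traj p y0 t @^-1` Q).
  by rewrite -[X in P X]setIT -integral_indic.
by rewrite /Rintegral E fineK// fin_num_measure.
Qed.

Lemma Gamma_Rintegral p y0 T (g : prob_on R G) : control_plan Y U p -> Y y0 ->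
  (forall Q : set (borel X), measurable Q -> Q `<=` G ->
    g Q = (occupation f s p y0 T Q)%:E) ->
  forall h, bounded_measurable (G : set (borel X)) h ->
  \int[g]_(z in G) h z = T%:R^-1 * \sum_(t < T) \int[P]_w h (traj p y0 t w).
Proof.
move=> p_plan Yy0 hg h bh.
have [mu [muh muQ]] := occupation_mixture T p_plan Yy0.
rewrite (@Rintegral_mixture _ _ _ g _ measurable_graph T (fun=> T%:R^-1) (fun t => mu t))//.
- by rewrite mulr_sumr; apply: eq_bigr => t _; rewrite muh.
- by move=> Q mQ QG; exact: etrans (hg Q mQ QG) (muQ Q mQ).
Qed.

Lemma Gamma_of_plan p y0 T : (0 < T)%N -> control_plan Y U p -> Y y0 ->
  exists g : prob_on R G, forall Q : set (borel X), measurable Q ->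
    g Q = (occupation f s p y0 T Q)%:E.
Proof.
move=> T0 p_plan Yy0; have [mu [_ muQ]] := occupation_mixture T p_plan Yy0.
have [||g hg] := @prob_on_mixture _ _ G T (fun=> T%:R^-1) (fun t => mu t) open_setC_graph.
- by [].
- by rewrite sumr_const card_ord -[_ *+ _]mulr_natr mulVf// pnatr_eq0 -lt0n.
- by exists g => Q mQ; exact: etrans (hg Q mQ) (esym (muQ Q mQ)).
Qed.

Let mG : measurable (G : set (borel X)) := measurable_graph.

Let drift_bounded_measurable (phi : 'rV[R]_n -> R) : {within Y, continuous phi} ->
  bounded_measurable (G : set (borel X)) (drift f s phi).
Proof.
move=> cphi; apply: bounded_measurableB;
  apply: (bounded_measurable_within_continuous compact_graph).
  exact: (mean_continuous (@cphi)).
exact: (continuous_fst_graph (@cphi)).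
Qed.

Lemma drift_continuous (phi : 'rV[R]_n -> R) : {within Y, continuous phi} ->
  {within G, continuous (drift f s phi)}.
Proof.
move=> cphi z; apply: cvgB; first exact: (mean_continuous (@cphi)).
exact: (continuous_fst_graph (@cphi)).
Qed.

Lemma Rintegral_drift_trajectory p y0 t (phi : 'rV[R]_n -> R) :
  control_plan Y U p -> Y y0 -> {within Y, continuous phi} ->
  \int[P]_w drift f s phi (traj p y0 t w) =
  \int[P]_w phi (state f s p y0 t.+1 w) - \int[P]_w phi (state f s p y0 t w).
Proof.
move=> p_plan Yy0 cphi.
rewrite (Rintegral_state_succ p_plan Yy0 t (@cphi)) -RintegralB//.
- apply: bounded_measurable_integrable => //.
  apply: (@bounded_measurable_trajectory p y0 t (mean phi)) => //.
  apply: (bounded_measurable_within_continuous compact_graph).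
  exact: (mean_continuous (@cphi)).
- apply: bounded_measurable_integrable => //.
  apply: (@bounded_measurable_trajectory p y0 t (fun z => phi z.1)) => //.
  apply: (bounded_measurable_within_continuous compact_graph).
  exact: (continuous_fst_graph (@cphi)).
Qed.

(** The increment from [t] to [t.+1] occurs in [e t' - e 0] for [t'] from [t.+1] to [T.-1], that is,
    [T.-1 - t] times. *)
Lemma sum_telescope_average (e : nat -> R) T :
  \sum_(t < T) (e t - e 0%N) = \sum_(t < T) (T.-1 - t)%:R * (e t.+1 - e t).
Proof.
elim: T => [|T ih]; first by rewrite !big_ord0.
rewrite big_ord_recr/= ih [RHS]big_ord_recr/= subnn mul0r addr0.
rewrite -(telescope_sumr e (leq0n T)) big_mkord -big_split/=; apply: eq_bigr => t _.
case: T t {ih} => [[]//|T t] /=.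
by rewrite subSn ?leq_ord// -natr1 mulrDl mul1r.
Qed.

Let state_integrable p y0 t (phi : 'rV[R]_n -> R) :
  control_plan Y U p -> Y y0 -> {within Y, continuous phi} ->
  bounded_measurable [set: Omega] (fun w => phi (state f s p y0 t w)).
Proof.
move=> p_plan Yy0 cphi.
apply: (@bounded_measurable_trajectory p y0 t (fun z => phi z.1)) => //.
apply: (bounded_measurable_within_continuous compact_graph).
exact: (continuous_fst_graph (@cphi)).
Qed.

Lemma Gamma_drift_le T y0 (g : prob_on R G) (phi : 'rV[R]_n -> R) (M : R) :
  Y y0 -> Gamma Y U f s T y0 g ->
  {within Y, continuous phi} -> (forall y, Y y -> `|phi y| <= M) ->
  `|\int[g]_(z in G) drift f s phi z| <= 2 * M / T%:R.
Proof.
move=> Yy0 [p p_plan hg] cphi phiM.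
rewrite (Gamma_Rintegral p_plan Yy0 hg)//; last exact: drift_bounded_measurable.
under eq_bigr => t _ do rewrite (Rintegral_drift_trajectory t p_plan Yy0 (@cphi)).
rewrite -(big_mkord xpredT (fun t => \int[P]_w phi (state f s p y0 t.+1 w) -
   \int[P]_w phi (state f s p y0 t w))) telescope_sumr//.
rewrite normrM ger0_norm ?invr_ge0// mulrC ler_wpM2r ?invr_ge0//.
have le_M t : `|\int[P]_w phi (state f s p y0 t w)| <= M.
  have [mphi _] := state_integrable t p_plan Yy0 (@cphi).
  apply: (@normr_Rintegral_le _ _ _ P _ measurableT) => //.
    exact: Rintegral_prob_cst.
  by move=> w _; apply: phiM; exact: state_in.
by apply: (le_trans (ler_normB _ _)); rewrite mulr_natl mulr2n lerD.
Qed.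

(** For a fixed horizon the relation of [D1] holds exactly, with a single measure: the laws of the
    trajectory weighted as in [sum_telescope_average]. *)
Lemma Gamma_fst_drift T y0 (g : prob_on R G) :
  Y y0 -> Gamma Y U f s T y0 g ->
  exists xi : {finite_measure set (borel X) -> \bar R},
    finite_measure_on G xi /\ forall phi : 'rV[R]_n -> R, {within Y, continuous phi} ->
      \int[g]_(z in G) (phi z.1 - phi y0) = \int[xi]_(z in G) drift f s phi z.
Proof.
move=> Yy0 [p p_plan hg].
have [mu [muh _]] := occupation_mixture T p_plan Yy0.
have w_ge0 (t : 'I_T) : 0 <= T%:R^-1 * (T.-1 - t)%:R :> R.
  by rewrite mulr_ge0// invr_ge0.
have [xi hxi] := finite_measure_mixture (fun t : 'I_T => mu t) w_ge0.
exists xi; split.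
  rewrite /finite_measure_on hxi; last exact: borel_open open_setC_graph.
  rewrite big1// => t _.
  by apply: etrans (congr1 (fun z => (_ * z)%E) (prob_on_supp (mu t))) _; rewrite mule0.
move=> phi cphi.
rewrite (@Rintegral_mixture _ _ _ xi _ mG T (fun t => T%:R^-1 * (T.-1 - t)%:R)
  (fun t => mu t))//; last 2 first.
- by move=> Q mQ _; exact: hxi.
- exact: drift_bounded_measurable.
rewrite (Gamma_Rintegral p_plan Yy0 hg); last first.
  apply: bounded_measurableB; last exact: bounded_measurable_cst.
  apply: (bounded_measurable_within_continuous compact_graph).
  exact: (continuous_fst_graph (@cphi)).
pose e t := \int[P]_w phi (state f s p y0 t w).
transitivity (T%:R^-1 * \sum_(t < T) (T.-1 - t)%:R * (e t.+1 - e t)); last first.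
  rewrite mulr_sumr; apply: eq_bigr => t _; rewrite mulrA; congr (_ * _).
  rewrite muh; last exact: drift_bounded_measurable.
  by rewrite (Rintegral_drift_trajectory t p_plan Yy0 (@cphi)).
rewrite -sum_telescope_average /e.
congr (_ * _); apply: eq_bigr => t _.
rewrite RintegralB//= ?Rintegral_prob_cst//.
- by apply: bounded_measurable_integrable => //; exact: (state_integrable t p_plan Yy0 (@cphi)).
- by apply: bounded_measurable_integrable => //; exact: bounded_measurable_cst.
Qed.

Lemma convex_hull_drift_le T y0 (g : prob_on R G) (phi : 'rV[R]_n -> R) (M : R) :
  Y y0 -> convex_hull (Gamma Y U f s T y0) g ->
  {within Y, continuous phi} -> (forall y, Y y -> `|phi y| <= M) ->
  `|\int[g]_(z in G) drift f s phi z| <= 2 * M / T%:R.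
Proof.
move=> Yy0 [m [w [g_ [w0 w1 gG gE]]]] cphi phiM.
rewrite (@Rintegral_mixture _ _ _ g _ mG m w (fun i => g_ i))//; last 2 first.
- by move=> Q mQ _; exact: gE.
- exact: drift_bounded_measurable.
apply: le_trans (ler_norm_sum _ _ _) _.
apply: (@le_trans _ _ (\sum_i w i * (2 * M / T%:R))).
  apply: ler_sum => i _.
  rewrite normrM ger0_norm//; apply: (ler_wpM2l (w0 i)).
  exact: (Gamma_drift_le Yy0 (gG i) (@cphi) phiM).
by rewrite -mulr_suml w1 mul1r.
Qed.

Lemma convex_hull_fst_drift T y0 (g : prob_on R G) :
  Y y0 -> convex_hull (Gamma Y U f s T y0) g ->
  exists xi : {finite_measure set (borel X) -> \bar R},
    finite_measure_on G xi /\ forall phi : 'rV[R]_n -> R, {within Y, continuous phi} ->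
      \int[g]_(z in G) (phi z.1 - phi y0) = \int[xi]_(z in G) drift f s phi z.
Proof.
move=> Yy0 [m [w [g_ [w0 _ gG gE]]]].
have [xi_ hxi_] := choice (fun i => Gamma_fst_drift Yy0 (gG i)).
have [xi hxi] := finite_measure_mixture xi_ w0.
exists xi; split.
  rewrite /finite_measure_on hxi; last exact: borel_open open_setC_graph.
  by rewrite big1// => i _; have [-> _] := hxi_ i; rewrite mule0.
move=> phi cphi.
rewrite (@Rintegral_mixture _ _ _ xi _ mG m w xi_)//; last 2 first.
- by move=> Q mQ _; exact: hxi.
- exact: drift_bounded_measurable.
rewrite (@Rintegral_mixture _ _ _ g _ mG m w (fun i => g_ i))//; last 2 first.
- by move=> Q mQ _; exact: gE.
- apply: bounded_measurableB; last exact: bounded_measurable_cst.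
  apply: (bounded_measurable_within_continuous compact_graph).
  exact: (continuous_fst_graph (@cphi)).
by apply: eq_bigr => i _; have [_ ->] := hxi_ i.
Qed.

(** * Convergence along the test functions and the two halves of the Hausdorff distance *)

Section test_functions.
Variable q : nat -> X -> R.
Hypothesis q_dense : dense_lipschitz_seq G q.

(* McShane's extension, an infimal convolution *)
Lemma lipschitz_extension j :
  exists2 h : X -> R, continuous h & forall z, G z -> h z = q j z.
Proof.
have [qL q1 _] := q_dense; have [L hL] := qL j.
have [[z0 Gz0]|G0] := pselect (G !=set0); last first.
  exists (fun=> 0); first by move=> z; exact: cvg_cst.
  by move=> z Gz; exfalso; apply: G0; exists z.
have GN0 : G !=set0 by exists z0.
have mq z : G z -> -1 <= q j z by move=> /(q1 j); rewrite ler_norml => /andP[].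
exists (infconv product_dist (q j) G `|L|).
  exact: (infconv_continuous metX GN0 mq (normr_ge0 L)).
move=> z Gz; apply/eqP; rewrite eq_le.
rewrite (infconv_le_self metX GN0 mq (normr_ge0 L) Gz)/=.
apply: (le_infconv metX GN0 mq (normr_ge0 L)) => a Ga.
rewrite -lerBlDl; apply: le_trans (ler_norm _) _; apply: le_trans (hL _ _ Gz Ga) _.
by rewrite ler_wpM2r ?ler_norm//; exact: (metrizes_ge0 metX).
Qed.

Lemma test_continuous j : {within G, continuous (q j)}.
Proof.
have [h ch hq] := lipschitz_extension j.
have hc : {within G, continuous h} by exact: continuous_subspaceT.
apply: subspace_eq_continuous hc => z.
by rewrite inE => /hq.
Qed.

Let bm_test j : bounded_measurable (G : set (borel X)) (q j).
Proof. exact: (bounded_measurable_within_continuous compact_graph (@test_continuous j)). Qed.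

Lemma Rintegral_prob_on_dist (g : prob_on R G) (a b : X -> R) (e : R) :
  bounded_measurable (G : set (borel X)) a -> bounded_measurable (G : set (borel X)) b ->
  (forall z, G z -> `|a z - b z| <= e) ->
  `|\int[g]_(z in G) a z - \int[g]_(z in G) b z| <= e.
Proof.
move=> ba bb abe; rewrite -RintegralB//; try exact: bounded_measurable_integrable.
apply: (@normr_Rintegral_le _ _ _ g _ mG) => //.
- exact: Rintegral_prob_on_cst.
- by have [] := bounded_measurableB ba bb.
Qed.

Lemma test_bounded (g : prob_on R G) j : `|\int[g]_(z in G) q j z| <= 1.
Proof.
apply: (@normr_Rintegral_le _ _ _ g _ mG) => //.
- exact: Rintegral_prob_on_cst.
- by have [] := bm_test j.
- by have [_ + _] := q_dense; exact.
Qed.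

Lemma cvg_Rintegral_test (g_ : nat -> prob_on R G) (g : prob_on R G) :
  (forall l j, (j < l)%N ->
    `|\int[g_ l]_(z in G) q j z - \int[g]_(z in G) q j z| <= l.+1%:R^-1) ->
  forall h : X -> R, {within G, continuous h} ->
    \int[g_ l]_(z in G) h z @[l --> \oo] --> \int[g]_(z in G) h z.
Proof.
move=> gg h ch; have [M0 hM0] := compact_within_continuous_bounded compact_graph (@ch).
pose M := `|M0| + 1; have Mgt0 : 0 < M by rewrite ltr_wpDl.
have hM z : G z -> `|h z| <= M.
  by move=> /hM0 hz; apply: (le_trans hz); rewrite (le_trans (ler_norm _))// lerDl.
(* After scaling by [M], [h] lies in the unit ball. Two replacements of [h] by a multiple of [q j]
   and the comparison of the integrals of [q j] cost [M * r = e / 3] each. *)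
apply/cvgrPdist_le => e e0; pose r := e / (3 * M).
have r0 : 0 < r by rewrite divr_gt0// mulr_gt0.
have [_ _ /(_ (fun z => M^-1 * h z) _ _ _ r0)[||j hj]] := q_dense.
- by move=> z; apply: cvgMr; exact: ch.
- by move=> z Gz; rewrite normrM gtr0_norm ?invr_gt0// ler_pdivrMl// mulr1 hM.
have bh : bounded_measurable (G : set (borel X)) h.
  exact: (bounded_measurable_within_continuous compact_graph (@ch)).
have hq (g' : prob_on R G) :
    `|\int[g']_(z in G) h z - M * \int[g']_(z in G) q j z| <= M * r.
  rewrite -RintegralZl//; last exact: bounded_measurable_integrable.
  apply: Rintegral_prob_on_dist => //; first exact: bounded_measurableZ.
  move=> z Gz; rewrite -[h z](mulVKf (lt0r_neq0 Mgt0)) -mulrBr normrM gtr0_norm//.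
  by rewrite ler_wpM2l// ?hj// ltW.
have Mr : M * r = e / 3 by rewrite /r; field; rewrite lt0r_neq0.
near=> l.
have lj : (j < l)%N by near: l; exact: nbhs_infty_gt.
have lr : l.+1%:R^-1 <= r.
  by apply: ltW; near: l; exact: near_infty_natSinv_lt (PosNum r0).
have := hq g; have := hq (g_ l); have := gg l j lj.
rewrite Mr !ler_norml => /andP[a1 a2] /andP[b1 b2] /andP[c1 c2].
have Mlr : M * l.+1%:R^-1 <= e / 3 by rewrite -Mr ler_wpM2l// ltW.
have {}a1 : - (e / 3) <= M * \int[g_ l]_(z in G) q j z - M * \int[g]_(z in G) q j z.
  rewrite -mulrBr; apply: le_trans (ler_wpM2l (ltW Mgt0) a1).
  by rewrite mulrN lerN2.
have {}a2 : M * \int[g_ l]_(z in G) q j z - M * \int[g]_(z in G) q j z <= e / 3.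
  by rewrite -mulrBr; apply: le_trans (ler_wpM2l (ltW Mgt0) a2) _.
by apply/andP; split; lra.
Unshelve. all: by end_near. Qed.

(** The horizons exceed [l], so the bound on the drift tends to zero. For [D1], the measures [xi l]
    are the exact ones belonging to the approximants, and only the other side, an integral of a
    continuous function, has to converge. *)
Lemma W_cap_D1_limit y0 (g : prob_on R G) : Y y0 ->
  (forall l, exists T (g' : prob_on R G), [/\ (l < T)%N,
    convex_hull (Gamma Y U f s T y0) g' &
    forall j, (j < l)%N ->
      `|\int[g']_(z in G) q j z - \int[g]_(z in G) q j z| <= l.+1%:R^-1]) ->
  W_cap_D1 Y U f s y0 g.
Proof.
move=> Yy0 /choice[T_ /choice[g_ hg_]].
have g_cvg h := @cvg_Rintegral_test g_ g _ h.
have {}g_cvg (h : X -> R) : {within G, continuous h} ->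
    \int[g_ l]_(z in G) h z @[l --> \oo] --> \int[g]_(z in G) h z.
  by apply: g_cvg => l; have [] := hg_ l.
split.
  move=> phi cphi; have [M hM] := compact_within_continuous_bounded Y_compact (@cphi).
  have M0 : 0 <= M by exact: le_trans (normr_ge0 _) (hM _ Yy0).
  have c1 : `|\int[g_ l]_(z in G) drift f s phi z| @[l --> \oo] -->
      `|\int[g]_(z in G) drift f s phi z|.
    by apply: cvg_norm; apply: g_cvg; exact: (drift_continuous (@cphi)).
  have c2 : 2 * M * l.+1%:R^-1 @[l --> \oo] --> 0.
    by rewrite -[X in _ --> X](mulr0 (2 * M)); apply: cvgMr; exact: cvg_harmonic.
  apply/eqP; rewrite -normr_le0; apply: (ler_cvg_to c1 c2); apply: nearW => l.
  have [lT cg _] := hg_ l.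
  apply: le_trans (convex_hull_drift_le Yy0 cg (@cphi) hM) _.
  by rewrite ler_wpM2l ?mulr_ge0// lef_pV2 ?posrE ?ltr0n ?ler_nat// (leq_trans _ lT).
split.
  move=> A mA AG; apply: (subset_measure0 (mu := g) mA _ AG (prob_on_supp g)).
  exact: borel_open open_setC_graph.
have xi_ l := convex_hull_fst_drift Yy0 (let: And3 _ cg _ := hg_ l in cg).
have {xi_}[xi hxi] := choice xi_; exists xi => [l|phi cphi]; first by have [] := hxi l.
rewrite charge_integral_finite_measure.
under eq_fun => l do rewrite -(hxi l).2//.
apply: g_cvg => z; apply: cvgB; last exact: cvg_cst.
exact: (continuous_fst_graph (@cphi)).
Qed.

Lemma nbhs_test (g : prob_on R G) l (e : R) : 0 < e ->
  nbhs g [set g' : prob_on R G | forall j, (j < l)%N ->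
    `|\int[g']_(z in G) q j z - \int[g]_(z in G) q j z| < e].
Proof.
move=> e0; elim: l => [|l ih]; first by apply: filterS filterT.
have /cvgrPdist_lt/(_ e e0) hl := Rintegral_prob_on_continuous (@test_continuous l) (x := g).
apply: filterS (filterI ih hl) => g' [/= h1 h2] j.
by rewrite ltnS leq_eqVlt => /orP[/eqP->|/h1//]; rewrite distrC.
Qed.

Lemma rho_test_le (e : R) : 0 < e -> exists N, forall g g' : prob_on R G,
  (forall j, (j < N)%N ->
    `|\int[g]_(z in G) q j z - \int[g']_(z in G) q j z| <= e / 2) ->
  (rho q g g' <= e%:E)%E.
Proof.
move=> e0; have [N hN] : exists N, 2 / 2 ^+ N <= e / 2 :> R.
  have e4 : 0 < e / 4 by rewrite divr_gt0.
  have [N _ /(_ N (leqnn N)) /= hN] := near_infty_natSinv_expn_lt (PosNum e4).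
  by exists N; move: hN; lra.
exists N => g g' gg'; apply: le_trans (rho_le (e := e / 2) (N := N) _ gg' _) _.
- move=> j; apply: le_trans (ler_normB _ _) _.
  by rewrite (_ : 2 = 1 + 1)// lerD// test_bounded.
- by rewrite divr_ge0// ltW.
- by rewrite lee_fin; lra.
Qed.

(** Otherwise a sequence of bad measures with growing horizons has a weak* cluster point; it lies in
    [W_cap_D1], while some bad measures come arbitrarily close to it. *)
Lemma occupation_near_W_cap_D1 y0 (e : R) : Y y0 -> 0 < e ->
  \forall T \near \oo, forall g : prob_on R G,
    closed_convex_hull (Gamma Y U f s T y0) g ->
    (rho_set q g (W_cap_D1 Y U f s y0) <= e%:E)%E.
Proof.
move=> Yy0 e0; apply: contrapT => nT.
have bad l : exists T (g : prob_on R G), [/\ (l < T)%N,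
    closed_convex_hull (Gamma Y U f s T y0) g &
    ~ (rho_set q g (W_cap_D1 Y U f s y0) <= e%:E)%E].
  apply: contrapT => nl; apply: nT; exists l.+1 => // T /= lT g hg.
  by apply: contrapT => ng; apply: nl; exists T, g.
have [T_ /choice[g_ hg_]] := choice bad.
have := @compact_prob_on R X _ G metX compact_graph.
move=> /(_ (g_ @ \oo) _ filterT)[g [_ gcl]].
have close l (r : R) : 0 < r -> exists2 i, (l <= i)%N & forall j, (j < l)%N ->
    `|\int[g_ i]_(z in G) q j z - \int[g]_(z in G) q j z| < r.
  move=> r0; have [|_ [[i li <-] hi]] := gcl (g_ @` [set i | (l <= i)%N]) _ _ (nbhs_test g l r0).
    by exists l => // i /= li; exists i.
  by exists i.
have Wg : W_cap_D1 Y U f s y0 g.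
  apply: W_cap_D1_limit => // l.
  (* One half of the tolerance leads from the cluster point to a measure of the closed hull, the
     other half from there into the hull itself. *)
  have r0 : 0 < l.+1%:R^-1 / 2 :> R by rewrite divr_gt0 ?invr_gt0.
  have [i li hi] := close l _ r0.
  have [iT cg _] := hg_ i.
  have [g' [cg' hg']] := cg _ (nbhs_test (g_ i) l r0).
  exists (T_ i), g'; split=> //; first exact: leq_ltn_trans li iT.
  move=> j jl; apply: ltW; rewrite [ltRHS]splitr.
  apply: le_lt_trans (ler_distD (\int[g_ i]_(z in G) q j z) _ _) _.
  by apply: ltrD; [exact: hg'|exact: hi].
have [N hN] := rho_test_le e0.
have [i Ni hi] := close N (e / 2) (ltac:(by rewrite divr_gt0)).
have [_ _] := hg_ i; apply; apply: le_trans (hN (g_ i) g _); last first.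
  by move=> j /hi/ltW.
by apply: ereal_inf_lbound; exists g.
Qed.

Lemma convex_hull_self (A : set (prob_on R G)) (g : prob_on R G) :
  A g -> convex_hull A g.
Proof.
move=> Ag; exists 1, (fun=> 1), (fun=> g); split=> //; first by rewrite big_ord1.
by move=> Q _; rewrite big_ord1 mul1e.
Qed.

(** The existence of any plan at all is a measurable selection from [U]; minimising the zero cost
    provides one. *)
Lemma Gamma_nonempty y0 T : Y y0 -> (0 < T)%N -> Gamma Y U f s T y0 !=set0.
Proof.
move=> Yy0 T0.
have [||p [p_plan _]] := @cost_to_go_selection (fun=> 0) 0.
- by move=> z; exact: cvg_cst.
- by move=> z _; rewrite normr0.
have [g hg] := Gamma_of_plan T0 p_plan Yy0.
by exists g, p => // Q mQ _; exact: hg.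
Qed.

Hypothesis value_limit : forall k : X -> R,
  {within Y `*` [set: Uhat], continuous k} ->
  exists2 v : 'rV[R]_n -> R, {within Y, continuous v} &
    forall y0, Y y0 -> value Y U f s k T y0 @[T --> \oo] --> v y0.

(** An optimal plan has cost close to [v y0], a lower bound for the cost of every point of
    [W_cap_D1]. The horizon thus depends on [k], but not on [g']. *)
Lemma near_optimal y0 (k : X -> R) (e : R) : Y y0 -> continuous k -> 0 < e ->
  \forall T \near \oo, exists2 g : prob_on R G, Gamma Y U f s T y0 g &
    forall g' : prob_on R G, W_cap_D1 Y U f s y0 g' ->
      \int[g]_(z in G) k z <= \int[g']_(z in G) k z + e.
Proof.
move=> Yy0 ck e0; have [|v cv hv] := value_limit (k := k); first exact: continuous_subspaceT.
have ckG : {within G, continuous k} by exact: continuous_subspaceT.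
have [K hK] := compact_within_continuous_bounded compact_graph (@ckG).
have /cvgrPdist_lt/(_ e e0) vT := hv y0 Yy0.
near=> T.
have T0 : (0 < T)%N by near: T; exact: nbhs_infty_gt.
have [p p_plan popt] := optimal_plan (@ckG) hK T Yy0.
have [g hg] := Gamma_of_plan T0 p_plan Yy0.
exists g; first by exists p => // Q mQ _; exact: hg.
have bk := bounded_measurable_within_continuous compact_graph (@ckG).
move=> g' Wg'.
rewrite (@Gamma_Rintegral p y0 T g)//; last by move=> Q mQ _; exact: hg.
rewrite -(Rintegral_trajectory_sum T p_plan Yy0 bk) popt -(valueE (@ckG) hK T Yy0).
have vk := W_cap_D1_limit_le (@ckG) (@cv) hv Yy0 Wg'.
have : `|v y0 - value Y U f s k T y0| < e by near: T.
by rewrite ltr_norml => /andP[h1 h2]; lra.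
Unshelve. all: by end_near. Qed.

Lemma continuous_bigsum (T : topologicalType) (I : Type) (r : seq I)
    (h : I -> T -> R) : (forall i, continuous (h i)) ->
  continuous (fun x => \sum_(i <- r) h i x).
Proof.
move=> ch; elim: r => [|i r ih] x.
  by under eq_fun do rewrite big_nil; exact: cvg_cst.
by under eq_fun do rewrite big_cons; apply: cvgD; [exact: ch|exact: ih].
Qed.

Lemma Rintegral_test_sum N (lambda : 'I_N -> R) (h : 'I_N -> X -> R) (g : prob_on R G) :
  (forall j z, G z -> h j z = q j z) ->
  \int[g]_(z in G) (\sum_j lambda j * h j z) =
  \sum_j lambda j * \int[g]_(z in G) q j z.
Proof.
move=> hq; transitivity (\int[g]_(z in G) (\sum_j lambda j * q j z)).
  by apply: eq_Rintegral => z /set_mem Gz; apply: eq_bigr => j _; rewrite hq.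
rewrite (@Rintegral_bounded_sum _ _ _ g _ mG 'I_N _ (fun j z => lambda j * q j z)).
  by apply: eq_bigr => j _; rewrite RintegralZl//; exact: bounded_measurable_integrable.
by move=> j; exact: bounded_measurableZ.
Qed.

Lemma convex_hull_test_segment (A : set (prob_on R G)) (g g' : prob_on R G) (t : R) :
  convex_hull A g -> convex_hull A g' -> 0 <= t <= 1 ->
  exists2 g'' : prob_on R G, convex_hull A g'' & forall j,
    \int[g'']_(z in G) q j z = \int[g]_(z in G) q j z +
      t * (\int[g']_(z in G) q j z - \int[g]_(z in G) q j z).
Proof.
move=> Ag Ag' t01; have [g'' Ag'' gE] := convex_hull_segment open_setC_graph Ag Ag' t01.
exists g'' => // j.
rewrite (@Rintegral_mixture _ _ _ g'' _ mG 2 (fun i => if i == ord0 then 1 - t else t)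
  (fun i => if i == ord0 then g else g'))//.
- by rewrite !big_ord_recl big_ord0/=; ring.
- by move=> i; case: ifP => _; have /andP[? ?] := t01; rewrite ?subr_ge0.
- move=> Q mQ _; apply: etrans (gE Q mQ) _.
  by rewrite !big_ord_recl big_ord0/= adde0.
Qed.

Lemma W_cap_D1_near_occupation y0 (e : R) : Y y0 -> 0 < e ->
  \forall T \near \oo, forall g : prob_on R G, W_cap_D1 Y U f s y0 g ->
    (rho_set q g (closed_convex_hull (Gamma Y U f s T y0)) <= e%:E)%E.
Proof.
move=> Yy0 e0; have [N hN] := rho_test_le e0.
(* The limits of the values are assumed for costs continuous on all of [Y] times [Uhat], while the
   [q j] are controlled on [G] only; hence their extensions [h j]. *)
have ext j : exists h : X -> R, continuous h /\ forall z, G z -> h z = q j z.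
  by have [h] := lipschitz_extension j; exists h.
have [h hq] := choice ext.
(* A squared distance below [E] forces every coordinate within [e / 2], as [rho_test_le] requires.
   The integrals of the [q j] lie in [-1, 1], so differences, and with them the separating
   coefficients, are bounded by 2. *)
pose E := (e / 2) ^+ 2.
have E0 : 0 < E by rewrite exprn_gt0// divr_gt0.
pose box := [set l : 'rV[R]_N | forall j, `[-2, 2]%classic (l ord0 j)].
have cbox : compact box.
  by apply: (@rV_compact R N (fun=> `[-2, 2]%classic)) => j; exact: segment_compact.
(* Moving each of the [N] coefficients by at most [r] changes the pairing with a difference of
   integrals by at most [2 * r * N <= E / 8]. *)
pose r := E / (16 * N.+1%:R).
have r0 : 0 < r by rewrite divr_gt0// mulr_gt0.
have [net [_ hnet]] := metrizes_net (metrizes_norm R N) cbox r0.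
have E8 : 0 < E / 8 by rewrite divr_gt0.
pose good T (l : 'rV[R]_N) := exists2 g : prob_on R G, Gamma Y U f s T y0 g &
  forall g' : prob_on R G, W_cap_D1 Y U f s y0 g' ->
    \sum_j l ord0 j * \int[g]_(z in G) q j z <=
    \sum_j l ord0 j * \int[g']_(z in G) q j z + E / 8.
have near_good : \forall T \near \oo, forall l, l \in net -> good T l.
  elim: net {hnet} => [|l net ih]; first by apply: nearW.
  have ck : continuous (fun z => \sum_j l ord0 j * h j z).
    apply: (continuous_bigsum (h := fun j z => l ord0 j * h j z)) => j z.
    by apply: cvgMr; have [+ _] := hq j; exact.
  have := near_optimal Yy0 ck E8.
  apply: filterS2 ih => T ih [g Gg hg] l'; rewrite inE => /orP[/eqP->|/ih//].
  exists g => // g' Wg'; have := hg g' Wg'.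
  have hqG (j : 'I_N) z : G z -> h j z = q j z by have [_] := hq j; exact.
  by rewrite !(@Rintegral_test_sum N (fun j => l ord0 j) (fun j => h j) _ hqG).
apply: filterS2 (nbhs_infty_gt 0) near_good => T T0 good_T g Wg.
pose x (j : 'I_N) := \int[g]_(z in G) q j z.
pose C := [set c : 'I_N -> R | exists2 g' : prob_on R G,
  convex_hull (Gamma Y U f s T y0) g' & c = fun j => \int[g']_(z in G) q j z].
have [|||[c [g' cg' ->] small]|[l lB sep]] := @convex_separation R N C x 2 E _ _ _ E0.
- have [g' Gg'] := Gamma_nonempty Yy0 T0.
  by eexists; exists g' => //; exact: convex_hull_self.
- move=> _ [g' _ ->] j; apply: le_trans (ler_normB _ _) _.
  by rewrite (_ : 2 = 1 + 1)// lerD// test_bounded.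
- move=> _ _ t [g1 cg1 ->] [g2 cg2 ->] t01.
  have [g3 cg3 g3E] := convex_hull_test_segment cg1 cg2 t01.
  by exists g3 => //; apply/funext => j; rewrite g3E.
- have : (rho q g g' <= e%:E)%E.
    apply: hN => j jN; rewrite leNgt; apply/negP => hj.
    move: small; apply/negP; rewrite -leNgt.
    rewrite (bigD1 (Ordinal jN))//= -[X in X <= _]addr0 lerD ?sumr_ge0//.
      rewrite /E -[leRHS]real_normK ?num_real// ler_pXn2r ?nnegrE ?divr_ge0 ?(ltW e0)//.
      by rewrite distrC ltW.
    by move=> i _; exact: sqr_ge0.
  apply: le_trans; apply: ereal_inf_lbound; exists g' => //.
  exact: subset_closure.
(* The separating vector is replaced by a point of the net. Its gap [E / 2] would be at most [E / 8]
   from this replacement plus [E / 8] from near-optimality. *)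
- exfalso.
  pose l0 : 'rV[R]_N := \row_j l j.
  have [|l' l'net ll'] := hnet l0.
    by move=> j; rewrite /= in_itv/= mxE -ler_norml lB.
  have [g' Gg' hg'] := good_T l' l'net.
  have := sep (fun j => \int[g']_(z in G) q j z) (ex_intro2 _ _ g' (convex_hull_self Gg') erefl).
  have := hg' g Wg; rewrite -lerBlDl -sumrB => opt.
  have dist : \sum_j (l j - l' ord0 j) * (\int[g']_(z in G) q j z - x j) <= E / 8.
    apply: (@le_trans _ _ (\sum_(j < N) r * 2)).
      apply: ler_sum => j _; apply: le_trans (ler_norm _) _; rewrite normrM.
      apply: ler_pM => //; last first.
        apply: le_trans (ler_normB _ _) _.
        by rewrite (_ : 2 = 1 + 1)// lerD// test_bounded.
      apply: le_trans (ltW ll'); rewrite [leRHS]/Num.Def.normr /= mx_normrE.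
      by apply/bigmax_geP; right; exists (ord0, j) => //=; rewrite !mxE.
    rewrite sumr_const card_ord -[_ *+ N]mulr_natr.
    have -> : E / 8 = r * 2 * N.+1%:R.
      by rewrite /r; field; rewrite addrC natr1 pnatr_eq0.
    apply: ler_wpM2l; first by rewrite mulr_ge0// ltW.
    by rewrite ler_nat.
  have : \sum_j l j * (\int[g']_(z in G) q j z - x j) =
    \sum_j (l j - l' ord0 j) * (\int[g']_(z in G) q j z - x j) +
    \sum_(j < N) (l' ord0 j * \int[g']_(z in G) q j z - l' ord0 j * \int[g]_(z in G) q j z).
    by rewrite -big_split/=; apply: eq_bigr => j _; rewrite /x; ring.
  by move=> -> ?; lra.
Qed.

Lemma rho_ge0 (g g' : prob_on R G) : (0 <= rho q g g')%E.
Proof. by apply: nneseries_ge0 => j _ _; rewrite lee_fin mulr_ge0. Qed.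

Lemma rho_set_ge0 (g : prob_on R G) A : (0 <= rho_set q g A)%E.
Proof. by apply: le_ereal_inf_tmp => _ [g' _ <-]; exact: rho_ge0. Qed.

Lemma rho_H_cvg y0 : Y y0 ->
  rho_H q (closed_convex_hull (Gamma Y U f s T y0)) (W_cap_D1 Y U f s y0)
    @[T --> \oo] --> 0%E.
Proof.
move=> Yy0.
(* A supremum over the empty set would be [-oo], so a point of the hull is exhibited; at [T = 0]
   there is none. *)
have rho_H_ge0 T : (0 < T)%N -> (0 <= rho_H q
    (closed_convex_hull (Gamma Y U f s T y0)) (W_cap_D1 Y U f s y0))%E.
  move=> T0; have [g Gg] := Gamma_nonempty Yy0 T0; rewrite /rho_H le_max.
  apply/orP; left; apply: le_trans (rho_set_ge0 g (W_cap_D1 Y U f s y0)) _.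
  apply: ereal_sup_ubound; exists g => //.
  by apply: subset_closure; exact: convex_hull_self.
have rho_H_le e : 0 < e -> \forall T \near \oo, (rho_H q
    (closed_convex_hull (Gamma Y U f s T y0)) (W_cap_D1 Y U f s y0) <= e%:E)%E.
  move=> e0; have := W_cap_D1_near_occupation Yy0 e0.
  apply: filterS2 (occupation_near_W_cap_D1 Yy0 e0) => T h1 h2.
  by rewrite /rho_H ge_max; apply/andP; split; apply: ge_ereal_sup => _ [g hg <-];
    [exact: h1|exact: h2].
apply/fine_cvgP; split.
  have := rho_H_le 1 ltr01; apply: filterS2 (nbhs_infty_gt 0) => T T0 h1.
  by rewrite ge0_fin_numE ?rho_H_ge0// (le_lt_trans h1)// ltry.
apply/cvgrPdist_le => e e0; have := rho_H_le e e0.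
apply: filterS2 (nbhs_infty_gt 0) => T T0 h1; rewrite sub0r normrN /=.
have h0 := rho_H_ge0 T T0.
rewrite ger0_norm ?fine_ge0// -lee_fin fineK//.
by rewrite ge0_fin_numE// (le_lt_trans h1)// ltry.
Qed.

End test_functions.
End dynamics.

Theorem corollary5p3 (R : realType) (n : nat) (Uhat : pmetricType R)
  (S : ptopologicalType) (d : measure_display) (Omega : measurableType d)
  (P : probability Omega R) (s : nat -> {RV P >-> borel S})
  (Y : set 'rV[R]_n) (U : 'rV[R]_n -> set Uhat)
  (f : 'rV[R]_n -> Uhat -> S -> 'rV[R]_n)
  (q : nat -> 'rV[R]_n * Uhat -> R)
  (Y_nonempty : Y !=set0) (Y_compact : compact Y)
  (Uhat_compact : compact [set: Uhat])
  (S_polish : polish_space R S)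
  (f_bounded : exists M : R, forall y u x, Y y -> `|f y u x| <= M)
  (f_continuous : forall x,
    {within Y `*` [set: Uhat], continuous (fun z => f z.1 z.2 x)})
  (f_measurable : forall y u, Y y ->
    measurable_fun [set: borel S] (f y u : _ -> borel 'rV[R]_n))
  (s_iid : iid s)
  (U_usc : upper_semicontinuous_on Y U)
  (U_nonempty : forall y, Y y -> U y !=set0)
  (U_compact : forall y, Y y -> compact (U y))
  (f_invariant : forall y u x, Y y -> U y u -> Y (f y u x))
  (q_dense : dense_lipschitz_seq (graph_of Y U) q)
  (v_continuous : forall k : 'rV[R]_n * Uhat -> R,
    {within Y `*` [set: Uhat], continuous k} ->
    exists2 v : 'rV[R]_n -> R,
      {within Y, continuous v} &
      forall y0, Y y0 -> value Y U f s k T y0 @[T --> \oo] --> v y0) :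
  forall y0, Y y0 ->
    rho_H q (closed_convex_hull (Gamma Y U f s T y0)) (W_cap_D1 Y U f s y0)
      @[T --> \oo] --> 0%E.

Proof.
move=> y0 Yy0.
by apply: (@rho_H_cvg R n Uhat S d Omega P s Y U f) => //.
Qed.
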